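(* Let $N\ge 2$, let $\Omega\subset\mathbb{R}^N$ be a domain (a nonempty connected open set), and let $H:\Omega\to\mathbb{R}$ be locally Lipschitz continuous in $\Omega$. Let $u:\Omega\to\mathbb{R}$ be a lower semicontinuous function that is a viscosity supersolution of $M(u)=NH$ in $\Omega$, that is, $M(u)\le NH$ in $\Omega$ in the viscosity sense, and let $v:\Omega\to\mathbb{R}$ be an upper semicontinuous function that is a viscosity subsolution of the same equation, that is, $M(v)\ge NH$ in $\Omega$ in the viscosity sense. Assume that $u\ge v$ in $\Omega$ and that $u(x_0)=v(x_0)$ at some point $x_0\in\Omega$. Then $u\equiv v$ in $\Omega$.
   Context: For a $C^2$ function $\varphi$, $M(\varphi):=\operatorname{div}\left(\frac{D\varphi}{\sqrt{1+|D\varphi|^2}}\right)$, where $D\varphi$ is the gradient of $\varphi$. The equation $M(u)=NH$ is the prescribed mean curvature equation. Viscosity sense (standard definition): a lower semicontinuous $u:\Omega\to\mathbb{R}$ is a viscosity supersolution of $M(u)=NH$ in $\Omega$ (written $M(u)\le NH$) if for every $\varphi\in C^2(\Omega)$ and every $x\in\Omega$ at which $u-\varphi$ attains a local minimum, $M(\varphi)(x)\le NH(x)$. An upper semicontinuous $v:\Omega\to\mathbb{R}$ is a viscosity subsolution (written $M(v)\ge NH$) if for every $\varphi\in C^2(\Omega)$ and every $x\in\Omega$ at which $v-\varphi$ attains a local maximum, $M(\varphi)(x)\ge NH(x)$. *)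

(* Defs.v *)
From HB Require Import structures.
From mathcomp Require Import all_boot all_order all_algebra.
From mathcomp Require Import all_classical all_reals all_analysis.
Import Order.TTheory GRing.Theory Num.Theory.
Import numFieldNormedType.Exports.

Set Implicit Arguments.
Unset Strict Implicit.
Unset Printing Implicit Defensive.

Local Open Scope classical_set_scope.
Local Open Scope ring_scope.

(* Functions on an open set Omega of R^N are represented by total functions
   on 'rV[R]_N whose values outside Omega are never used. *)

(* The norm that the library puts on 'rV[R]_N is the max norm: it gives the
   usual topology and the usual Lipschitz functions, but |D phi| has to be the
   Euclidean norm. *)
Definition norm2 (R : realType) (N : nat) (p : 'rV[R]_N) : R :=
  Num.sqrt (\sum_(i < N) p 0 i ^+ 2).

Definition partial (R : realType) (N : nat) (i : 'I_N) (f : 'rV[R]_N -> R) :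
    'rV[R]_N -> R :=
  'D_(delta_mx 0 i) f.

Definition grad (R : realType) (N : nat) (f : 'rV[R]_N -> R) (x : 'rV[R]_N) :
    'rV[R]_N :=
  \row_(i < N) partial i f x.

Definition divergence (R : realType) (N : nat) (F : 'rV[R]_N -> 'rV[R]_N)
    (x : 'rV[R]_N) : R :=
  \sum_(i < N) partial i (fun y => F y 0 i) x.

Definition mean_curvature_op (R : realType) (N : nat) (phi : 'rV[R]_N -> R) :
    'rV[R]_N -> R :=
  divergence (fun x => (Num.sqrt (1 + norm2 (grad phi x) ^+ 2))^-1 *: grad phi x).

(* For open Omega, continuity at the points of Omega in the ambient space is
   the same as continuity on the subspace Omega. *)
Fixpoint class_C (R : realType) (N : nat) (k : nat) (Omega : set 'rV[R]_N)
    (f : 'rV[R]_N -> R) : Prop :=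
  (forall x, Omega x -> {for x, continuous f}) /\
  match k with
  | 0%N => True
  | k'.+1 => forall i : 'I_N,
      (forall x, Omega x -> derivable f x (delta_mx 0 i)) /\
      class_C k' Omega (partial i f)
  end.

(* The library's [locally [lipschitz _ | _ in Omega]] quantifies over all base
   points of Omega `*` Omega, not only over the diagonal. *)
Definition locally_lipschitz (R : realType) (N : nat) (Omega : set 'rV[R]_N)
    (f : 'rV[R]_N -> R) : Prop :=
  forall x, Omega x ->
    exists2 U, nbhs x U & [lipschitz f y | y in U `&` Omega].

Definition upper_semicontinuous (X : topologicalType) (R : numFieldType)
    (f : X -> \bar R) : Prop :=
  forall x a, (f x < a%:E)%E ->
    exists2 V, nbhs x V & forall y, V y -> (f y < a%:E)%E.

(* Points outside Omega are isolated in [subspace Omega], so they add no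
   condition to semicontinuity. *)
Definition lsc_on (R : realType) (N : nat) (Omega : set 'rV[R]_N)
    (u : 'rV[R]_N -> R) : Prop :=
  @lower_semicontinuous (subspace Omega) R (EFin \o u).

Definition usc_on (R : realType) (N : nat) (Omega : set 'rV[R]_N)
    (v : 'rV[R]_N -> R) : Prop :=
  @upper_semicontinuous (subspace Omega) R (EFin \o v).

Definition local_min_on (R : realType) (N : nat) (Omega : set 'rV[R]_N)
    (f : 'rV[R]_N -> R) (x : 'rV[R]_N) : Prop :=
  \forall y \near x, Omega y -> f x <= f y.

Definition local_max_on (R : realType) (N : nat) (Omega : set 'rV[R]_N)
    (f : 'rV[R]_N -> R) (x : 'rV[R]_N) : Prop :=
  \forall y \near x, Omega y -> f y <= f x.

Definition viscosity_supersolution (R : realType) (N : nat)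
    (Omega : set 'rV[R]_N) (H u : 'rV[R]_N -> R) : Prop :=
  lsc_on Omega u /\
  forall phi : 'rV[R]_N -> R, class_C 2%N Omega phi ->
  forall x, Omega x -> local_min_on Omega (fun y => u y - phi y) x ->
    mean_curvature_op phi x <= N%:R * H x.

Definition viscosity_subsolution (R : realType) (N : nat)
    (Omega : set 'rV[R]_N) (H v : 'rV[R]_N -> R) : Prop :=
  usc_on Omega v /\
  forall phi : 'rV[R]_N -> R, class_C 2%N Omega phi ->
  forall x, Omega x -> local_max_on Omega (fun y => v y - phi y) x ->
    N%:R * H x <= mean_curvature_op phi x.

(* Main.v *)
Require Import Defs.
From mathcomp Require Import all_boot all_order all_algebra.
From mathcomp Require Import all_classical all_reals all_analysis.
From mathcomp Require Import zify ring lra.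
Import Order.TTheory GRing.Theory Num.Theory.
Import numFieldNormedType.Exports.

Set Implicit Arguments.
Unset Strict Implicit.
Unset Printing Implicit Defensive.

Local Open Scope classical_set_scope.
Local Open Scope ring_scope.

(** The contact set of [u] and [v] is nonempty, and by semicontinuity it is closed in [Omega], so
    connectedness reduces the theorem to its openness ([contact_open]). If it were not open, a
    non-contact point close to a contact point would have a nearest contact point [y1], and some
    ball would meet the contact set only at its boundary point [y1]. The Hopf-type lemma [hopf]
    excludes this.

    Two difficulties stand in the way of a classical Hopf argument. Neither function is
    differentiable, so [u - v] satisfies no equation; and ellipticity degenerates when slopes become
    large.

    For the first difficulty there is a theorem on sums in traced form ([sum_superjets0],
    [sum_superjets], [sum_superjets_frames]). No second derivatives are extracted almost everywhere.
    Sup-convolutions are semiconvex, hence uniform limits of polynomials ([approximable_sup]); they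
    are viscosity subsolutions of Poisson equations near the touching point, and are compared with
    harmonic polynomials ([dirichlet]) having almost the same boundary values. The trace is taken
    along two frames ([frames]) matched by the rotation of R^(N+1) that carries one tangent plane to
    the other, so that a penalty depending on [y - x] sees only a rank-one difference.

    For the second difficulty, [pair_lipschitz] proves the two-point estimate
    [v x - u y <= L0 * nrm (x - y)] near a contact point. It is an interior gradient estimate by
    doubling of variables: a steep convex function [chi] is applied to both functions minus a
    paraboloid, and the gain from the second derivative of [chi] outweighs every loss when the power
    is large. The slope [1 / tau] allowed in the estimate is halved step by step ([good_step]),
    starting from an enormous one; each step rules out a touching pair ([lip_no_touch]).

    For the Hopf lemma, points of the slightly lowered graph of [v] are surrounded by spheres of
    R^(N+1) of variable radius [(m + e * h x) ^+ 2], where [h] is a barrier positive inside the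
    ball. At a first touching with the graph of [u], [touching] bounds the curvature-weighted trace
    of the Hessian of the radius by terms in [H] plus an error quartic in its gradient. A barrier of
    large exponent violates this bound ([hopf_numerics]). *)

(** * Euclidean inner product and norm on row vectors *)

Section InnerProduct.
Variables (R : realType) (N : nat).
Implicit Types (x y z d : 'rV[R]_N) (A X : 'M[R]_N).

Definition dot x y : R := \sum_(i < N) x 0 i * y 0 i.

Lemma dotC x y : dot x y = dot y x.
Proof. by apply: eq_bigr => i _; rewrite mulrC. Qed.

Lemma dotDl x y z : dot (x + y) z = dot x z + dot y z.
Proof. by rewrite -big_split; apply: eq_bigr => i _; rewrite mxE mulrDl. Qed.

Lemma dotDr x y z : dot z (x + y) = dot z x + dot z y.
Proof. by rewrite dotC dotDl !(dotC z). Qed.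

Lemma dotZl k x y : dot (k *: x) y = k * dot x y.
Proof. by rewrite mulr_sumr; apply: eq_bigr => i _; rewrite mxE mulrA. Qed.

Lemma dotZr k x y : dot x (k *: y) = k * dot x y.
Proof. by rewrite dotC dotZl dotC. Qed.

Lemma dotNl x y : dot (- x) y = - dot x y.
Proof. by rewrite -scaleN1r dotZl mulN1r. Qed.

Lemma dotNr x y : dot x (- y) = - dot x y.
Proof. by rewrite dotC dotNl dotC. Qed.

Lemma dot0l x : dot 0 x = 0.
Proof. by rewrite -(scale0r x) dotZl mul0r. Qed.

Lemma dot0r x : dot x 0 = 0.
Proof. by rewrite dotC dot0l. Qed.

Definition dotE := (dotDl, dotDr, dotNl, dotNr, dotZl, dotZr, dot0l, dot0r).

Lemma sq_ge0 x : 0 <= dot x x.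
Proof. by apply: sumr_ge0 => i _; rewrite -expr2 sqr_ge0. Qed.

Lemma sq_eq0 x : dot x x = 0 -> x = 0.
Proof.
move=> /eqP; rewrite psumr_eq0 => [/allP x0|i _]; last by rewrite -expr2 sqr_ge0.
apply/rowP => i; rewrite mxE; apply/eqP.
by have := x0 i (mem_index_enum i); rewrite /= -expr2 sqrf_eq0.
Qed.

Lemma sq_gt0 x : x != 0 -> 0 < dot x x.
Proof.
move=> x0; rewrite lt_neqAle sq_ge0 andbT eq_sym.
by apply: contra x0 => /eqP /sq_eq0 ->.
Qed.

Lemma cauchy_schwarz x y : dot x y ^+ 2 <= dot x x * dot y y.
Proof.
have [->|x0] := eqVneq x 0; first by rewrite !dotE; lra.
have xx := sq_gt0 x0.
have := sq_ge0 (dot x x *: y - dot x y *: x).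
rewrite !dotE (dotC y x) => H.
have : 0 <= dot x x * (dot x x * dot y y - dot x y ^+ 2) by nra.
by rewrite pmulr_rge0// subr_ge0.
Qed.

Definition nrm x : R := Num.sqrt (dot x x).

Lemma nrm_ge0 x : 0 <= nrm x. Proof. exact: sqrtr_ge0. Qed.

Lemma nrm_sq x : nrm x ^+ 2 = dot x x.
Proof. by rewrite sqr_sqrtr// sq_ge0. Qed.

Lemma nrm0 : nrm 0 = 0. Proof. by rewrite /nrm dot0l sqrtr0. Qed.

Lemma nrm_eq0 x : nrm x = 0 -> x = 0.
Proof. by move=> x0; apply: sq_eq0; rewrite -nrm_sq x0 expr0n. Qed.

Lemma nrmN x : nrm (- x) = nrm x.
Proof. by rewrite /nrm !dotE opprK. Qed.

Lemma nrmB x y : nrm (x - y) = nrm (y - x).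
Proof. by rewrite -nrmN opprB. Qed.

Lemma nrmZ k x : nrm (k *: x) = `|k| * nrm x.
Proof. by rewrite /nrm !dotE mulrA -expr2 sqrtrM ?sqr_ge0// sqrtr_sqr. Qed.

Lemma ler_dot x y : `|dot x y| <= nrm x * nrm y.
Proof.
rewrite -(@ler_pXn2r _ 2)// ?nnegrE ?mulr_ge0 ?nrm_ge0//.
by rewrite exprMn !nrm_sq real_normK ?num_real// cauchy_schwarz.
Qed.

Lemma ler_nrmD x y : nrm (x + y) <= nrm x + nrm y.
Proof.
rewrite -(@ler_pXn2r _ 2)// ?nnegrE ?addr_ge0 ?nrm_ge0//.
rewrite sqrrD !nrm_sq !dotE (dotC y x).
by have := ler_dot x y; rewrite ler_norml => /andP[_]; lra.
Qed.

Lemma ler_nrm_sq x k : 0 <= k -> (nrm x <= k) = (dot x x <= k ^+ 2).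
Proof. by move=> k0; rewrite -nrm_sq ler_pXn2r// nnegrE nrm_ge0. Qed.

Lemma ltr_nrm_sq x k : 0 <= k -> (nrm x < k) = (dot x x < k ^+ 2).
Proof. by move=> k0; rewrite -nrm_sq ltr_pXn2r// nnegrE nrm_ge0. Qed.

Lemma coord_le_norm x i : `|x 0 i| <= `|x|.
Proof.
rewrite [leRHS]/Num.Def.normr /= mx_normrE; apply/bigmax_geP; right => /=.
by exists (0, i).
Qed.

Lemma norm_le_nrm x : `|x| <= nrm x.
Proof.
rewrite [leLHS]/Num.Def.normr /= mx_normrE; apply/bigmax_leP; split=> [|[i j] _ /=].
  exact: nrm_ge0.
rewrite ord1 -(@ler_pXn2r _ 2)// ?nnegrE ?nrm_ge0// nrm_sq real_normK ?num_real//.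
rewrite /dot (bigD1 j)//= -expr2 lerDl; apply: sumr_ge0 => k _.
by rewrite -expr2 sqr_ge0.
Qed.

Lemma sq_le_norm x : dot x x <= N%:R * `|x| ^+ 2.
Proof.
rewrite -[N in N%:R]card_ord mulr_natl -sumr_const; apply: ler_sum => i _.
rewrite -expr2 -[leLHS]real_normK ?num_real//.
by rewrite ler_pXn2r ?nnegrE// coord_le_norm.
Qed.

(** The topology comes from the max norm while all estimates are Euclidean. The two norms are
    equivalent, so neighbourhoods can be handled through squared Euclidean distances throughout. *)
Lemma near_sqP x (P : set 'rV[R]_N) :
  (\forall y \near x, P y) <->
  exists2 r, 0 < r & forall y, dot (y - x) (y - x) < r -> P y.
Proof.
split=> [/nbhs_normP[e /= e0 eP]|[r r0 rP]].
  exists (e ^+ 2) => [|y yx]; first by rewrite exprn_gt0.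
  apply: eP; rewrite /ball_ /= distrC; apply: le_lt_trans (norm_le_nrm _) _.
  by rewrite ltr_nrm_sq// ltW.
apply/nbhs_normP; exists (Num.min 1 (r / N.+1%:R)) => /=.
  by rewrite lt_min ltr01 divr_gt0.
move=> y; rewrite /ball_ /= distrC lt_min => /andP[y1 yr].
apply: rP; apply: le_lt_trans (sq_le_norm _) _.
have {}yr : `|y - x| * N.+1%:R < r by rewrite -ltr_pdivlMr.
apply: le_lt_trans yr; rewrite expr2 mulrCA ler_wpM2l// -natr1.
have : N%:R * `|y - x| <= N%:R * 1 by rewrite ler_wpM2l// ltW.
lra.
Qed.

Lemma cvg_dot (T : Type) (F : set_system T) (f g : T -> 'rV[R]_N) a b :
  Filter F -> f @ F --> a -> g @ F --> b ->
  (fun t => dot (f t) (g t)) @ F --> dot a b.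
Proof.
move=> FF fa gb; apply: cvg_big => [|i _]; first exact: (@add_continuous R).
apply: cvgM.
- exact: (cvg_comp f (fun M : 'rV[R]_N => M 0 i) fa (@coord_continuous _ 1 N 0 i a)).
- exact: (cvg_comp g (fun M : 'rV[R]_N => M 0 i) gb (@coord_continuous _ 1 N 0 i b)).
Qed.

End InnerProduct.

Lemma dot_mulmx (R : realType) (N M : nat) (x : 'rV[R]_N) (y : 'rV[R]_M) (A : 'M[R]_(N, M)) :
  dot (x *m A) y = dot x (y *m A^T).
Proof.
rewrite /dot; under eq_bigr do rewrite mxE mulr_suml.
rewrite exchange_big; apply: eq_bigr => i _.
rewrite mxE mulr_sumr; apply: eq_bigr => j _.
by rewrite mxE -mulrA [_ * y 0 j]mulrC.
Qed.

(** * Semicontinuity and minimization on compact sets *)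

Section LowerSemicontinuous.
Variable R : realType.

(** Semicontinuity is relative to [K], so values off [K] are irrelevant. Upper semicontinuity is
    always expressed as [lsc_within] of the opposite function. *)
Definition lsc_within (T : topologicalType) (K : set T) (f : T -> R) :=
  forall x, K x -> forall a, a < f x -> \forall y \near x, K y -> a < f y.

Lemma compact_lsc_min (T : topologicalType) (K : set T) (f : T -> R) :
  compact K -> K !=set0 -> lsc_within K f ->
  exists2 x, K x & forall y, K y -> f x <= f y.
Proof.
move=> Kc [x0 Kx0] flsc.
pose D := [set c : R | exists2 y, K y & f y < c].
(* The nonempty sublevel sets of [f] in [K] generate a proper filter, and a cluster point of it
   cannot lie above any value of [f]. *)
pose G := filter_from D (fun c => [set y | K y /\ f y < c]).
have GF : Filter G.
  apply: filter_from_filter => [|c c' [y Ky yc] [y' Ky' yc']].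
    by exists (f x0 + 1), x0 => //; rewrite ltrDl.
  exists (Num.min c c').
    by case: (leP c c') => _; [exists y|exists y'].
  by move=> z /= [Kz]; rewrite lt_min => /andP[].
have GP : ProperFilter G.
  apply: filter_from_proper => // c [y Ky yc].
  by exists y.
have GK : G K by exists (f x0 + 1); [exists x0 => //; rewrite ltrDl|move=> z []].
have [x [Kx xc]] := Kc G GP GK.
exists x => // y Ky; rewrite leNgt; apply/negP => yx.
have yxm : f y < (f y + f x) / 2 by rewrite ltr_pdivlMr//; lra.
have mx : (f y + f x) / 2 < f x by rewrite ltr_pdivrMr//; lra.
have Gm : G [set z | K z /\ f z < (f y + f x) / 2].
  by exists ((f y + f x) / 2) => //; exists y.
have [z [[Kz zm] /(_ Kz)]] := xc _ _ Gm (flsc x Kx _ mx).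
by move=> /(lt_trans zm); rewrite ltxx.
Qed.

Lemma lsc_within_cts (T : topologicalType) (K : set T) (f : T -> R) :
  (forall x, K x -> {for x, continuous f}) -> lsc_within K f.
Proof.
by move=> fc x Kx a /(cvgr_gt _ (fc x Kx)); apply: filterS.
Qed.

Lemma lsc_withinD (T : topologicalType) (K : set T) (f1 f2 : T -> R) :
  lsc_within K f1 -> lsc_within K f2 -> lsc_within K (fun x => f1 x + f2 x).
Proof.
move=> h1 h2 x Kx a ax; pose e := (f1 x + f2 x - a) / 2.
have e0 : 0 < e by rewrite divr_gt0// subr_gt0.
have H1 : f1 x - e < f1 x by lra.
have H2 : f2 x - e < f2 x by lra.
apply: filterS2 (h1 x Kx _ H1) (h2 x Kx _ H2) => y l1 l2 Ky.
have := l1 Ky; have := l2 Ky; rewrite /e; lra.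
Qed.

End LowerSemicontinuous.

(** * Linear and quadratic forms *)

Section QuadraticForms.
Variables (R : realType) (N : nat).
Implicit Types (w e d : 'rV[R]_N) (Q X : 'M[R]_N).

Definition qf Q d : R := dot (d *m Q) d.

Definition is_qf (q : 'rV[R]_N -> R) := exists2 Q, Q^T = Q & forall d, q d = qf Q d.

Definition is_lf (l : 'rV[R]_N -> R) := exists c, forall d, l d = dot c d.

Lemma qf_tr Q d : qf Q^T d = qf Q d.
Proof. by rewrite /qf dot_mulmx trmxK dotC. Qed.

Lemma qfD Q Q' d : qf (Q + Q') d = qf Q d + qf Q' d.
Proof. by rewrite /qf mulmxDr dotDl. Qed.

Lemma qfZ k Q d : qf (k *: Q) d = k * qf Q d.
Proof. by rewrite /qf -scalemxAr dotZl. Qed.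

Lemma qfN Q d : qf (- Q) d = - qf Q d.
Proof. by rewrite -scaleN1r qfZ mulN1r. Qed.

Lemma qf_scalar k d : qf k%:M d = k * dot d d.
Proof. by rewrite /qf mul_mx_scalar dotZl. Qed.

Lemma qfZr k Q d : qf Q (k *: d) = k ^+ 2 * qf Q d.
Proof. by rewrite /qf -scalemxAl !dotE mulrA -expr2. Qed.

Lemma qfNr Q d : qf Q (- d) = qf Q d.
Proof. by rewrite -scaleN1r qfZr sqrrN expr1n mul1r. Qed.

Lemma qf0r Q : qf Q 0 = 0.
Proof. by rewrite /qf dot0r. Qed.

(** A matrix and its symmetric part define the same form, so symmetry in [is_qf] costs nothing. *)
Lemma is_qfP (q : 'rV[R]_N -> R) Q : (forall d, q d = qf Q d) -> is_qf q.
Proof.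
move=> qE; exists (2^-1 *: (Q + Q^T)).
  by rewrite linearZ /= linearD /= trmxK addrC.
by move=> d; rewrite qfZ qfD qf_tr qE; lra.
Qed.

Lemma is_qfD q1 q2 : is_qf q1 -> is_qf q2 -> is_qf (fun d => q1 d + q2 d).
Proof.
move=> [Q1 _ q1E] [Q2 _ q2E]; apply: (@is_qfP _ (Q1 + Q2)) => d.
by rewrite qfD q1E q2E.
Qed.

Lemma is_qfZ k q : is_qf q -> is_qf (fun d => k * q d).
Proof. by move=> [Q _ qE]; apply: (@is_qfP _ (k *: Q)) => d; rewrite qfZ qE. Qed.

Lemma is_qf_lf l1 l2 : is_lf l1 -> is_lf l2 -> is_qf (fun d => l1 d * l2 d).
Proof.
move=> [c1 l1E] [c2 l2E]; apply: (@is_qfP _ (c1^T *m c2)) => d.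
rewrite l1E l2E /qf mulmxA [d *m _]mx11_scalar mul_scalar_mx dotZl; congr (_ * _).
rewrite mxE dotC; apply: eq_bigr => i _; by rewrite mxE.
Qed.

Lemma is_qf_sq : is_qf (fun d => dot d d).
Proof. by apply: (@is_qfP _ 1%:M) => d; rewrite qf_scalar mul1r. Qed.

Lemma is_lfD l1 l2 : is_lf l1 -> is_lf l2 -> is_lf (fun d => l1 d + l2 d).
Proof. by move=> [c1 l1E] [c2 l2E]; exists (c1 + c2) => d; rewrite dotDl l1E l2E. Qed.

Lemma is_lfZ k l : is_lf l -> is_lf (fun d => k * l d).
Proof. by move=> [c lE]; exists (k *: c) => d; rewrite dotZl lE. Qed.

Lemma sq_mulmx_le Q : exists2 K : R, 0 <= K &
  forall d, dot (d *m Q) (d *m Q) <= K ^+ 2 * dot d d.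
Proof.
exists (Num.sqrt (\sum_j dot (row j Q^T) (row j Q^T))); first exact: sqrtr_ge0.
move=> d; rewrite sqr_sqrtr; last by apply: sumr_ge0 => j _; exact: sq_ge0.
rewrite mulr_suml; apply: ler_sum => j _.
have -> : (d *m Q) 0 j = dot (row j Q^T) d.
  by rewrite mxE; apply: eq_bigr => i _; rewrite !mxE mulrC.
by rewrite -expr2 cauchy_schwarz.
Qed.

Lemma qf_bound Q : exists2 K : R, 0 <= K & forall d e, `|dot (d *m Q) e| <= K * (nrm d * nrm e).
Proof.
have [K K0 KQ] := sq_mulmx_le Q; exists K => // d e.
apply: le_trans (ler_dot _ _) _; rewrite mulrA ler_wpM2r ?nrm_ge0//.
by rewrite ler_nrm_sq ?mulr_ge0 ?nrm_ge0// exprMn nrm_sq.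
Qed.

Lemma is_qf_bound q : is_qf q -> exists2 K : R, 0 <= K & forall d, `|q d| <= K * dot d d.
Proof.
move=> [Q _ qE]; have [K K0 KQ] := qf_bound Q; exists K => // d.
by rewrite qE -nrm_sq expr2; exact: KQ.
Qed.

Lemma is_lf_bound l : is_lf l -> exists2 K : R, 0 <= K & forall d, `|l d| <= K * nrm d.
Proof.
by move=> [c lE]; exists (nrm c); [exact: nrm_ge0|move=> d; rewrite lE ler_dot].
Qed.

(** Young's inequality on the cross term. In the theorem on sums it moves a pair of maximizers back
    to the diagonal, at a price paid by the sup-convolution penalty. *)
Lemma qf_perturb Q k : 0 < k -> exists2 C : R, 0 < C &
  forall w e, qf Q (w + e) <= qf Q w + k * dot w w + C * dot e e.
Proof.
move=> k0; have [K K0 KQ] := qf_bound Q.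
exists (K + K ^+ 2 / k + 1); first by rewrite !(ltr_wpDl, ltr01, addr_ge0, divr_ge0, sqr_ge0)// ltW.
move=> w e; rewrite /qf mulmxDl !dotE.
have := KQ w e; have := KQ e w; have := KQ e e.
rewrite !ler_norml => /andP[_ H1] /andP[_ H2] /andP[_ H3].
rewrite -(nrm_sq w) -(nrm_sq e).
set a := nrm w in H1 H2 H3 *; set b := nrm e in H1 H2 H3 *.
have : 0 <= (k * a - K * b) ^+ 2 / k by rewrite divr_ge0 ?sqr_ge0// ltW.
have -> : (k * a - K * b) ^+ 2 / k = k * a ^+ 2 - 2 * K * a * b + K ^+ 2 / k * b ^+ 2.
  by field; rewrite gt_eqF.
have := sqr_ge0 b; nra.
Qed.

End QuadraticForms.

(** * Pointwise second-order Taylor expansions and their calculus *)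

Section Jets.
Variables (R : realType) (N : nat).
Implicit Types (f g r l q : 'rV[R]_N -> R) (x d p : 'rV[R]_N).

Definition littleo2 r := forall k, 0 < k -> \forall d \near (0 : 'rV[R]_N), `|r d| <= k * dot d d.

Lemma littleo2D r1 r2 : littleo2 r1 -> littleo2 r2 -> littleo2 (fun d => r1 d + r2 d).
Proof.
move=> h1 h2 k k0; have k20 : 0 < k / 2 by rewrite divr_gt0.
near=> d; apply: le_trans (ler_normD _ _) _.
have H1 : `|r1 d| <= k / 2 * dot d d by near: d; exact: h1.
have H2 : `|r2 d| <= k / 2 * dot d d by near: d; exact: h2.
lra.
Unshelve. all: by end_near. Qed.

Lemma littleo2_bdd a r K : (\forall d \near (0 : 'rV[R]_N), `|a d| <= K) ->
  littleo2 r -> littleo2 (fun d => a d * r d).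
Proof.
move=> aK h k k0.
have K0 : 0 < `|K| + 1 by rewrite ltr_wpDl.
have kK0 : 0 < k / (`|K| + 1) by rewrite divr_gt0.
near=> d.
have H1 : `|r d| <= k / (`|K| + 1) * dot d d by near: d; exact: h.
have H2 : `|a d| <= `|K| + 1.
  apply: (@le_trans _ _ K); first by near: d.
  by rewrite (le_trans (ler_norm _))// lerDl.
rewrite normrM; apply: (@le_trans _ _ ((`|K| + 1) * (k / (`|K| + 1) * dot d d))).
  exact: ler_pM.
by rewrite mulrA [(_ + 1) * _]mulrC divfK ?gt_eqF.
Unshelve. all: by end_near. Qed.

Lemma littleo2Z k r : littleo2 r -> littleo2 (fun d => k * r d).
Proof. by apply: (@littleo2_bdd (fun=> k) _ `|k|); near=> d. Unshelve. all: by end_near. Qed.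

Lemma littleo2_le r r' : (\forall d \near (0 : 'rV[R]_N), `|r d| <= `|r' d|) ->
  littleo2 r' -> littleo2 r.
Proof.
move=> rr h k k0; near=> d; apply: (@le_trans _ _ `|r' d|); first by near: d.
by near: d; exact: h.
Unshelve. all: by end_near. Qed.

Lemma littleo2_sq a : (forall k, 0 < k -> \forall d \near (0 : 'rV[R]_N), `|a d| <= k) ->
  littleo2 (fun d => a d * dot d d).
Proof.
move=> h k k0; near=> d; rewrite normrM (ger0_norm (sq_ge0 _)) ler_wpM2r ?sq_ge0//.
by near: d; exact: h.
Unshelve. all: by end_near. Qed.

Lemma near_nrm_small k : 0 < k -> \forall d \near (0 : 'rV[R]_N), nrm d <= k.
Proof.
move=> k0; apply/near_sqP; exists (k ^+ 2); first by rewrite exprn_gt0.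
by move=> d; rewrite subr0 -(ltr_nrm_sq _ (ltW k0)); exact: ltW.
Qed.

Lemma lf_small l : is_lf l -> forall k, 0 < k -> \forall d \near (0 : 'rV[R]_N), `|l d| <= k.
Proof.
move=> /is_lf_bound[K K0 lK] k k0; near=> d.
apply: (le_trans (lK d)); apply: (@le_trans _ _ (K * (k / (K + 1)))).
  rewrite ler_wpM2l//; near: d; apply: near_nrm_small.
  by rewrite divr_gt0 ?ltr_wpDl.
rewrite mulrCA -[leRHS]mulr1 ler_wpM2l ?(ltW k0)// ler_pdivrMr ?ltr_wpDl//.
by rewrite mul1r lerDl.
Unshelve. all: by end_near. Qed.

Lemma sq_small k : 0 < k -> \forall d \near (0 : 'rV[R]_N), dot d d <= k.
Proof.
move=> k0; apply/near_sqP; exists k => // d; by rewrite subr0 => /ltW.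
Qed.

Lemma qf_small q : is_qf q -> forall k, 0 < k -> \forall d \near (0 : 'rV[R]_N), `|q d| <= k.
Proof.
move=> /is_qf_bound[K K0 qK] k k0; near=> d.
apply: (le_trans (qK d)); apply: (@le_trans _ _ (K * (k / (K + 1)))).
  by rewrite ler_wpM2l//; near: d; apply: sq_small; rewrite divr_gt0 ?ltr_wpDl.
rewrite mulrCA -[leRHS]mulr1 ler_wpM2l ?(ltW k0)// ler_pdivrMr ?ltr_wpDl//.
by rewrite mul1r lerDl.
Unshelve. all: by end_near. Qed.

Lemma littleo2_small r : littleo2 r -> forall k, 0 < k -> \forall d \near (0 : 'rV[R]_N), `|r d| <= k.
Proof.
move=> h k k0; near=> d; apply: (@le_trans _ _ (1 * dot d d)); first by near: d; exact: h.
by rewrite mul1r; near: d; exact: sq_small.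
Unshelve. all: by end_near. Qed.

Lemma littleo2_qf a q : (forall k, 0 < k -> \forall d \near (0 : 'rV[R]_N), `|a d| <= k) ->
  is_qf q -> littleo2 (fun d => a d * q d).
Proof.
move=> ha /is_qf_bound[K K0 qK].
apply: (@littleo2_le _ (fun d => K * (a d * dot d d))); last exact/littleo2Z/littleo2_sq.
near=> d; rewrite !normrM (ger0_norm K0) mulrCA ler_wpM2l//.
by rewrite (ger0_norm (sq_ge0 _)).
Unshelve. all: by end_near. Qed.

(** A Taylor expansion at the single point [x]; differentiability elsewhere is not asked, so
    second-order calculus becomes algebra on pairs (linear form, quadratic form). *)
Definition jet f x l q := [/\ is_lf l, is_qf q &
  littleo2 (fun d => f (x + d) - f x - l d - 2^-1 * q d)].

Lemma eq_jet f f' x l l' q q' : f =1 f' -> l =1 l' -> q =1 q' ->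
  jet f x l q -> jet f' x l' q'.
Proof. by move=> /funext-> /funext-> /funext->. Qed.

Lemma jet_cst c x : jet (cst c) x (cst 0) (cst 0).
Proof.
split; first by exists 0 => d; rewrite dot0l.
  by apply: (@is_qfP _ _ _ 0) => d; rewrite /qf mulmx0 dot0l.
move=> k k0; near=> d; rewrite /cst (_ : c - c - 0 - 2^-1 * 0 = 0); last by ring.
by rewrite normr0 mulr_ge0 ?sq_ge0// ltW.
Unshelve. all: by end_near. Qed.

Lemma jet_dot c x : jet (dot c) x (dot c) (cst 0).
Proof.
split; first by exists c.
  by apply: (@is_qfP _ _ _ 0) => d; rewrite /qf mulmx0 dot0l.
move=> k k0; near=> d; rewrite /cst dotDr.
rewrite (_ : _ - _ = 0); last by ring.
by rewrite normr0 mulr_ge0 ?sq_ge0// ltW.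
Unshelve. all: by end_near. Qed.

Lemma jet_sq z x : jet (fun y => dot (y - z) (y - z)) x
  (fun d => 2 * dot (x - z) d) (fun d => 2 * dot d d).
Proof.
split; first by exists (2 *: (x - z)) => d; rewrite dotZl.
  exact/is_qfZ/is_qf_sq.
move=> k k0; near=> d.
rewrite (_ : _ - _ = 0) ?normr0 ?mulr_ge0 ?sq_ge0 1?ltW//.
rewrite !dotE (dotC d x) (dotC d z) (dotC z x); lra.
Unshelve. all: by end_near. Qed.

Lemma jetD f g x l l' q q' : jet f x l q -> jet g x l' q' ->
  jet (fun y => f y + g y) x (fun d => l d + l' d) (fun d => q d + q' d).
Proof.
move=> [lf_ qf_ fo] [lg_ qg_ go]; split; [exact: is_lfD|exact: is_qfD|].
apply: littleo2_le (littleo2D fo go); near=> d.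
by rewrite le_eqVlt; apply/orP; left; apply/eqP; congr `|_|; ring.
Unshelve. all: by end_near. Qed.

Lemma jetZ f k x l q : jet f x l q ->
  jet (fun y => k * f y) x (fun d => k * l d) (fun d => k * q d).
Proof.
move=> [lf_ qf_ fo]; split; [exact: is_lfZ|exact: is_qfZ|].
apply: littleo2_le (littleo2Z k fo); near=> d.
by rewrite le_eqVlt; apply/orP; left; apply/eqP; congr `|_|; ring.
Unshelve. all: by end_near. Qed.

Lemma jet_incr_small f x l q : jet f x l q ->
  forall k, 0 < k -> \forall d \near (0 : 'rV[R]_N), `|f (x + d) - f x| <= k.
Proof.
move=> [lf_ qf_ fo] k k0; have k30 : 0 < k / 3 by rewrite divr_gt0.
near=> d.
have H1 : `|l d| <= k / 3 by near: d; exact: lf_small.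
have H2 : `|q d| <= k / 3 by near: d; exact: qf_small.
have H3 : `|f (x + d) - f x - l d - 2^-1 * q d| <= k / 3.
  by near: d; exact: (littleo2_small fo).
move: H1 H2 H3; rewrite !ler_norml; lra.
Unshelve. all: by end_near. Qed.

Definition jet1 (h : R -> R) t a b := forall k, 0 < k -> \forall s \near (0 : R),
  `|h (t + s) - h t - a * s - 2^-1 * b * s ^+ 2| <= k * s ^+ 2.

Lemma near0_jet f x l q (P : set R) : jet f x l q -> (\forall s \near (0 : R), P s) ->
  \forall d \near (0 : 'rV[R]_N), P (f (x + d) - f x).
Proof.
move=> fj /nbhs_normP[e /= e0 eP]; have e20 : 0 < e / 2 by rewrite divr_gt0.
near=> d; apply: eP; rewrite /ball_ /= sub0r normrN.
apply: (@le_lt_trans _ _ (e / 2)); last by lra.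
by near: d; exact: (jet_incr_small fj).
Unshelve. all: by end_near. Qed.

(** Insert the increment [s] of [f] into the expansion of [h]. Replacing [s ^+ 2] by [l ^+ 2] costs
    [(s + l) * (s - l)], and [s - l] is [q / 2] plus the remainder [r]; both products are o(|d|^2)
    because [s + l] tends to 0. *)
Lemma jet_comp f x l q (h : R -> R) a b : jet f x l q -> jet1 h (f x) a b ->
  jet (fun y => h (f y)) x (fun d => a * l d) (fun d => a * q d + b * l d ^+ 2).
Proof.
move=> fj hj; have [lf_ qf_ fo] := fj; split; first exact: is_lfZ.
  apply: is_qfD; [exact: is_qfZ|exact/is_qfZ/is_qf_lf].
pose s d := f (x + d) - f x.
pose r d := s d - l d - 2^-1 * q d.
have s_small k : 0 < k -> \forall d \near (0 : 'rV[R]_N), `|s d| <= k.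
  exact: (jet_incr_small fj).
have s_sq : exists2 C : R, 0 < C & \forall d \near (0 : 'rV[R]_N), s d ^+ 2 <= C * dot d d.
  have [K K0 lK] := is_lf_bound lf_; have [L L0 qL] := is_qf_bound qf_.
  exists (3 * (K ^+ 2 + L ^+ 2 + 1)); first by have := sqr_ge0 K; have := sqr_ge0 L; lra.
  near=> d.
  have d1 : dot d d <= 1 by near: d; exact: sq_small.
  have H1 : l d ^+ 2 <= K ^+ 2 * dot d d.
    rewrite -[l d ^+ 2]real_normK ?num_real// -nrm_sq -exprMn ler_pXn2r ?nnegrE//.
    by rewrite mulr_ge0 ?nrm_ge0.
  have H2 : q d ^+ 2 <= L ^+ 2 * dot d d.
    apply: (@le_trans _ _ ((L * dot d d) ^+ 2)).
      rewrite -[q d ^+ 2]real_normK ?num_real// ler_pXn2r ?nnegrE//.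
      by rewrite mulr_ge0 ?sq_ge0.
    rewrite exprMn ler_wpM2l ?sqr_ge0// expr2 -[leRHS]mulr1.
    by rewrite ler_wpM2l ?sq_ge0.
  have H3 : `|r d| <= 1 * dot d d by near: d; exact: fo.
  have H4 : r d ^+ 2 <= dot d d.
    apply: (@le_trans _ _ ((dot d d) ^+ 2)).
      rewrite -[r d ^+ 2]real_normK ?num_real// ler_pXn2r ?nnegrE ?sq_ge0//.
      by rewrite -[leRHS]mul1r.
    by rewrite expr2 -[leRHS]mulr1 ler_wpM2l ?sq_ge0.
  have -> : s d = l d + 2^-1 * q d + r d by rewrite /r; ring.
  have := sqr_ge0 (l d - 2^-1 * q d); have := sqr_ge0 (l d - r d).
  have := sqr_ge0 (2^-1 * q d - r d); nra.
have [C C0 sC] := s_sq.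
have o1 : littleo2 (fun d => h (f x + s d) - h (f x) - a * s d - 2^-1 * b * s d ^+ 2).
  move=> k k0; near=> d.
  apply: (@le_trans _ _ (k / C * s d ^+ 2)).
    by near: d; apply: (near0_jet fj (P := fun t => `|h (f x + t) - h (f x) - a * t - 2^-1 * b * t ^+ 2| <= k / C * t ^+ 2)); apply: hj; rewrite divr_gt0.
  rewrite -mulrA ler_wpM2l ?(ltW k0)// ler_pdivrMl//.
  by near: d.
have o2 : littleo2 (fun d => (s d + l d) * r d).
  apply: (@littleo2_bdd _ _ 2) fo; near=> d; apply: le_trans (ler_normD _ _) _.
  have H1 : `|s d| <= 1 by near: d; exact: s_small.
  have H2 : `|l d| <= 1 by near: d; exact: lf_small.
  lra.
have o3 : littleo2 (fun d => (s d + l d) * q d).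
  apply: littleo2_qf qf_ => k k0; have k20 : 0 < k / 2 by rewrite divr_gt0.
  near=> d; apply: le_trans (ler_normD _ _) _.
  have H1 : `|s d| <= k / 2 by near: d; exact: s_small.
  have H2 : `|l d| <= k / 2 by near: d; exact: lf_small.
  lra.
have := littleo2D o1 (littleo2D (littleo2Z a fo)
  (littleo2D (littleo2Z (2^-1 * b) o2) (littleo2Z (2^-1 * b * 2^-1) o3))).
apply: littleo2_le; near=> d.
rewrite le_eqVlt; apply/orP; left; apply/eqP; congr `|_|.
have -> : f (x + d) = f x + s d by rewrite /s; ring.
rewrite /r; field.
Unshelve. all: by end_near. Qed.

Lemma jet1_sq t : jet1 (fun s => s ^+ 2) t (2 * t) 2.
Proof.
move=> k k0; near=> s.
rewrite (_ : _ - 2^-1 * 2 * s ^+ 2 = 0); last by field.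
by rewrite normr0 mulr_ge0 ?sqr_ge0// ltW.
Unshelve. all: by end_near. Qed.

(** Polarization, [f * g] being a quarter of the difference of the squares of [f + g] and [f - g],
    reduces products to the chain rule. *)
Lemma jetM f g x l l' q q' : jet f x l q -> jet g x l' q' ->
  jet (fun y => f y * g y) x (fun d => f x * l' d + g x * l d)
    (fun d => f x * q' d + g x * q d + 2 * l d * l' d).
Proof.
move=> fj gj.
have := jetD (jetZ (1/4) (jet_comp (jetD fj gj) (@jet1_sq _)))
  (jetZ (- (1/4)) (jet_comp (jetD fj (jetZ (-1) gj)) (@jet1_sq _))).
by apply: eq_jet => y /=; field.
Qed.

Lemma jet1_sqrt t : 0 < t ->
  jet1 Num.sqrt t (2 * Num.sqrt t)^-1 (- (4 * Num.sqrt t ^+ 3)^-1).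
Proof.
move=> t0 k k0; have x0 : 0 < Num.sqrt t by rewrite sqrtr_gt0.
set x := Num.sqrt t in x0 *.
have xx : t = x ^+ 2 by rewrite sqr_sqrtr// ltW.
have kx0 : 0 < k * x ^+ 5 by rewrite mulr_gt0 ?exprn_gt0.
near=> s.
have st : `|s| <= t / 2 by near: s; apply: (@nbhs0_le _ R^o); rewrite divr_gt0.
have st1 : `|s| <= k * x ^+ 5 by near: s; exact: (@nbhs0_le _ R^o).
have ts : 0 <= t + s by move: st; rewrite ler_norml; lra.
set y := Num.sqrt (t + s).
have y0 : 0 <= y by exact: sqrtr_ge0.
have yy : t + s = y ^+ 2 by rewrite sqr_sqrtr.
have sE : s = (y - x) * (y + x) by rewrite -subr_sqr -yy -xx; ring.
(* With [x] and [y] the square roots of [t] and [t + s], the Taylor remainder is an exact multiple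
   of [(y - x) ^+ 3], hence cubic in [s]. *)
have -> : y - x - (2 * x)^-1 * s - 2^-1 * - (4 * x ^+ 3)^-1 * s ^+ 2 =
    (y - x) ^+ 3 * (y + 3 * x) / (8 * x ^+ 3).
  by rewrite sE; field; rewrite gt_eqF.
rewrite normrM normrM normrX (ger0_norm (_ : 0 <= (8 * x ^+ 3)^-1)); last first.
  by rewrite invr_ge0 mulr_ge0// exprn_ge0// ltW.
rewrite (ger0_norm (_ : 0 <= y + 3 * x)); last by lra.
rewrite ler_pdivrMr ?mulr_gt0 ?exprn_gt0//.
have sn : `|s| = `|y - x| * (y + x) by rewrite sE normrM (ger0_norm (_ : 0 <= y + x))//; lra.
rewrite -[s ^+ 2]real_normK ?num_real// sn exprMn.
rewrite sn in st1.
set D := `|y - x| in st1 *; have D0 : 0 <= D by exact: normr_ge0.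
have yx0 : 0 < y + x by lra.
have Dk : D * x <= k * x ^+ 5 by nra.
have {}Dk : D <= k * x ^+ 4 by rewrite -(ler_pM2r x0) -mulrA -exprSr.
have H : D * (y + 3 * x) <= k * (8 * x ^+ 3) * (y + x) ^+ 2.
  apply: (@le_trans _ _ (k * x ^+ 4 * (3 * (y + x)))).
    by apply: ler_pM => //; lra.
  have : 0 <= k * x ^+ 3 by rewrite mulr_ge0 ?exprn_ge0 ?ltW.
  rewrite exprS; nra.
have := ler_wpM2l (sqr_ge0 D) H; lra.
Unshelve. all: by end_near. Qed.

End Jets.

(** * From viscosity solutions to inequalities on semijets *)

Section ViscosityJets.
Variables (R : realType) (N : nat).
Implicit Types (u v : 'rV[R]_N -> R) (x y d p : 'rV[R]_N) (X : 'M[R]_N).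

(** The inequality is exact, without an o(|d|^2), so that the quadratic itself is an admissible test
    function. Wherever a remainder occurs, it is absorbed by adding a small multiple of the identity
    to [X]. *)
Definition superjet u x p X := X^T = X /\
  \forall d \near (0 : 'rV[R]_N), u (x + d) <= u x + dot p d + 2^-1 * qf X d.

Definition subjet u x p X := X^T = X /\
  \forall d \near (0 : 'rV[R]_N), u x + dot p d + 2^-1 * qf X d <= u (x + d).

(* [curvmx p] is [I - p p^T / (1 + |p|^2)], so that
   [M(phi) = tr (curvmx (D phi) D^2 phi) / sqrt (1 + |D phi|^2)]. *)
Definition curvmx p : 'M[R]_N := 1%:M - (1 + dot p p)^-1 *: (p^T *m p).

Lemma tr_curvmx p X : \tr (curvmx p *m X) = \tr X - qf X p / (1 + dot p p).
Proof.
rewrite /curvmx mulmxBl mul1mx linearB /= -scalemxAl linearZ /= mulrC.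
congr (_ - _ / _); rewrite -mulmxA mxtrace_mulC /mxtrace big_ord1 mxE.
by rewrite /qf; apply: eq_bigr => i _; rewrite !mxE.
Qed.

Lemma is_derive_line (f : 'rV[R]_N -> R) (x v : 'rV[R]_N) (D : R) :
  is_derive (0 : R) (1 : R) (fun t : R => f (t *: v + x) : R) D -> is_derive x v f D.
Proof.
move=> [H1 H2]; have E : (fun h : R => h^-1 *: ((f \o shift x) (h *: v) - f x)) =
    (fun h : R => h^-1 *: (((fun t : R => f (t *: v + x)) \o shift 0) (h *: 1) -
       f (0 *: v + x))).
  by apply/funext => h /=; rewrite addr0 scale0r add0r [_%:A]mulr1.
by split; [apply/derivable1P|rewrite -H2 /derive E].
Qed.

Lemma is_derive_quad (a b c : R) : is_derive (0 : R) 1 (fun t : R => c + b * t + a * t ^+ 2) b.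
Proof.
apply: is_derive_eq; rewrite /= /GRing.scale /=; ring.
Qed.

Definition quad (x0 p : 'rV[R]_N) X y := dot p (y - x0) + 2^-1 * qf X (y - x0).

Lemma dot_delta p i : dot p (delta_mx 0 i) = p 0 i.
Proof.
rewrite /dot (bigD1 i)//= mxE !eqxx mulr1 big1 ?addr0// => j ji.
by rewrite mxE eqxx (negbTE ji) mulr0.
Qed.

Lemma is_derive_quad_partial x0 p X i y : X^T = X ->
  is_derive y (delta_mx 0 i) (quad x0 p X) ((p + (y - x0) *m X) 0 i).
Proof.
move=> XT; apply: is_derive_line.
rewrite (_ : (fun t => _) = (fun t : R => quad x0 p X y + (p + (y - x0) *m X) 0 i * t +
  2^-1 * qf X (delta_mx 0 i) * t ^+ 2)); first exact: is_derive_quad.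
apply/funext => t; rewrite /quad /qf -addrA; move: (y - x0) => d.
rewrite mulmxDl -scalemxAl [(p + d *m X) 0 i]mxE !dotE !dot_delta.
rewrite [dot (delta_mx 0 i *m X) d]dot_mulmx XT [dot (delta_mx 0 i) (d *m X)]dotC dot_delta.
by field.
Qed.

Lemma partial_quad x0 p X i : X^T = X ->
  partial i (quad x0 p X) = fun y => (p + (y - x0) *m X) 0 i.
Proof. by move=> XT; apply/funext => y; have [] := is_derive_quad_partial x0 p i y XT. Qed.

Lemma is_derive_affine_partial x0 p X i j y :
  is_derive y (delta_mx 0 j) (fun y => (p + (y - x0) *m X) 0 i) (X j i).
Proof.
apply: is_derive_line.
rewrite (_ : (fun t => _) = (fun t : R => (p + (y - x0) *m X) 0 i + X j i * t +
  0 * t ^+ 2)); first exact: is_derive_quad.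
apply/funext => t; rewrite -[t *: _ + y - x0]addrA; move: (y - x0) => d.
by rewrite mulmxDl -scalemxAl -rowE !mxE; ring.
Qed.

Lemma cts_dot c : continuous (dot c : 'rV[R]_N -> R).
Proof.
move=> x; apply: (@cvg_dot R N _ (nbhs x) (fun=> c) id); [exact: cvg_cst|exact: cvg_id].
Qed.

Lemma cts_affine x0 p X i : continuous (fun y => (p + (y - x0) *m X) 0 i).
Proof.
have -> : (fun y => (p + (y - x0) *m X) 0 i) =
    (fun y => p 0 i - (x0 *m X) 0 i + dot (delta_mx 0 i *m X^T) y).
  by apply/funext => y; rewrite mulmxBl !mxE dot_mulmx trmxK dotC dot_delta !mxE; ring.
by move=> y; exact: (cvgD (cvg_cst _) (@cts_dot _ y)).
Qed.

Lemma cts_quad x0 p X : continuous (quad x0 p X).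
Proof.
have -> : quad x0 p X = (fun y => dot (p + 2^-1 *: ((y - x0) *m X)) (y - x0)).
  by apply/funext => y; rewrite /quad /qf dotDl dotZl.
move=> y.
have H : continuous (fun y => (y - x0) *m X).
  move=> z; apply/(@cvgrPdist_lt _ _ _ (nbhs z) (nbhs_filter z)) => e e0.
  have [K K0 KX] := sq_mulmx_le X.
  apply/near_sqP; exists ((e / (K + 1)) ^+ 2).
    by rewrite exprn_gt0// divr_gt0// ltr_wpDl.
  move=> w wz; rewrite distrC.
  rewrite -mulmxBl opprB addrA subrK.
  apply: le_lt_trans (norm_le_nrm _) _; rewrite ltr_nrm_sq ?ltW//.
  apply: le_lt_trans (KX _) _.
  apply: (@le_lt_trans _ _ ((K + 1) ^+ 2 * dot (w - z) (w - z))).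
    rewrite ler_wpM2r ?sq_ge0// ler_pXn2r ?nnegrE ?addr_ge0//; lra.
  by rewrite -ltr_pdivlMl ?exprn_gt0 ?ltr_wpDl// mulrC -exprVn -exprMn.
have FF := nbhs_filter y.
have H1 := cvgD (cvg_cst p) (@cvgZl_tmp _ _ _ (nbhs y) FF (2^-1) _ _ (H y)).
have H2 := cvgB (@cvg_id _ (nbhs y)) (cvg_cst x0).
exact: (cvg_dot FF (H1 FF FF) (H2 FF FF)).
Qed.

Lemma class_C_cst (k : nat) (Omega : set 'rV[R]_N) (c : R) : class_C k Omega (fun=> c).
Proof.
elim: k c => [|k IH] c; first by split=> // x _; exact: cst_continuous.
split; first by move=> x _; exact: cst_continuous.
move=> i; split; first by move=> x _; exact: derivable_cst.
rewrite (_ : partial i (fun=> c) = fun=> 0); first exact: IH.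
by apply/funext => y; exact: derive_cst.
Qed.

Lemma class_C2_quad (Omega : set 'rV[R]_N) x0 p X : X^T = X -> class_C 2 Omega (quad x0 p X).
Proof.
move=> XT; split; first by move=> x _; exact: cts_quad.
move=> i; split; first by move=> x _; have [] := is_derive_quad_partial x0 p i x XT.
rewrite partial_quad//; split; first by move=> x _; exact: cts_affine.
move=> j; split; first by move=> x _; have [] := is_derive_affine_partial x0 p X i j x.
rewrite (_ : partial j _ = fun=> X j i); first exact: class_C_cst.
by apply/funext => y; have [] := is_derive_affine_partial x0 p X i j y.
Qed.

Lemma mean_curvature_quad x0 p X : X^T = X ->
  mean_curvature_op (quad x0 p X) x0 = \tr (curvmx p *m X) / Num.sqrt (1 + dot p p).
Proof.
move=> XT; have gradE y : grad (quad x0 p X) y = p + (y - x0) *m X.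
  by apply/rowP => i; rewrite mxE partial_quad.
set a := Num.sqrt (1 + dot p p).
have pp : 0 < 1 + dot p p by rewrite ltr_pwDl ?sq_ge0.
have a0 : 0 < a by rewrite sqrtr_gt0.
have aa : 1 + dot p p = a ^+ 2 by rewrite sqr_sqrtr// ltW.
have H i : partial i (fun y => ((Num.sqrt (1 + norm2 (grad (quad x0 p X) y) ^+ 2))^-1 *:
    grad (quad x0 p X) y) 0 i) x0 = X i i / a - p 0 i * (p *m X) 0 i / a ^+ 3.
  apply: derive_val; apply: is_derive_line.
  (* Along the coordinate line through [x0] the gradient is [p + t *: row i X], and [g t] is 1 plus
     its squared length. *)
  pose g (t : R) := (1 + dot p p) + 2 * dot p (row i X) * t + dot (row i X) (row i X) * t ^+ 2.
  rewrite (_ : (fun t => _) = (fun t : R => (Num.sqrt (g t))^-1 * (p 0 i + X i i * t + 0 * t ^+ 2))).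
    have dg : is_derive (0 : R) 1 g (2 * dot p (row i X)) by exact: is_derive_quad.
    have g0 : g 0 = a ^+ 2 by rewrite /g mulr0 expr0n/= mulr0 !addr0.
    have ds : is_derive (0 : R) 1 (Num.sqrt \o g) ((2 * a)^-1 * (2 * dot p (row i X))).
      apply: is_derive1_comp; rewrite g0; have := @is_derive1_sqrt R (a ^+ 2) (exprn_gt0 _ a0).
      by rewrite sqrtr_sqr gtr0_norm.
    have sn0 : (Num.sqrt \o g) 0 != 0 by rewrite /= g0 sqrtr_sqr gtr0_norm// gt_eqF.
    have dV := is_deriveV sn0 ds.
    have dL := is_derive_quad 0 (X i i) (p 0 i).
    apply: is_derive_eq (is_deriveM dV dL) _.
    rewrite /= g0 sqrtr_sqr gtr0_norm// /GRing.scale /= !mulr0 !addr0.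
    have -> : dot p (row i X) = (p *m X) 0 i.
      by rewrite [in RHS]mxE; apply: eq_bigr => j _; rewrite mxE -[in LHS]XT mxE.
    by field; rewrite gt_eqF.
  apply/funext => t; rewrite gradE mxE; congr (_ * _); last first.
    by rewrite addrK -scalemxAl -rowE !mxE; ring.
  congr (Num.sqrt _)^-1; rewrite addrK -scalemxAl -rowE /g -addrA -addrA; congr (1 + _).
  rewrite /norm2 sqr_sqrtr; last by apply: sumr_ge0 => j _; exact: sqr_ge0.
  rewrite (_ : \sum_(_ < _) _ = dot (p + t *: row i X) (p + t *: row i X)).
    by rewrite !dotE (dotC (row i X) p); ring.
  by apply: eq_bigr => j _; rewrite expr2.
rewrite /mean_curvature_op /divergence (eq_bigr _ (fun i _ => H i)) sumrB tr_curvmx -!mulr_suml.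
rewrite aa /qf (dotC (p *m X)) /dot /mxtrace; field; by rewrite gt_eqF.
Qed.

(** Quadratics suffice as test functions: this lemma and [viscosity_sub_jet] are the only gateways
    from the inequality in the viscosity definition to the rest of the proof. *)
Lemma viscosity_super_jet (Omega : set 'rV[R]_N) (H u : 'rV[R]_N -> R) x p X :
  viscosity_supersolution Omega H u -> Omega x -> subjet u x p X ->
  \tr (curvmx p *m X) <= Num.sqrt (1 + dot p p) * (N%:R * H x).
Proof.
move=> [_ us] Ox [XT uX].
have a0 : 0 < Num.sqrt (1 + dot p p) by rewrite sqrtr_gt0 ltr_pwDl ?sq_ge0.
rewrite mulrC -ler_pdivrMr// -(mean_curvature_quad x)//; apply: us => //.
  exact: class_C2_quad.
have [r r0 rP] := (near_sqP _ _).1 uX.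
apply/near_sqP; exists r => // y yx _; have /= := rP (y - x).
rewrite subr0 [x + (y - x)]addrCA subrr addr0 => /(_ yx).
rewrite /quad subrr dot0r qf0r; lra.
Qed.

Lemma viscosity_sub_jet (Omega : set 'rV[R]_N) (H v : 'rV[R]_N -> R) x p X :
  viscosity_subsolution Omega H v -> Omega x -> superjet v x p X ->
  Num.sqrt (1 + dot p p) * (N%:R * H x) <= \tr (curvmx p *m X).
Proof.
move=> [_ vs] Ox [XT vX].
have a0 : 0 < Num.sqrt (1 + dot p p) by rewrite sqrtr_gt0 ltr_pwDl ?sq_ge0.
rewrite mulrC -ler_pdivlMr// -(mean_curvature_quad x)//; apply: vs => //.
  exact: class_C2_quad.
have [r r0 rP] := (near_sqP _ _).1 vX.
apply/near_sqP; exists r => // y yx _; have /= := rP (y - x).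
rewrite subr0 [x + (y - x)]addrCA subrr addr0 => /(_ yx).
rewrite /quad subrr dot0r qf0r; lra.
Qed.

End ViscosityJets.

(** * Polynomial functions, their Laplacian and the maximum principle *)

Section PolynomialFunctions.
Variables (R : realType) (N : nat).
Implicit Types (f g h r w : 'rV[R]_N -> R) (x d p : 'rV[R]_N).

(** The index is an upper bound for the degree. Working with functions instead of formal polynomials
    makes every structural fact an induction on the derivation. *)
Inductive polyf : nat -> ('rV[R]_N -> R) -> Prop :=
| polyf_cst n c : polyf n (fun=> c)
| polyf_add n f g : polyf n f -> polyf n g -> polyf n (fun x => f x + g x)
| polyf_mulX n i f : polyf n f -> polyf n.+1 (fun x => x 0 i * f x)
| polyf_mono n f : polyf n f -> polyf n.+1 f.

Lemma polyfZ n k f : polyf n f -> polyf n (fun x => k * f x).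
Proof.
elim=> {n f} [n c|n f g _ IHf _ IHg|n i f _ IHf|n f _ IHf].
- exact: polyf_cst.
- rewrite (_ : (fun x => _) = fun x => k * f x + k * g x); first exact: polyf_add.
  by apply/funext => x; rewrite mulrDr.
- rewrite (_ : (fun x => _) = fun x => x 0 i * (k * f x)); first exact: polyf_mulX.
  by apply/funext => x; rewrite mulrCA.
- exact: polyf_mono.
Qed.

Lemma polyf_le n m f : (n <= m)%N -> polyf n f -> polyf m f.
Proof.
move=> /subnK <-; elim: (m - n)%N => [//|k IH] pf; rewrite addSn; exact/polyf_mono/IH.
Qed.

Lemma polyfM n m f g : polyf n f -> polyf m g -> polyf (n + m) (fun x => f x * g x).
Proof.
move=> pf pg; elim: pf => {n f} [n c|n f f' _ IHf _ IHg|n i f _ IHf|n f _ IHf].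
- by apply: polyfZ; apply: polyf_le pg; rewrite leq_addl.
- rewrite (_ : (fun x => _) = fun x => f x * g x + f' x * g x); first exact: polyf_add.
  by apply/funext => x; rewrite mulrDl.
- rewrite addSn (_ : (fun x => _) = fun x => x 0 i * (f x * g x)); first exact: polyf_mulX.
  by apply/funext => x; rewrite mulrA.
- by rewrite addSn; exact: polyf_mono.
Qed.

Lemma polyf_sum (I : Type) (s : seq I) n (F : I -> 'rV[R]_N -> R) :
  (forall i, polyf n (F i)) -> polyf n (fun x => \sum_(i <- s) F i x).
Proof.
move=> H; elim: s => [|i s IH].
  rewrite (_ : (fun x => _) = fun=> 0); first exact: polyf_cst.
  by apply/funext => x; rewrite big_nil.
rewrite (_ : (fun x => _) = fun x => F i x + \sum_(i <- s) F i x); first exact: polyf_add.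
by apply/funext => x; rewrite big_cons.
Qed.

Lemma polyf_coord i : polyf 1 (fun x => x 0 i).
Proof.
rewrite (_ : (fun x => _) = fun x => x 0 i * 1); first exact/polyf_mulX/polyf_cst.
by apply/funext => x; rewrite mulr1.
Qed.

Lemma polyf_dot c : polyf 1 (dot c).
Proof. by apply: polyf_sum => i; exact/polyfZ/polyf_coord. Qed.

Lemma polyf_sq c : polyf 2 (fun x => dot (x - c) (x - c)).
Proof.
apply: polyf_sum => i; apply: (@polyfM 1 1);
  rewrite (_ : (fun x => _) = fun x => x 0 i + - c 0 i);
  by [apply: polyf_add; [exact: polyf_coord|exact: polyf_cst] | apply/funext => x; rewrite !mxE].
Qed.

Lemma is_derive_coord i j x :
  is_derive x (delta_mx 0 j) (fun y : 'rV[R]_N => y 0 i) ((i == j)%:R : R).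
Proof.
apply: is_derive_line.
rewrite (_ : (fun t => _) = (fun t : R => x 0 i + (i == j)%:R * t + 0 * t ^+ 2)).
  exact: is_derive_quad.
by apply/funext => t; rewrite !mxE eqxx /=; ring.
Qed.

(** At [n = 0] the truncated predecessor [n.-1] loses the fact that the derivative vanishes, hence
    the extra clause. The product rule needs it: [x 0 j * f' x] must again have degree 0. *)
Lemma polyf_derive n f i : polyf n f ->
  exists g, [/\ polyf n.-1 g, n = 0%N -> g = fun=> 0 &
    forall x, is_derive x (delta_mx 0 i) f (g x)].
Proof.
elim=> {n f} [n c|n f g _ [f' [pf' f0 df]] _ [g' [pg' g0 dg]]|n j f pf [f' [pf' f0 df]]|n f _ [f' [pf' f0 df]]].
- by exists (fun=> 0); split=> // [|x]; [exact: polyf_cst|exact: is_derive_cst].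
- exists (fun x => f' x + g' x); split; first exact: polyf_add.
    by move=> n0; rewrite f0// g0//; apply/funext => x; rewrite addr0.
  by move=> x; have := df x; have := dg x => ? ?; exact: is_deriveD.
- exists (fun x => (j == i)%:R * f x + x 0 j * f' x); split=> //=.
    apply: polyf_add; first exact: polyfZ.
    case: n pf pf' f0 => [|n] pf pf' f0; last exact: polyf_mulX.
    rewrite f0// (_ : (fun x => _) = fun=> 0); first exact: polyf_cst.
    by apply/funext => x; rewrite mulr0.
  move=> x; have d1 := is_derive_coord j i x; have d2 := df x.
  apply: is_derive_eq (is_deriveM d1 d2) _.
  by rewrite /GRing.scale /= addrC mulrC.
- exists f'; split=> //=; apply: polyf_le pf'; exact: leq_pred.
Qed.

Lemma polyf_partial n f i : polyf n f -> polyf n.-1 (partial i f).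
Proof.
move=> /(polyf_derive i)[g [pg _ dg]].
by rewrite (_ : partial i f = g)//; apply/funext => x; have [] := dg x.
Qed.

Lemma polyf_is_derive n f i x : polyf n f -> is_derive x (delta_mx 0 i) f (partial i f x).
Proof.
by move=> /(polyf_derive i)[g [_ _ dg]]; have [H _] := dg x; exact: derivableP.
Qed.

Lemma partialD n m f g i : polyf n f -> polyf m g ->
  partial i (fun x => f x + g x) = fun x => partial i f x + partial i g x.
Proof.
move=> pf pg; apply/funext => x; apply: derive_val.
by apply: is_deriveD; apply: polyf_is_derive; eassumption.
Qed.

Lemma partialZ n f i k : polyf n f ->
  partial i (fun x => k * f x) = fun x => k * partial i f x.
Proof.
move=> pf; apply/funext => x; apply: derive_val.
by apply: is_deriveZ; apply: polyf_is_derive; eassumption.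
Qed.

Lemma partial_mulX n f i j : polyf n f ->
  partial i (fun x => x 0 j * f x) = fun x => (j == i)%:R * f x + x 0 j * partial i f x.
Proof.
move=> pf; apply/funext => x; apply: derive_val.
apply: is_derive_eq (is_deriveM (is_derive_coord j i x) (polyf_is_derive i x pf)) _.
by rewrite /GRing.scale /= addrC mulrC.
Qed.

Definition lap f x : R := \sum_i partial i (partial i f) x.

Lemma polyf_lap n f : polyf n f -> polyf n.-2 (lap f).
Proof. by move=> pf; apply: polyf_sum => i; exact/polyf_partial/polyf_partial. Qed.

Lemma lapD n m f g x : polyf n f -> polyf m g -> lap (fun x => f x + g x) x = lap f x + lap g x.
Proof.
move=> pf pg; rewrite /lap -big_split /=; apply: eq_bigr => i _.
by rewrite (partialD i pf pg) (partialD i (polyf_partial i pf) (polyf_partial i pg)).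
Qed.

Lemma lapZ n f k x : polyf n f -> lap (fun x => k * f x) x = k * lap f x.
Proof.
move=> pf; rewrite /lap mulr_sumr; apply: eq_bigr => i _.
by rewrite (partialZ i k pf) (partialZ i k (polyf_partial i pf)).
Qed.

Lemma lap_cst c x : lap (fun=> c) x = 0.
Proof.
apply: big1 => i _; rewrite (_ : partial i (fun=> c) = fun=> 0); first exact: derive_cst.
by apply/funext => y; exact: derive_cst.
Qed.

Lemma lap_sum (I : Type) (s : seq I) n (F : I -> 'rV[R]_N -> R) x :
  (forall i, polyf n (F i)) ->
  lap (fun x => \sum_(i <- s) F i x) x = \sum_(i <- s) lap (F i) x.
Proof.
move=> H; elim: s => [|i s IH].
  rewrite big_nil (_ : (fun x => _) = fun=> 0); first exact: lap_cst.
  by apply/funext => y; rewrite big_nil.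
rewrite big_cons -IH -(lapD _ (H i) (polyf_sum s H)).
rewrite (_ : (fun x => _) = fun y => F i y + \sum_(i <- s) F i y)//.
by apply/funext => y; rewrite big_cons.
Qed.

Lemma lap_mulX n f j x : polyf n f ->
  lap (fun x => x 0 j * f x) x = x 0 j * lap f x + 2 * partial j f x.
Proof.
move=> pf; rewrite /lap mulr_sumr.
under eq_bigr => i _.
  rewrite (partial_mulX i j pf).
  rewrite (partialD i (polyfZ _ pf) (polyf_mulX j (polyf_partial i pf))).
  rewrite (partialZ i _ pf) (partial_mulX i j (polyf_partial i pf)).
  rewrite addrA -mulrDl addrC; over.
rewrite big_split /=; congr (_ + _).
rewrite (bigD1 j)//= eqxx big1 ?addr0; first by rewrite -mulr2n.
by move=> i ij; rewrite eq_sym (negbTE ij) addr0 mul0r.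
Qed.

Lemma lap_sq c x : lap (fun x => dot (x - c) (x - c)) x = (2 * N)%:R.
Proof.
rewrite (@lap_sum _ _ 2 (fun j x => (x - c) 0 j * (x - c) 0 j)); last first.
  move=> i; apply: (@polyfM 1 1);
  rewrite (_ : (fun x => _) = fun x => x 0 i + - c 0 i);
  by [apply: polyf_add; [exact: polyf_coord|exact: polyf_cst] | apply/funext => y; rewrite !mxE].
rewrite mulnC natrM -[N in N%:R]card_ord mulr_natl -sumr_const; apply: eq_bigr => j _.
pose f := fun y : 'rV[R]_N => y 0 j + (- (2 * c 0 j)).
have pf : polyf 1 f by apply: polyf_add; [exact: polyf_coord|exact: polyf_cst].
rewrite (_ : (fun x : 'rV[R]_N => (x - c) 0 j * (x - c) 0 j) =
    fun y => (y 0 j * f y) + c 0 j ^+ 2); last first.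
  by apply/funext => y; rewrite /f !mxE; ring.
rewrite (lapD _ (polyf_mulX j pf) (polyf_cst 0 _)) lap_cst addr0 (lap_mulX _ _ pf).
have pE i : partial i f = fun=> (j == i)%:R.
  rewrite (partialD i (polyf_coord j) (polyf_cst 0 _)); apply/funext => y.
  rewrite [X in X + _](_ : _ = (j == i)%:R); last exact/derive_val/is_derive_coord.
  by rewrite [X in _ + X](_ : _ = 0) ?addr0//; exact: derive_cst.
rewrite pE eqxx mulr1 /lap big1 ?mulr0 ?add0r// => i _.
by rewrite pE; exact: derive_cst.
Qed.

(** Links the two notions of derivative: viscosity arguments use jets, while [lap] is defined
    through partial derivatives. *)
Lemma polyf_jet n f x : polyf n f -> exists l q,
  [/\ jet f x l q, forall i, l (delta_mx 0 i) = partial i f x &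
      \sum_i q (delta_mx 0 i) = lap f x].
Proof.
elim=> {n f} [n c|n f g pf [l [q [fj fl fq]]] pg [l' [q' [gj gl gq]]]|n j f pf [l [q [fj fl fq]]]|n f _ IH //].
- exists (cst 0), (cst 0); split; first exact: jet_cst.
    by move=> i; rewrite /partial derive_cst.
  by rewrite lap_cst big1.
- exists (fun d => l d + l' d), (fun d => q d + q' d); split; first exact: jetD.
    by move=> i; rewrite (partialD i pf pg) fl gl.
  by rewrite (lapD _ pf pg) big_split fq gq.
- have cj : jet (fun y => y 0 j) x (dot (delta_mx 0 j)) (cst 0).
    apply: eq_jet (jet_dot (delta_mx 0 j) x) => // y.
    by rewrite dotC dot_delta.
  exists (fun d => x 0 j * l d + f x * dot (delta_mx 0 j) d).
  exists (fun d => x 0 j * q d + f x * cst 0 d + 2 * dot (delta_mx 0 j) d * l d).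
  split; first exact: jetM.
    move=> i; rewrite (partial_mulX i j pf) fl dot_delta mxE eqxx /= addrC mulrC.
    by rewrite eq_sym.
  rewrite (lap_mulX _ _ pf) -fq -fl mulr_sumr.
  under eq_bigr do rewrite /cst mulr0 addr0.
  rewrite big_split /=; congr (_ + _); rewrite (bigD1 j)//= big1 ?addr0.
    by rewrite dot_delta mxE !eqxx mulr1.
  by move=> i ij; rewrite dot_delta mxE eqxx (negbTE ij) mulr0 mul0r.
Qed.

(** Evaluating at [t *: d] and [- t *: d] and adding cancels the linear part; a positive [q d] would
    dominate the remainder. *)
Lemma jet_local_max f x l q d : jet f x l q ->
  (\forall d \near (0 : 'rV[R]_N), f (x + d) <= f x) -> q d <= 0.
Proof.
move=> [[c lE] [Q _ qE] fo] fmax; rewrite leNgt; apply/negP => q0.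
have d0 : 0 < dot d d.
  apply: sq_gt0; apply: contraTneq q0 => ->.
  by rewrite qE qf0r ltxx.
pose k := q d / (4 * dot d d).
have k0 : 0 < k by rewrite divr_gt0// mulr_gt0.
have [r r0 rP] := (near_sqP _ _).1 (filterI fmax (fo k k0)).
pose t := Num.sqrt (r / (2 * dot d d)).
have t0 : 0 < t by rewrite sqrtr_gt0 divr_gt0// mulr_gt0.
have tt : t ^+ 2 * dot d d = r / 2.
  rewrite sqr_sqrtr; first by field; rewrite gt_eqF.
  by rewrite ltW// divr_gt0// mulr_gt0.
have ttE s : s ^+ 2 = t ^+ 2 -> dot (s *: d - 0) (s *: d - 0) < r.
  by rewrite subr0 !dotE mulrA -expr2 => ->; rewrite tt; lra.
have [/= H1 H2] := rP (t *: d) (ttE t erefl).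
have [/= H3 H4] := rP (- t *: d) (ttE (- t) (sqrrN t)).
move: H2 H4; rewrite !lE !qE !qfZr !dotE sqrrN -!qE !ler_norml => /andP[H2 _] /andP[H4 _].
have kd : k * (t * (t * dot d d)) = t ^+ 2 * q d / 4.
  by rewrite /k; field; rewrite gt_eqF.
have : k * (- t * (- t * dot d d)) = t ^+ 2 * q d / 4.
  by rewrite /k; field; rewrite gt_eqF.
have : 0 < t ^+ 2 * q d by rewrite mulr_gt0 ?exprn_gt0.
nra.
Qed.

Lemma cts_polyf n f : polyf n f -> continuous f.
Proof.
elim=> {n f} [n c|n f g _ IHf _ IHg|n i f _ IHf|n f _ IHf] x.
- exact: cst_continuous.
- exact: (cvgD (IHf x) (IHg x)).
- exact: (cvgM (@coord_continuous _ 1 N 0 i x) (IHf x)).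
- exact: IHf.
Qed.

Lemma compact_sqball (z : 'rV[R]_N) rho : compact [set x | dot (x - z) (x - z) <= rho].
Proof.
apply: bounded_closed_compact.
  exists (nrm z + Num.sqrt `|rho|); split; first exact: num_real.
  move=> M M0 x /= xr; apply: (le_trans (norm_le_nrm x)).
  rewrite -[x](subrK z) (le_trans (ler_nrmD _ _))// addrC (le_trans _ (ltW M0))// lerD2l.
  rewrite ler_nrm_sq ?sqrtr_ge0// sqr_sqrtr//.
  by rewrite (le_trans xr)// ler_norm.
apply: (@closed_comp _ _ (fun x => dot (x - z) (x - z)) [set t | t <= rho]); last exact: closed_le.
by move=> x _; exact: (cts_polyf (polyf_sq z)).
Qed.

(** Adding [k * dot x x] makes the Laplacian strictly positive, which forbids an interior maximum;
    then [k] is sent to 0. Here and below [rho] is the square of a radius. *)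
Lemma subharmonic_le n w rho M : (0 < N)%N -> polyf n w ->
  (forall x, dot x x < rho -> 0 <= lap w x) ->
  (forall x, dot x x = rho -> w x <= M) ->
  forall x, dot x x <= rho -> w x <= M.
Proof.
move=> N0 pw wl wM y yr; apply/ler_addgt0Pr => e e0.
have rho0 : 0 <= rho by exact: le_trans (sq_ge0 y) yr.
pose k := e / (rho + 1); have k0 : 0 < k by rewrite divr_gt0// ltr_wpDl.
pose g x := w x + k * dot (x - 0) (x - 0).
have pk := polyfZ k (polyf_sq 0).
have pg : polyf (maxn n 2) g.
  by apply: polyf_add; [apply: polyf_le pw|apply: polyf_le pk];
    rewrite ?leq_maxl ?leq_maxr.
pose K := [set x : 'rV[R]_N | dot (x - 0) (x - 0) <= rho].
have Ky : K y by rewrite /K /= subr0.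
have [x Kx xmax] : exists2 x, K x & forall z, K z -> - g x <= - g z.
  apply: compact_lsc_min; [exact: compact_sqball|by exists y|].
  apply: lsc_within_cts => z _.
  exact: (@cvgN _ _ _ (nbhs z) (nbhs_filter z) _ _ (cts_polyf pg (x:=z))).
have ke : k * rho <= e.
  rewrite /k mulrAC ler_pdivrMr ?ltr_wpDl// ler_wpM2l ?(ltW e0)//; lra.
have gxy : g y <= g x by rewrite -lerN2; exact: xmax.
have wg : w y <= g y by rewrite lerDl mulr_ge0 ?sq_ge0// ltW.
apply: (le_trans wg); apply: (le_trans gxy).
move: Kx; rewrite /K /= le_eqVlt => /orP[/eqP xE|xl].
  rewrite /g xE lerD//; apply: wM; by rewrite -xE subr0.
have [l [q [gj _ gq]]] := polyf_jet x pg.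
have : \sum_i q (delta_mx 0 i) <= 0.
  apply: sumr_le0 => i _; apply: (jet_local_max _ gj).
  have : \forall z \near x, dot (z - 0) (z - 0) < rho.
    exact: (@cvgr_lt _ _ _ (nbhs_filter x) _ _ (cts_polyf (polyf_sq 0) (x:=x)) _ xl).
  move=> /near_sqP[r r0 rP]; apply/near_sqP; exists r => // d; rewrite subr0 => dr.
  rewrite -lerN2; apply/xmax/ltW/rP.
  by rewrite [x + d]addrC addrK.
rewrite gq /g (lapD _ pw pk) (lapZ _ _ (polyf_sq 0)) lap_sq.
have : 0 <= lap w x by apply: wl; rewrite -[x]subr0.
have : 0 < k * (2 * N)%:R by rewrite mulr_gt0// ltr0n muln_gt0.
lra.
Qed.

End PolynomialFunctions.

(** * The Dirichlet problem on a ball with polynomial data *)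

Section DirichletProblem.
Variables (R : realType) (N : nat).
Implicit Types (f g h r w : 'rV[R]_N -> R) (x d p : 'rV[R]_N).

Fixpoint monom_idx (n : nat) : finType :=
  if n is n'.+1 then (monom_idx n' + 'I_N * monom_idx n')%type : finType else unit.

Fixpoint monom (n : nat) : monom_idx n -> 'rV[R]_N -> R :=
  match n with
  | 0%N => fun _ _ => 1
  | n'.+1 => fun j x => match j with
      | inl j' => monom j' x
      | inr (i, j') => x 0 i * monom j' x
      end
  end.

Lemma sum_monomS n (c : monom_idx n.+1 -> R) x :
  \sum_j c j * monom j x = \sum_j c (inl j) * monom j x +
    \sum_i \sum_j c (inr (i, j)) * (x 0 i * monom j x).
Proof.
rewrite big_sumType; congr (_ + _).
by rewrite pair_bigA; apply: eq_bigr => -[i j] _.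
Qed.

Lemma polyf_span n f : polyf n f ->
  exists c : monom_idx n -> R, forall x, f x = \sum_j c j * monom j x.
Proof.
elim=> {n f} [n c|n f g _ [c cE] _ [c' c'E]|n i f _ [c cE]|n f _ [c cE]].
- elim: n => [|n [c' c'E]].
    exists (fun=> c) => x; rewrite (big_pred1 (tt : monom_idx 0)) ?mulr1//.
  exists (fun j => if j is inl j' then c' j' else 0) => x.
  rewrite sum_monomS -c'E big1 ?addr0// => i _; rewrite big1// => j _.
  by rewrite mul0r.
- exists (fun j => c j + c' j) => x.
  by rewrite cE c'E -big_split; apply: eq_bigr => j _; rewrite mulrDl.
- exists (fun j => if j is inr (i', j') then (i' == i)%:R * c j' else 0) => x.
  rewrite sum_monomS big1 ?add0r; last by move=> j _; rewrite mul0r.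
  rewrite (bigD1 i)//= eqxx cE mulr_sumr [X in _ + X]big1 ?addr0.
    by apply: eq_bigr => j _; rewrite mul1r mulrCA.
  by move=> i' /negbTE ->; rewrite big1// => j _; rewrite !mul0r.
- exists (fun j => if j is inl j' then c j' else 0) => x.
  rewrite sum_monomS -cE big1 ?addr0// => i _; rewrite big1// => j _.
  by rewrite mul0r.
Qed.

(** The coefficient rows of [m.+1] functions live in an [m]-dimensional space. Redundancy among the
    [monom] is harmless, since only a spanning family is needed. *)
Lemma polyf_dependent n (F : nat -> 'rV[R]_N -> R) : (forall k, polyf n (F k)) ->
  exists m (a : nat -> R), (exists2 k, (k <= m)%N & a k != 0) /\
    forall x, \sum_(k < m.+1) a k * F k x = 0.
Proof.
move=> pF; pose m := #|monom_idx n|.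
have /choice[c cE] : forall k, exists c : monom_idx n -> R,
    forall x, F k x = \sum_j c j * monom j x.
  by move=> k; exact: polyf_span.
pose M : 'M[R]_(m.+1, m) := \matrix_(k, j) c k (enum_val j).
have kM : kermx M != 0.
  rewrite kermx_eq0 /row_free; apply/negP => /eqP rM.
  by have := rank_leq_col M; rewrite rM ltnn.
have /rowV0Pn[v /sub_kermxP vM v0] := kM.
exists m, (fun k => v 0 (inord k)); split.
  have [k vk] : exists k, v 0 k != 0.
    apply: contrapT => H; move/negP: v0; apply; apply/eqP/rowP => k; rewrite mxE.
    by apply/eqP; apply: contrapT => vk; apply: H; exists k; exact/negP.
  by exists (val k); [rewrite -ltnS; exact: ltn_ord|rewrite inord_val].
move=> x; under eq_bigr do rewrite inord_val cE mulr_sumr.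
rewrite exchange_big big1//= => j _.
have := congr1 (fun A : 'rV_m => A 0 (enum_rank j)) vM; rewrite !mxE => H.
transitivity ((\sum_k v 0 k * M k (enum_rank j)) * monom j x); last by rewrite H mul0r.
rewrite mulr_suml; apply: eq_bigr => k _.
by rewrite mxE enum_rankK mulrA.
Qed.

Lemma polyf_bubble n rho r : polyf n r -> polyf n.+2 (fun x => (rho - dot (x - 0) (x - 0)) * r x).
Proof.
move=> pr; apply: (@polyfM _ _ 2) => //.
rewrite (_ : (fun x => _) = fun x => rho + (-1) * dot (x - 0) (x - 0)).
  by apply: polyf_add; [exact: polyf_cst|exact/polyfZ/polyf_sq].
by apply/funext => x; rewrite mulN1r.
Qed.

(** Seek [h = P + (rho - |x|^2) r], so that the boundary values are automatic and [T r = - lap P]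
    must be solved for [T r = lap ((rho - |x|^2) r)]. The map [T] does not raise the degree and is
    injective on the ball by the maximum principle. Since the iterates of [T] on [lap P] are
    linearly dependent, cancelling the lowest power of [T] in a dependence relation exhibits [lap P]
    as a value of [T] on the ball. *)
Lemma dirichlet n rho P : (0 < N)%N -> polyf n P ->
  exists h, [/\ exists m, polyf m h, forall x, dot x x = rho -> h x = P x &
    forall x, dot x x < rho -> lap h x = 0].
Proof.
move=> N0 pP.
have [T TE] : exists T, forall r, T r = lap (fun x => (rho - dot (x - 0) (x - 0)) * r x).
  by exists (fun r => lap (fun x => (rho - dot (x - 0) (x - 0)) * r x)).
have pT m r : polyf m r -> polyf m (T r) by move=> pr; rewrite TE; exact: polyf_lap (polyf_bubble rho pr).
have TD m (r s : 'rV[R]_N -> R) k : polyf m r -> polyf m s -> forall x,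
    T (fun x => r x + k * s x) x = T r x + k * T s x.
  move=> pr ps x; rewrite !TE -(lapZ _ _ (polyf_bubble rho ps)).
  rewrite -(lapD _ (polyf_bubble rho pr) (polyfZ _ (polyf_bubble rho ps))).
  by rewrite (_ : (fun x => _ * (_ + _)) = fun x => (rho - dot (x - 0) (x - 0)) * r x +
    k * ((rho - dot (x - 0) (x - 0)) * s x))//; apply/funext => y; ring.
(* injectivity of [T], on the open ball, by the maximum principle *)
have Tinj m r : polyf m r -> (forall x, dot x x < rho -> T r x = 0) ->
    forall x, dot x x < rho -> r x = 0.
  move=> pr Tr x xr; pose w x := (rho - dot (x - 0) (x - 0)) * r x.
  have pw : polyf m.+2 w by exact: polyf_bubble.
  have wle : w x <= 0.
    apply: (subharmonic_le N0 pw (rho := rho)); last exact: ltW.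
      by move=> y yr; have -> : lap w y = 0 by have := Tr y yr; rewrite TE.
    by move=> y yr; rewrite /w subr0 yr subrr mul0r.
  have wge : -1 * w x <= 0.
    apply: (subharmonic_le N0 (polyfZ (-1) pw) (rho := rho)); last exact: ltW.
      by move=> y yr; rewrite (lapZ _ _ pw); have -> : lap w y = 0; [by have := Tr y yr; rewrite TE|rewrite mulr0].
    by move=> y yr; rewrite /w subr0 yr subrr mul0r mulr0.
  have : w x = 0 by lra.
  rewrite /w subr0 => /eqP; rewrite mulf_eq0 => /orP[/eqP xE|/eqP //].
  by move: xr; rewrite (_ : dot x x = rho) ?ltxx//; lra.
pose p0 := lap P.
have pp0 : polyf n p0 by apply: polyf_le (polyf_lap pP); lia.
pose F k := iter k T p0.
have pF k : polyf n (F k) by elim: k => [|k IH]; [exact: pp0|rewrite /F iterS; exact: pT].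
have [m [a [[k0 k0m ak0] aF]]] := polyf_dependent pF.
have sumE (b : nat -> R) k : T (fun x => \sum_(j < k) b j * F j x) =
    fun x => \sum_(j < k) b j * F j.+1 x.
  elim: k => [|k IH]; apply/funext => x.
    rewrite big_ord0 TE (_ : (fun x => _) = fun=> 0); first exact: lap_cst.
    by apply/funext => y; rewrite big_ord0 mulr0.
  have H := TD n _ _ (b k) (polyf_sum (index_enum _) (fun j : 'I_k => polyfZ (b j) (pF j))) (pF k) x.
  rewrite big_ord_recr.
  apply: etrans _ (congr1 (fun t => t + b k * F k.+1 x) (congr1 (@^~ x) IH)).
  apply: etrans _ H.
  rewrite (_ : (fun x => \sum_(j < k.+1) _) = fun x => \sum_(j < k) b j * F j x + b k * F k x) //.
  by apply/funext => y; rewrite big_ord_recr.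
have [j0 [j0m aj0 jmin]] : exists j0, [/\ (j0 <= m)%N, a j0 != 0 &
    forall j, (j < j0)%N -> a j = 0].
  have ex : exists k, (k <= m)%N && (a k != 0) by exists k0; rewrite k0m.
  case: (ex_minnP ex) => j /andP[jm aj] jmin; exists j; split=> // i ij.
  apply/eqP; apply: contraTT ij => ai; rewrite -leqNgt.
  have [im|mi] := leqP i m; first by apply: jmin; apply/andP; split.
  by move: (leq_ltn_trans jm mi); lia.
pose S k x := \sum_(j < m.+1 - k) a (j + k)%N * F j x.
have pS k : polyf n (S k) by apply: polyf_sum => j; exact: polyfZ.
pose S' k x := \sum_(j < m - k) a (j + k.+1)%N * F j x.
have SE k : (k <= m)%N -> forall x, S k x = a k * p0 x + T (S' k) x.
  move=> km x; rewrite /S' (sumE (fun j => a (j + k.+1)%N)) /S subSn//.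
  rewrite big_ord_recl /= add0n; congr (_ + _); apply: eq_bigr => j _.
  by rewrite /bump /= addnS.
(* Below [j0] the coefficients vanish, so [S k] is [T (S' k)] and injectivity removes one power of
   [T] from the relation. *)
have S0 k : (k <= j0)%N -> forall x, dot x x < rho -> S k x = 0.
  elim: k => [_ x _|k IH kj0].
    rewrite -[RHS](aF x) /S subn0; apply: eq_bigr => j _; by rewrite addn0.
  apply: (Tinj n) => // x xr; have := IH (ltnW kj0) x xr.
  by rewrite SE ?jmin ?mul0r ?add0r//; lia.
have pS' : polyf n (S' j0) by apply: polyf_sum => j; exact: polyfZ.
pose h x := P x + (a j0)^-1 * ((rho - dot (x - 0) (x - 0)) * S' j0 x).
have pb := polyfZ (a j0)^-1 (polyf_bubble rho pS').
exists h; split.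
- exists n.+2; apply: polyf_add pb; apply: polyf_le pP; lia.
- by move=> x xr; rewrite /h subr0 xr subrr mul0r mulr0 addr0.
- move=> x xr; rewrite (lapD _ pP pb) (lapZ _ _ (polyf_bubble rho pS')).
  have := S0 j0 (leqnn _) x xr; rewrite SE// TE => H.
  by apply: (mulfI aj0); rewrite mulr0 mulrDr mulVKf.
Qed.

End DirichletProblem.

(** * Uniform approximation by polynomials *)

Section PolynomialApproximation.
Variables (R : realType) (N : nat).
Implicit Types (f g h r w : 'rV[R]_N -> R) (x d p : 'rV[R]_N).

(* Newton's iteration [s + (t^2 - s^2) / 2] increases to [|t|] on [-1, 1]. *)
Fixpoint abs_iter (k : nat) (t : R) : R :=
  if k is k'.+1 then abs_iter k' t + 2^-1 * (t ^+ 2 - abs_iter k' t ^+ 2) else 0.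

(** One iteration multiplies the error by [1 - (|t| + s) / 2], at most [1 - |t| / 2]. The third
    clause is stable under this factor and gives an error of order [1 / k], uniformly down to
    [t = 0]. *)
Lemma abs_iter_bound k t : `|t| <= 1 ->
  [/\ 0 <= abs_iter k t, abs_iter k t <= `|t| &
      (`|t| - abs_iter k t) * (1 + k%:R * `|t| / 2) <= `|t|].
Proof.
move=> t1; have t0 := normr_ge0 t.
elim: k => [|k [s0 st H]] /=; first by rewrite subr0 mul0r mul0r addr0 mulr1.
rewrite -[t ^+ 2]real_normK ?num_real//; set a := `|t| in t1 t0 st H *.
set s := abs_iter k t in s0 st H *.
have sE : a - (s + 2^-1 * (a ^+ 2 - s ^+ 2)) = (a - s) * (1 - (a + s) / 2) by field.
split; [nra| |].
  by rewrite -subr_ge0 sE mulr_ge0//; lra.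
rewrite sE; set k' := k.+1%:R; have kE : k' = k%:R + 1 :> R by rewrite /k' -natr1.
have k0 : 0 <= k%:R :> R by exact: ler0n.
apply: le_trans H; rewrite -mulrA ler_wpM2l ?subr_ge0// kE.
have ka : 0 <= k%:R * a by rewrite mulr_ge0.
nra.
Qed.

Lemma abs_iter_le k t : `|t| <= 1 -> `| `|t| - abs_iter k.+1 t| <= 2 / k.+1%:R.
Proof.
move=> t1; have [s0 st H] := abs_iter_bound k.+1 t1.
rewrite ger0_norm ?subr_ge0// ler_pdivlMr//.
have [a0|a0] := eqVneq `|t| 0; first by rewrite (_ : _ - _ = 0) ?mul0r//; lra.
have {}a0 : 0 < `|t| by rewrite lt_neqAle eq_sym a0 normr_ge0.
rewrite -(ler_pM2r a0).
have : 0 <= `|t| - abs_iter k.+1 t by rewrite subr_ge0.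
by set D := `|t| - _ in H * => D0; lra.
Qed.

Definition approximable (rho : R) f := forall e : R, 0 < e -> exists n P,
  polyf n P /\ forall x, dot x x <= rho -> `|f x - P x| <= e.

Lemma approximable_polyf rho n f : polyf n f -> approximable rho f.
Proof. by move=> pf e e0; exists n, f; split=> // x _; rewrite subrr normr0 ltW. Qed.

Lemma approximableD rho f g : approximable rho f -> approximable rho g ->
  approximable rho (fun x => f x + g x).
Proof.
move=> af ag e e0; have e20 : 0 < e / 2 by rewrite divr_gt0.
have [n [P [pP fP]]] := af _ e20; have [m [Q [pQ gQ]]] := ag _ e20.
exists (maxn n m), (fun x => P x + Q x); split.
  by apply: polyf_add; [apply: polyf_le pP|apply: polyf_le pQ];
    rewrite ?leq_maxl ?leq_maxr.
move=> x xr; have := fP x xr; have := gQ x xr; rewrite !ler_norml; lra.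
Qed.

Lemma approximableZ rho k f : approximable rho f -> approximable rho (fun x => k * f x).
Proof.
move=> af e e0; have k0 : 0 < `|k| + 1 by rewrite ltr_wpDl.
have [n [P [pP fP]]] := af _ (divr_gt0 e0 k0).
exists n, (fun x => k * P x); split; first exact: polyfZ.
move=> x xr; rewrite -mulrBr normrM.
apply: (@le_trans _ _ (`|k| * (e / (`|k| + 1)))); first by rewrite ler_wpM2l// fP.
rewrite mulrCA -[leRHS]mulr1 ler_wpM2l ?(ltW e0)// ler_pdivrMr// mul1r; lra.
Qed.

Lemma polyf_bounded n P rho : polyf n P ->
  exists2 M : R, 0 < M & forall x, dot x x <= rho -> `|P x| <= M.
Proof.
move=> pP; have [K0|/set0P K0] := eqVneq [set x : 'rV[R]_N | dot (x - 0) (x - 0) <= rho] set0.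
  exists 1 => // x xr; have : [set x : 'rV[R]_N | dot (x - 0) (x - 0) <= rho] x by rewrite /= subr0.
  by rewrite K0.
have pPP : polyf (n + n) (fun x => - 1 * (P x * P x)) by exact/polyfZ/polyfM.
have [x Kx xmax] : exists2 x, dot (x - 0) (x - 0) <= rho & forall z, dot (z - 0) (z - 0) <= rho ->
    - 1 * (P x * P x) <= - 1 * (P z * P z).
  apply: compact_lsc_min K0 _; first exact: compact_sqball.
  by apply: lsc_within_cts => z _; exact: (cts_polyf pPP).
exists (`|P x| + 1); first by rewrite ltr_wpDl.
move=> z zr; have := xmax z; rewrite subr0 !mulN1r lerN2 => /(_ zr).
rewrite -!expr2 => H; apply: (@le_trans _ _ `|P x|); last by rewrite lerDl.
by rewrite -(@ler_pXn2r _ 2)// ?nnegrE// !real_normK ?num_real.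
Qed.

Lemma approximable_abs rho f : approximable rho f -> approximable rho (fun x => `|f x|).
Proof.
move=> af e e0; have e20 : 0 < e / 2 by rewrite divr_gt0.
have [n [P [pP fP]]] := af _ e20.
have [M M0 PM] := polyf_bounded rho pP.
pose k := Num.Def.truncn (4 * M / e).
have ke : 2 / k.+1%:R * M <= e / 2.
  have : 4 * M / e < k.+1%:R by apply: truncnS_gt.
  rewrite ltr_pdivrMr// => H.
  rewrite mulrAC ler_pdivrMr//; lra.
have [m pm] : exists m, polyf m (fun x => abs_iter k.+1 (M^-1 * P x)).
  elim: k.+1 => [|j [m pm]]; first by exists 0%N; exact: polyf_cst.
  have pt := polyfZ M^-1 pP.
  exists (maxn m (maxn (n + n) (m + m))) => /=; apply: polyf_add.
    by apply: polyf_le pm; rewrite leq_maxl.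
  apply: polyfZ.
  rewrite (_ : (fun x => _) = fun x => M^-1 * P x * (M^-1 * P x) +
    (-1) * (abs_iter j (M^-1 * P x) * abs_iter j (M^-1 * P x))); last first.
    by apply/funext => x; ring.
  apply: polyf_add; first by apply: polyf_le (polyfM pt pt); lia.
  apply: polyfZ; apply: polyf_le (polyfM pm pm); lia.
exists m, (fun x => M * abs_iter k.+1 (M^-1 * P x)); split; first exact: polyfZ.
move=> x xr; have t1 : `|M^-1 * P x| <= 1.
  by rewrite normrM gtr0_norm ?invr_gt0// mulrC ler_pdivrMr// mul1r PM.
have := abs_iter_le k t1; rewrite -(ler_pM2l M0) -{1}(gtr0_norm M0) -normrM mulrBr.
have -> : M * `|M^-1 * P x| = `|P x|.
  by rewrite normrM gtr0_norm ?invr_gt0// mulrA divff ?mul1r// gt_eqF.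
move=> H1; have H2 := fP x xr; have H3 := ler_dist_dist (f x) (P x).
apply: (le_trans (ler_distD `|P x| _ _)).
apply: (le_trans (lerD (le_trans H3 H2) H1)).
rewrite [M * _]mulrC; move: ke; set K := 2 / _ * M => ?; lra.
Qed.

Lemma approximable_max rho f g : approximable rho f -> approximable rho g ->
  approximable rho (fun x => Num.max (f x) (g x)).
Proof.
move=> af ag.
have := approximableZ 2^-1 (approximableD (approximableD af ag)
  (approximable_abs (approximableD af (approximableZ (-1) ag)))).
congr (approximable rho _); apply/funext => x; rewrite mulN1r.
case: (leP (f x) (g x)) => H.
  by rewrite ler0_norm ?subr_le0//; field.
by rewrite gtr0_norm ?subr_gt0//; field.
Qed.

(** A Dini-type argument: the polynomials touching [f] from below are almost as large as [f] near
    their contact points by upper semicontinuity, and by compactness a finite maximum of them is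
    almost as large everywhere. Finite maxima remain approximable. *)
Lemma approximable_sup rho f :
  (forall x, dot x x <= rho -> exists n l, [/\ polyf n l, l x = f x &
    forall y, dot y y <= rho -> l y <= f y]) ->
  lsc_within [set x : 'rV[R]_N | dot x x <= rho] (fun x => - f x) ->
  approximable rho f.
Proof.
move=> fl fusc e e0.
pose K := [set x : 'rV[R]_N | dot x x <= rho].
have Kc : compact K.
  rewrite (_ : K = [set x : 'rV[R]_N | dot (x - 0) (x - 0) <= rho]); first exact: compact_sqball.
  by apply/funext => x; rewrite /K /= subr0.
have [K0|/set0P[z0 Kz0]] := eqVneq K set0.
  exists 0%N, (fun=> 0); split; first exact: polyf_cst.
  by move=> x Kx; have : K x by []; rewrite K0.
pose good g := approximable rho g /\ forall y, K y -> g y <= f y.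
have gl x : K x -> exists2 l, good l & l x = f x /\ continuous l.
  move=> Kx; have [n [l [pl lx lf]]] := fl x Kx; exists l; last first.
    by split=> //; exact: (cts_polyf pl).
  by split=> //; exact: approximable_polyf pl.
have [l0 gl0 _] := gl z0 Kz0.
(* This filter of lower approximations is directed by pointwise maxima; the near-covering form of
   compactness then replaces the choice of a finite subcover. *)
pose F := filter_from good (fun g0 => [set g | good g /\ forall y, K y -> g0 y <= g y]).
have FF : Filter F.
  apply: filter_from_filter; first by exists l0.
  move=> g1 g2 [a1 f1] [a2 f2]; exists (fun x => Num.max (g1 x) (g2 x)).
    by split; [exact: approximable_max|move=> y Ky; rewrite ge_max f1// f2].
  move=> g /= [gg gm]; split; (split=> // y Ky; apply: (le_trans _ (gm y Ky)));
    by rewrite le_max lexx ?orbT.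
have e20 : 0 < e / 2 by rewrite divr_gt0.
have [g [[ag gf] fg]] : exists g, good g /\ forall y, K y -> f y <= g y + e / 2.
  have [|g0 [ag0 g0f] H] := (compact_near_coveringP K).1 Kc _ F
      (fun g y => good g /\ (K y -> f y <= g y + e / 2)) FF.
    move=> x Kx; have [l gdl [lx lc]] := gl x Kx.
    have e40 : 0 < e / 4 by rewrite divr_gt0.
    have N1 : \forall y \near x, K y -> - (f x + e / 4) < - f y.
      by apply: fusc => //; rewrite ltrN2 ltrDl.
    have N2 : \forall y \near x, l x - e / 4 < l y.
      by apply: (@cvgr_gt _ _ _ (nbhs_filter x) _ _ (lc x)); rewrite ltrBlDr ltrDl.
    exists ([set y | (K y -> - (f x + e / 4) < - f y) /\ l x - e / 4 < l y],
            [set g | good g /\ forall y, K y -> l y <= g y]).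
      by split=> /=; [exact: filterI|exists l].
    move=> [y g] [/= [H1 H2] [gg lg]]; split=> // Ky.
    have := H1 Ky; have := lg y Ky; lra.
  have gg0 : good g0 /\ forall y, K y -> g0 y <= g0 y by split.
  exists g0; split=> // y Ky; by have [_] := H g0 gg0 y Ky; exact.
have [n [P [pP gP]]] := ag _ e20.
exists n, P; split=> // x Kx; have := gP x Kx; have := fg x Kx; have := gf x Kx.
rewrite !ler_norml; lra.
Qed.

End PolynomialApproximation.

(** * Comparison with polynomials and sup-convolutions *)

Section SumOfJets.
Variables (R : realType) (N : nat).
Implicit Types (f g h r w : 'rV[R]_N -> R) (x d p xi : 'rV[R]_N).

Lemma near0_scale (P : set 'rV[R]_N) d : (\forall e \near (0 : 'rV[R]_N), P e) ->
  exists2 t0 : R, 0 < t0 & forall t, 0 < t <= t0 -> P (t *: d).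
Proof.
move=> /near_sqP[r r0 rP].
exists (Num.sqrt (r / (2 * (dot d d + 1)))) => [|t /andP[t0 tt]].
  by rewrite sqrtr_gt0 divr_gt0// mulr_gt0// ltr_wpDl ?sq_ge0.
have d1 : 0 < 2 * (dot d d + 1) by rewrite mulr_gt0// ltr_wpDl ?sq_ge0.
apply: rP; rewrite subr0 !dotE mulrA -expr2.
have : t ^+ 2 <= r / (2 * (dot d d + 1)).
  have q0 : 0 <= r / (2 * (dot d d + 1)) by rewrite divr_ge0// ltW.
  by rewrite -[leRHS](sqr_sqrtr q0) ler_pXn2r ?nnegrE ?sqrtr_ge0// ltW.
rewrite ler_pdivlMr// => H.
have := sqr_ge0 t; have := sq_ge0 d; nra.
Qed.

Lemma lin_le_qf l (Y : 'M[R]_N) : (\forall d \near (0 : 'rV[R]_N), dot l d <= 2^-1 * qf Y d) ->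
  l = 0 /\ forall d, 0 <= qf Y d.
Proof.
move=> H; have l0 : l = 0.
  apply: sq_eq0; apply/eqP; rewrite eq_le sq_ge0 andbT; apply/ler_addgt0Pr => e e0.
  have [t0 t0_gt0 tP] := near0_scale l H.
  pose t := Num.min t0 (e / (`|qf Y l| + 1)).
  have y0 : 0 < `|qf Y l| + 1 by rewrite ltr_wpDl.
  have t_gt0 : 0 < t by rewrite lt_min t0_gt0 divr_gt0.
  have := tP t; rewrite t_gt0 ge_min lexx /= => /(_ isT).
  rewrite dotZr qfZr => H1.
  have H2 : t * (`|qf Y l| + 1) <= e by rewrite -ler_pdivlMr// ge_min lexx orbT.
  have H3 := ler_norm (qf Y l); have H4 := normr_ge0 (qf Y l).
  have : dot l l <= 2^-1 * t * qf Y l by rewrite -(ler_pM2l t_gt0); lra.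
  nra.
split=> // d; move: H; rewrite l0 => H.
have [t0 t0_gt0 /(_ t0)] := near0_scale d H.
rewrite t0_gt0 lexx dot0l qfZr => /(_ isT).
have := exprn_gt0 2 t0_gt0; nra.
Qed.

Lemma mxtrace_qf (X : 'M[R]_N) : \tr X = \sum_i qf X (delta_mx 0 i).
Proof. by apply: eq_bigr => i _; rewrite /qf dot_delta -rowE mxE. Qed.

Definition usc_ball (rho : R) f :=
  lsc_within [set x : 'rV[R]_N | dot x x <= rho] (fun x => - f x).

Lemma compact_sqball0 rho : compact [set x : 'rV[R]_N | dot x x <= rho].
Proof.
rewrite (_ : [set x | _] = [set x : 'rV[R]_N | dot (x - 0) (x - 0) <= rho]).
  exact: compact_sqball.
by apply/funext => x /=; rewrite subr0.
Qed.

(** At an interior maximum of [f - Phi], the jet of [Phi] plus a small multiple of the identity is a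
    superjet of [f], and its trace is still below [c]. *)
Lemma visc_le n (Phi f : 'rV[R]_N -> R) rho c :
  polyf n Phi -> usc_ball rho f ->
  (forall x P X, dot x x < rho -> superjet f x P X -> c <= \tr X) ->
  (forall x, dot x x < rho -> lap Phi x < c) ->
  (forall x, dot x x = rho -> f x <= Phi x) ->
  forall x, dot x x <= rho -> f x <= Phi x.
Proof.
move=> pP fusc fv lc fb y Ky.
have [x Kx xmax] : exists2 x, dot x x <= rho & forall z, dot z z <= rho -> - f x + Phi x <= - f z + Phi z.
  apply: compact_lsc_min; [exact: compact_sqball0|by exists y|].
  apply: lsc_withinD fusc _; apply: lsc_within_cts => z _; exact: (cts_polyf pP).
suff : f x <= Phi x by have := xmax y Ky; lra.
move: Kx; rewrite le_eqVlt => /orP[/eqP/fb //|xl].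
have [l [q [Pj _ Pq]]] := polyf_jet x pP.
exfalso; have [[cl lE] [Q QT qE] Po] := Pj.
pose k := (c - lap Phi x) / (4 * N.+1%:R).
have k0 : 0 < k by rewrite divr_gt0 ?subr_gt0 ?lc// mulr_gt0.
have sj : superjet f x cl (Q + (2 * k)%:M).
  split; first by rewrite linearD /= QT tr_scalar_mx.
  have : \forall z \near x, dot (z - 0) (z - 0) < rho.
    have xl' : dot (x - 0) (x - 0) < rho by rewrite subr0.
    exact: (@cvgr_lt _ _ _ (nbhs_filter x) _ _ (cts_polyf (polyf_sq 0) (x:=x)) _ xl').
  move=> /near_sqP[r r0 rP].
  have Pk := Po k k0.
  have B : \forall d \near (0 : 'rV[R]_N), dot (x + d) (x + d) < rho.
    apply/near_sqP; exists r => // d; rewrite subr0 => dr.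
    have := rP (x + d); rewrite subr0; apply.
    by rewrite [x + d]addrC addrK.
  apply: filterS2 Pk B => d; rewrite ler_norml => /andP[_ H1] /ltW H2.
  have := xmax _ H2; rewrite qfD qf_scalar; move: H1; rewrite lE qE; lra.
have := fv x _ _ xl sj.
rewrite linearD /= mxtrace_scalar mxtrace_qf.
rewrite (eq_bigr _ (fun i _ => esym (qE (delta_mx 0 i)))) Pq.
have : (2 * k) *+ N < c - lap Phi x.
  rewrite -mulr_natl /k.
  have -> : N%:R * (2 * ((c - lap Phi x) / (4 * N.+1%:R))) = (c - lap Phi x) * (N%:R / (2 * N.+1%:R)).
    by field; rewrite gt_eqF// -natr1 ltr_wpDl.
  have cl0 : 0 < c - lap Phi x by rewrite subr_gt0 lc.
  rewrite -[ltRHS]mulr1 ltr_pM2l// ltr_pdivrMr ?mulr_gt0// mul1r -natr1.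
  by have := ler0n R N; lra.
lra.
Qed.

(* Sup-convolution [sup (f xi' - mu |xi - xi'|^2)] over the ball of radius
   [sqrt r], given by a selection [m] of maximizers. *)
Lemma sup_convolution (r mu : R) f : 0 < r -> 0 < mu -> usc_ball r f ->
  exists F m, [/\ forall xi, dot (m xi) (m xi) <= r,
    forall xi, F xi = f (m xi) - mu * dot (xi - m xi) (xi - m xi) &
    forall xi y, dot y y <= r -> f y - mu * dot (xi - y) (xi - y) <= F xi].
Proof.
move=> r0 mu0 fusc.
have H xi : exists y, dot y y <= r /\ forall z, dot z z <= r ->
    f z - mu * dot (xi - z) (xi - z) <= f y - mu * dot (xi - y) (xi - y).
  have [y Ky ymin] : exists2 y, dot y y <= r & forall z, dot z z <= r ->
    - f y + mu * dot (y - xi) (y - xi) <= - f z + mu * dot (z - xi) (z - xi).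
    apply: compact_lsc_min; first exact: compact_sqball0.
      by exists 0; rewrite /= dot0l ltW.
    apply: lsc_withinD fusc _; apply: lsc_within_cts => z _.
    exact: (cts_polyf (polyfZ mu (polyf_sq xi))).
  exists y; split=> // z Kz; have := ymin z Kz.
  by rewrite -!(nrm_sq (_ - _)) !(nrmB xi); lra.
have [m mP] := choice H.
exists (fun xi => f (m xi) - mu * dot (xi - m xi) (xi - m xi)), m; split=> // xi.
- by have [] := mP xi.
- by move=> y; have [_] := mP xi; apply.
Qed.

Section Convolved.
Variables (r mu : R) (f F : 'rV[R]_N -> R) (m : 'rV[R]_N -> 'rV[R]_N).
Hypotheses (r0 : 0 < r) (mu0 : 0 < mu).
Hypotheses (mr : forall xi, dot (m xi) (m xi) <= r)
  (FE : forall xi, F xi = f (m xi) - mu * dot (xi - m xi) (xi - m xi))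
  (Fge : forall xi y, dot y y <= r -> f y - mu * dot (xi - y) (xi - y) <= F xi).

(** The maximizer [m xi] is a competitor at [y]. So every point of the graph of [F] is touched from
    below by a paraboloid of fixed opening; this yields both the polynomial approximation of [F] and
    the lower bound on its Hessians. *)
Lemma sup_convolution_below xi y :
  F xi - mu * (2 * dot (xi - m xi) (y - xi) + dot (y - xi) (y - xi)) <= F y.
Proof.
apply: le_trans (Fge y (mr xi)); rewrite FE.
have -> : y - m xi = (xi - m xi) + (y - xi) by rewrite [RHS]addrC addrA subrK.
move: (xi - m xi) (y - xi) => a b; rewrite !dotE (dotC b a); lra.
Qed.

Lemma sup_convolution_usc rho : usc_ball rho F.
Proof.
have below := sup_convolution_below.
move=> x /= xr a aF; pose C := Num.sqrt rho + Num.sqrt r.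
have C0 : 0 <= C by rewrite addr_ge0 ?sqrtr_ge0.
pose e := - F x - a; have e0 : 0 < e by rewrite subr_gt0.
pose k := mu * (2 * C + 1) + 1.
have k0 : 0 < k by rewrite ltr_wpDl// mulr_ge0 ?(ltW mu0)//; lra.
pose t0 := Num.min 1 (e / k); have t00 : 0 < t0 by rewrite lt_min ltr01 divr_gt0.
apply/near_sqP; exists (t0 ^+ 2); first by rewrite exprn_gt0.
move=> y; rewrite -(ltr_nrm_sq _ (ltW t00)) nrmB lt_min => /andP[n1 n2] /= yr.
have := below y x; have := ler_dot (y - m y) (x - y); rewrite ler_norml => /andP[_ H1] H2.
have H3 : nrm (y - m y) <= C.
  apply: (le_trans (ler_nrmD _ _)); rewrite nrmN lerD//.
    by rewrite ler_nrm_sq ?sqrtr_ge0// sqr_sqrtr// (le_trans (sq_ge0 y)).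
  by rewrite ler_nrm_sq ?sqrtr_ge0// sqr_sqrtr ?(ltW r0).
have H4 : dot (y - m y) (x - y) <= C * nrm (x - y).
  by apply: (le_trans H1); rewrite ler_wpM2r ?nrm_ge0.
have H5 : dot (x - y) (x - y) <= nrm (x - y).
  by rewrite -nrm_sq expr2 -[leRHS]mulr1 ler_wpM2l ?nrm_ge0// ltW.
have H6 : nrm (x - y) * k < e by rewrite -ltr_pdivlMr.
have := nrm_ge0 (x - y); move: H6; rewrite /k /e; set t := nrm _ in H4 H5 *.
have : mu * (2 * dot (y - m y) (x - y) + dot (x - y) (x - y)) <= mu * ((2 * C + 1) * t).
  by rewrite ler_wpM2l ?(ltW mu0)//; lra.
lra.
Qed.

Lemma sup_convolution_approximable rho : approximable rho F.
Proof.
have below := sup_convolution_below.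
apply: approximable_sup; last exact: sup_convolution_usc.
  move=> x xr; pose c := - (2 * mu) *: (x - m x).
  exists 2%N, (fun y => (F x - dot c x) + (dot c y + (- mu) * dot (y - x) (y - x))).
  split.
  - apply: polyf_add; first exact: polyf_cst.
    apply: polyf_add; first by apply: polyf_le (polyf_dot _).
    exact/polyfZ/polyf_sq.
  - by rewrite subrr dot0r; ring.
  - move=> y yr; apply: le_trans (below x y).
    rewrite /c; move: (x - m x) => a; rewrite !dotZl.
    by rewrite [dot a (y - x)]dotDr dotNr; lra.
Qed.

(** The paraboloid touching from below fixes the gradient and bounds [X] from below; translating the
    competitor by [xi - m xi] transfers the jet from [F] to [f]. *)
Lemma sup_convolution_jet xi P X : dot (m xi) (m xi) < r -> superjet F xi P X ->
  [/\ P = - (2 * mu) *: (xi - m xi), forall d, - (2 * mu) * dot d d <= qf X d &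
      superjet f (m xi) P X].
Proof.
move=> mxr [XT FX].
have [P0 XP] : - (2 * mu) *: (xi - m xi) - P = 0 /\ forall d, 0 <= qf (X + (2 * mu)%:M) d.
  apply: lin_le_qf; apply: filterS FX => d.
  have := sup_convolution_below xi (xi + d).
  rewrite [xi + d - xi]addrC addKr; move: (xi - m xi) => a.
  rewrite qfD qf_scalar dotDl dotNl dotZl; lra.
split.
- by apply/eqP; rewrite eq_sym -subr_eq0 P0.
- by move=> d; have := XP d; rewrite qfD qf_scalar; lra.
split=> //.
have : \forall z \near m xi, dot (z - 0) (z - 0) < r.
  have mxr' : dot (m xi - 0) (m xi - 0) < r by rewrite subr0.
  exact: (@cvgr_lt _ _ _ (nbhs_filter (m xi)) _ _ (cts_polyf (polyf_sq 0) (x:=m xi)) _ mxr').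
move=> /near_sqP[s s0 sP].
have B : \forall d \near (0 : 'rV[R]_N), dot (m xi + d) (m xi + d) < r.
  apply/near_sqP; exists s => // d; rewrite subr0 => ds.
  have := sP (m xi + d); rewrite subr0; apply.
  by rewrite [m xi + d]addrC addrK.
apply: filterS2 FX B => d H1 /ltW H2.
have := Fge (xi + d) H2; have -> : xi + d - (m xi + d) = xi - m xi.
  by rewrite opprD addrACA subrr addr0.
by move: H1; rewrite (FE xi); lra.
Qed.

End Convolved.


Lemma polyf_qf (X : 'M[R]_N) : polyf 2 (qf X).
Proof.
apply: polyf_sum => j; apply: (@polyfM _ _ 1 1); last exact: polyf_coord.
rewrite (_ : (fun x => _) = dot (row j X^T)); first exact: polyf_dot.
by apply/funext => x; rewrite mxE; apply: eq_bigr => i _; rewrite !mxE mulrC.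
Qed.

Lemma lap_qf (X : 'M[R]_N) x : X^T = X -> lap (fun y => 2^-1 * qf X y) x = \tr X.
Proof.
move=> XT; rewrite (_ : (fun y => _) = quad 0 0 X); last first.
  by apply/funext => y; rewrite /quad subr0 dot0l add0r.
apply: eq_bigr => i _; rewrite (partial_quad 0 0 i XT).
by have [] := is_derive_affine_partial 0 0 X i i x.
Qed.

Lemma tr_mxtrace (X : 'M[R]_N) : \tr X^T = \tr X.
Proof. by apply: eq_bigr => i _; rewrite mxE. Qed.

Definition visc_near f (al : R) := forall L k : R, 0 < k -> exists2 rho : R, 0 < rho &
  forall xi P X, dot xi xi < rho -> `|f xi| < rho -> dot P P < rho -> superjet f xi P X ->
    (forall d, - L * dot d d <= qf X d) -> al - k <= \tr X.

(** Since [f] lies below [K0 * |y|^2] and [F] above [- mu * |xi|^2], a penalty [mu] large against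
    [K0] keeps [|xi - m xi|^2] below [3 * |xi|^2]. Hence jets of [F] near 0 come from jets of [f]
    near 0 with small value and gradient. *)
Lemma sup_convolution_visc (r mu K0 : R) f F (m : 'rV[R]_N -> 'rV[R]_N) (al : R) : 0 < r -> 0 <= K0 -> 4 * K0 + 1 <= mu ->
  (forall xi, F xi = f (m xi) - mu * dot (xi - m xi) (xi - m xi)) ->
  (forall xi, dot (m xi) (m xi) <= r) ->
  (forall xi y, dot y y <= r -> f y - mu * dot (xi - y) (xi - y) <= F xi) ->
  f 0 = 0 -> (forall y, dot y y <= r -> f y <= K0 * dot y y) -> visc_near f al ->
  forall k : R, 0 < k -> exists2 rho : R, 0 < rho & forall xi P X, dot xi xi < rho ->
    superjet F xi P X -> al - k <= \tr X.
Proof.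
move=> r0 K00 muK FE mr Fge f0 fK fv k k0.
have mu0 : 0 < mu by lra.
have [rho rho0 rhoP] := fv (2 * mu) k k0.
(* The four summands bound, per unit of [dot xi xi], the quantities to be kept small: the squared
   distance of [m xi] to 0, the value [f (m xi)] from above, the same value from below, and the
   squared gradient. *)
pose c := 8 + 8 * K0 + mu + 12 * mu ^+ 2.
have c0 : 0 < c by rewrite /c; have := sqr_ge0 mu; lra.
pose rho' := Num.min rho r / c.
have mr0 : 0 < Num.min rho r by rewrite lt_min rho0.
exists rho' => [|xi P X]; first by rewrite divr_gt0.
rewrite ltr_pdivlMr// lt_min /c => /andP[B1 B2] FX.
have FB : - (mu * dot xi xi) <= F xi.
  have := Fge xi 0; rewrite dot0l subr0 f0 => /(_ (ltW r0)); lra.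
have mE : m xi = xi - (xi - m xi) by rewrite opprB addrC subrK.
have HA : dot (m xi) (m xi) <= 2 * dot xi xi + 2 * dot (xi - m xi) (xi - m xi).
  rewrite {1 2}mE; have := sq_ge0 (xi + (xi - m xi)).
  by move: (xi - m xi) => a; rewrite !dotE (dotC a xi); lra.
have fm := fK _ (mr xi); have Fx := FE xi.
set A := dot (xi - m xi) (xi - m xi) in HA Fx.
set B := dot xi xi in B1 B2 FB HA.
have A0 : 0 <= A by exact: sq_ge0.
have B0 : 0 <= B by exact: sq_ge0.
have muB : 0 <= mu * B by rewrite mulr_ge0// ltW.
have KB : 0 <= K0 * B by rewrite mulr_ge0.
have mu2B : 0 <= mu ^+ 2 * B by rewrite mulr_ge0// sqr_ge0.
have KA : 0 <= K0 * A by rewrite mulr_ge0.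
have H1 : mu * A <= K0 * (2 * B + 2 * A) + mu * B.
  have : K0 * dot (m xi) (m xi) <= K0 * (2 * B + 2 * A) by rewrite ler_wpM2l.
  lra.
have AB : A <= 3 * B.
  rewrite -(ler_pM2l mu0).
  have : (4 * K0 + 1) * A <= mu * A by rewrite ler_wpM2r.
  have : (4 * K0 + 1) * B <= mu * B by rewrite ler_wpM2r.
  nra.
have mB : dot (m xi) (m xi) <= 8 * B by lra.
have mxr : dot (m xi) (m xi) < r by lra.
have [PE XL fX] := sup_convolution_jet mr FE Fge mxr FX.
apply: (rhoP (m xi) P X) => //; first by lra.
  have H2 : f (m xi) <= K0 * (8 * B) by apply: (le_trans fm); rewrite ler_wpM2l.
  have H3 : 0 <= mu * A by rewrite mulr_ge0// ltW.
  rewrite ltr_norml; apply/andP; split; lra.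
rewrite PE dotZl dotZr -/A.
have : mu ^+ 2 * A <= mu ^+ 2 * (3 * B) by rewrite ler_wpM2l ?sqr_ge0.
lra.
Qed.

End SumOfJets.

(** * The theorem on sums in traced form at the origin *)

Section TheoremOnSums.
Variables (R : realType) (N : nat).

Lemma sq_row_mx (xi ze : 'rV[R]_N) : dot (row_mx xi ze) (row_mx xi ze) = dot xi xi + dot ze ze.
Proof.
rewrite /dot big_split_ord /=; congr (_ + _); apply: eq_bigr => i _.
  by rewrite row_mxEl.
by rewrite row_mxEr.
Qed.

(* The two sup-convolutions are trapped between paraboloids, so their jets near
   0 have small gradients and they are viscosity subsolutions of Poisson
   equations; comparing them with polynomial solutions that have almost the same
   boundary values on a small sphere bounds their sum, which vanishes at 0. *)
Lemma sum_superjets0 (f g : 'rV[R]_N -> R) (Q : 'M[R]_(N + N)) (r al be : R) :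
  (0 < N)%N -> Q^T = Q -> 0 < r -> usc_ball r f -> usc_ball r g ->
  f 0 = 0 -> g 0 = 0 ->
  (forall xi ze, dot xi xi <= r -> dot ze ze <= r ->
    f xi + g ze <= 2^-1 * qf Q (row_mx xi ze)) ->
  visc_near f al -> visc_near g be ->
  al + be <= \sum_i qf Q (row_mx (delta_mx 0 i) (delta_mx 0 i)).
Proof.
move=> N0 QT r0 fusc gusc f0 g0 fgQ fv gv.
set S := \sum_i _; rewrite leNgt; apply/negP => Slt.
pose n := N%:R : R; have n0 : 0 < n by rewrite ltr0n.
pose k := (al + be - S) / (16 * n).
have gap0 : 0 < al + be - S by rewrite subr_gt0.
have k0 : 0 < k by rewrite divr_gt0// mulr_gt0.
have [C C0 QC] := qf_perturb Q k0.
have [K _ QK] := qf_bound Q.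
have QK1 w : qf Q w <= `|K| * dot w w.
  apply: le_trans (ler_norm _) _; apply: le_trans (QK w w) _.
  by rewrite -expr2 nrm_sq ler_wpM2r ?sq_ge0// ler_norm.
pose K0 := `|K|; have K00 : 0 <= K0 by exact: normr_ge0.
pose mu := 4 * K0 + 1 + C; have mu0 : 0 < mu by rewrite /mu; lra.
have muK : 4 * K0 + 1 <= mu by rewrite /mu; lra.
have [F [m [mr FE Fge]]] := sup_convolution r0 mu0 fusc.
have [G [m' [mr' GE Gge]]] := sup_convolution r0 mu0 gusc.
have fK y : dot y y <= r -> f y <= K0 * dot y y.
  move=> yr; have := fgQ y 0 yr; rewrite dot0l g0 addr0 => /(_ (ltW r0)) H.
  have := QK1 (row_mx y 0); rewrite sq_row_mx dot0l addr0 -/K0.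
  have : 0 <= K0 * dot y y by rewrite mulr_ge0 ?sq_ge0.
  lra.
have gK y : dot y y <= r -> g y <= K0 * dot y y.
  move=> yr; have := fgQ 0 y; rewrite dot0l f0 add0r => /(_ (ltW r0) yr) H.
  have := QK1 (row_mx 0 y); rewrite sq_row_mx dot0l add0r -/K0.
  have : 0 <= K0 * dot y y by rewrite mulr_ge0 ?sq_ge0.
  lra.
have [rf rf0 Fv] := sup_convolution_visc r0 K00 muK FE mr Fge f0 fK fv k0.
have [rg rg0 Gv] := sup_convolution_visc r0 K00 muK GE mr' Gge g0 gK gv k0.
pose rho := Num.min rf rg.
have rho0 : 0 < rho by rewrite lt_min rf0.
have F00 : 0 <= F 0.
  have := Fge 0 0; rewrite subrr dot0l f0 mulr0 subrr; apply; exact: ltW.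
have G00 : 0 <= G 0.
  have := Gge 0 0; rewrite subrr dot0l g0 mulr0 subrr; apply; exact: ltW.
(* Both maximizers are moved to [x] with [qf_perturb]; the cost [C] is covered because [mu] exceeds
   [C]. *)
have FG x : F x + G x <= 2^-1 * qf Q (row_mx x x) + k * dot x x.
  have H := QC (row_mx x x) (row_mx (m x) (m' x) - row_mx x x).
  move: H; rewrite addrC subrK opp_row_mx add_row_mx !sq_row_mx => H.
  have := fgQ _ _ (mr x) (mr' x).
  rewrite FE GE -!(nrm_sq (_ - _)) (nrmB x) (nrmB x) !nrm_sq.
  have := sq_ge0 (m x - x); have := sq_ge0 (m' x - x).
  move: H; set a := dot (m x - x) _; set b := dot (m' x - x) _ => H b0 a0.
  have : C * (a + b) <= mu * (a + b) by rewrite ler_wpM2r ?addr_ge0// /mu; lra.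
  have : 0 <= C * (a + b) by rewrite mulr_ge0 ?addr_ge0// ltW.
  lra.
pose A : 'M[R]_(N, N + N) := row_mx 1%:M 1%:M.
have rowA (x : 'rV[R]_N) : row_mx x x = x *m A by rewrite mul_mx_row mulmx1.
(* Hessian of the restriction of the bound to the diagonal, enlarged by [4 * k] so that a margin
   [k * dot x x] is left on the sphere. *)
pose X := A *m Q *m A^T + (4 * k)%:M.
have XT : X^T = X by rewrite linearD /= !trmx_mul trmxK QT tr_scalar_mx mulmxA.
have XE x : qf X x = qf Q (row_mx x x) + 4 * k * dot x x.
  by rewrite qfD qf_scalar rowA /qf !mulmxA dot_mulmx trmxK.
have trX : \tr X = S + 4 * k * n.
  rewrite mxtrace_qf /S -[n]/(N%:R) mulr_natr -[X in _ *+ X]card_ord -sumr_const -big_split.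
  by apply: eq_bigr => i _; rewrite XE dot_delta mxE !eqxx mulr1.
pose q x := 2^-1 * qf X x.
have pq : polyf 2 q by exact/polyfZ/polyf_qf.
have FGq x : F x + G x <= q x - k * dot x x by have := FG x; rewrite /q XE; lra.
pose e1 := k * rho / 8; have e10 : 0 < e1 by rewrite divr_gt0// mulr_gt0.
have [nF [PF [pPF HPF]]] := sup_convolution_approximable r0 mu0 mr FE Fge rho e10.
have [nG [PG [pPG HPG]]] := sup_convolution_approximable r0 mu0 mr' GE Gge rho e10.
have [hF [[dF pF] bF lF]] := dirichlet rho N0 pPF.
have [hG [[dG pG] bG lG]] := dirichlet rho N0 pPG.
(* A paraboloid that vanishes on the sphere: it corrects the Laplacian without touching boundary
   values, at the price of its value [c] at the centre. *)
pose par (c : R) (x : 'rV[R]_N) : R := c + (- c / rho) * dot (x - 0) (x - 0).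
have pcst (c : R) : polyf 0 (fun _ : 'rV[R]_N => c) by exact: polyf_cst.
have ppar c : polyf 2 (par c).
  by apply: polyf_add; [exact: polyf_cst|exact/polyfZ/polyf_sq].
have lpar c x : lap (par c) x = - c / rho * (2 * n).
  by rewrite (lapD _ (pcst _) (polyfZ _ (polyf_sq (0 : 'rV[R]_N)))) lap_cst add0r
    (lapZ _ _ (polyf_sq (0 : 'rV[R]_N))) lap_sq natrM.
have bpar c x : dot x x = rho -> par c x = 0.
  by move=> xr; rewrite /par subr0 xr; field; rewrite gt_eqF.
have par0 c : par c 0 = c by rewrite /par subrr dot0l mulr0 addr0.
have comp (F' h PF' : 'rV[R]_N -> R) d c : usc_ball rho F' -> polyf d h ->
    (forall x P Y, dot x x < rho -> superjet F' x P Y -> c - k <= \tr Y) ->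
    (forall x, dot x x = rho -> h x = PF' x) -> (forall x, dot x x < rho -> lap h x = 0) ->
    (forall x, dot x x <= rho -> `|F' x - PF' x| <= e1) ->
    F' 0 <= h 0 + e1 - (c - 2 * k) * rho / (2 * n).
  move=> F'usc ph F'v hb hl hP.
  pose Phi x := h x + par (- ((c - 2 * k) * rho / (2 * n))) x + e1.
  have pPhi : polyf (maxn d 2) Phi.
    apply: polyf_add; last exact: polyf_cst.
    apply: polyf_add; [apply: polyf_le ph|apply: polyf_le (ppar _)];
      by rewrite ?leq_maxl ?leq_maxr.
  have := visc_le pPhi F'usc F'v _ _ (x := 0); rewrite dot0l /Phi par0 => H.
  apply: le_trans (H _ _ (ltW rho0)) _; last by lra.
    move=> x xr; rewrite (lapD _ (polyf_add (polyf_le (leq_maxl d 2) ph) (polyf_le (leq_maxr d 2) (ppar _))) (pcst _)).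
    rewrite (lapD _ ph (ppar _)) lap_cst hl// lpar.
    have -> : 0 + - - ((c - 2 * k) * rho / (2 * n)) / rho * (2 * n) + 0 = c - 2 * k.
      by field; rewrite !gt_eqF.
    by rewrite ltrD2l ltrN2 ltr_pMl// ltr1n.
  move=> x xr; rewrite hb// bpar// addr0.
  by have := hP x; rewrite xr => /(_ (lexx _)); rewrite ler_norml; lra.
have uF : usc_ball rho F by exact: (sup_convolution_usc r0 mu0 mr FE Fge).
have uG : usc_ball rho G by exact: (sup_convolution_usc r0 mu0 mr' GE Gge).
have rfg : rho <= rf /\ rho <= rg by rewrite /rho !ge_min !lexx orbT.
have Fv' x P Y : dot x x < rho -> superjet F x P Y -> al - k <= \tr Y.
  by move=> xr; apply: Fv; exact: lt_le_trans xr rfg.1.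
have Gv' x P Y : dot x x < rho -> superjet G x P Y -> be - k <= \tr Y.
  by move=> xr; apply: Gv; exact: lt_le_trans xr rfg.2.
have HF := comp F hF PF dF al uF pF
  Fv' bF lF HPF.
have HG := comp G hG PG dG be uG pG
  Gv' bG lG HPG.
pose W x := hF x + hG x + (-1) * q x + par (- (\tr X * rho / (2 * n))) x.
have pFG := polyf_add (polyf_le (leq_maxl dF dG) pF) (polyf_le (leq_maxr dF dG) pG).
have pFGq := polyf_add (polyf_le (leq_maxl (maxn dF dG) 2) pFG)
  (polyf_le (leq_maxr (maxn dF dG) 2) (polyfZ (-1) pq)).
have pW := polyf_add pFGq (polyf_le (leq_maxr (maxn dF dG) 2) (ppar (- (\tr X * rho / (2 * n))))).
have HW : W 0 <= - (k * rho) + 2 * e1.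
  apply: (subharmonic_le N0 pW (rho := rho)); last by rewrite dot0l ltW.
    move=> x xr; rewrite (lapD _ pFGq (ppar _)) (lapD _ pFG (polyfZ _ pq)) (lapD _ pF pG).
    rewrite lF// lG// (lapZ _ _ pq) lap_qf// lpar.
    by rewrite le_eqVlt; apply/orP; left; apply/eqP; field; rewrite !gt_eqF.
  move=> x xr; rewrite bF// bG// bpar//.
  have := HPF x; have := HPG x; have := FGq x; rewrite xr => H1 /(_ (lexx _)) H2 /(_ (lexx _)) H3.
  move: H2 H3; rewrite !ler_norml; lra.
(* [F 0] and [G 0] are nonnegative, so [HF], [HG] and [HW] together bound a positive multiple of
   [k * rho] by a negative one: [k] was chosen as a small fraction of the supposed gap. *)
move: HW; rewrite /W par0 /q /qf dot0r mulr0 trX.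
have kE : k * rho = (al + be - S) * rho / (16 * n) by rewrite /k; field; rewrite gt_eqF.
have E1 : (al - 2 * k) * rho / (2 * n) + (be - 2 * k) * rho / (2 * n) - (S + 4 * k * n) * rho / (2 * n) =
  8 * (k * rho) - 2 * (k * rho) / n - 2 * (k * rho).
  by rewrite /k; field; rewrite gt_eqF.
have kr : 0 < k * rho by rewrite mulr_gt0.
have : (k * rho) / n <= k * rho.
  by rewrite ler_pdivrMr// ler_peMr ?(ltW kr)// ler1n.
rewrite /e1 in HF HG *; lra.
Qed.

End TheoremOnSums.

(** * Reduction of an elliptic trace operator to the Laplacian *)

Section ChangeOfVariables.
Variables (R : realType) (N : nat).
Implicit Types (x d P : 'rV[R]_N) (E X Y Z S : 'M[R]_N).

Lemma qf_mulmx E X d : qf X (d *m E) = qf (E *m X *m E^T) d.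
Proof. by rewrite /qf !mulmxA [RHS]dot_mulmx trmxK. Qed.

Lemma qf_delta X i : qf X (delta_mx 0 i) = X i i.
Proof. by rewrite /qf dot_delta -rowE mxE. Qed.

Lemma psd_entry Z i j : Z^T = Z -> (forall d, 0 <= qf Z d) -> `|Z i j| <= (Z i i + Z j j) / 2.
Proof.
move=> ZT Z0; have H (s : R) : s ^+ 2 = 1 -> 0 <= Z i i + 2 * s * Z i j + Z j j.
  move=> s1; have := Z0 (delta_mx 0 i + s *: delta_mx 0 j).
  rewrite /qf mulmxDl -scalemxAl !dotE !dot_delta -!rowE !mxE.
  have -> : Z j i = Z i j by rewrite -{1}ZT mxE.
  have ss : s * (s * Z j j) = Z j j by rewrite mulrA -expr2 s1 mul1r.
  lra.
have := H 1 (expr1n _ _); have := H (-1); rewrite sqrrN expr1n => /(_ erefl).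
rewrite ler_norml; lra.
Qed.

(** For a positive semidefinite [Z] all entries are controlled by the diagonal, so an entrywise
    error in [S] costs only a multiple of the trace. *)
Lemma trace_perturb Z S (eta : R) : 0 <= eta -> Z^T = Z -> (forall d, 0 <= qf Z d) ->
  (forall i j, `|S i j - (i == j)%:R| <= eta) ->
  \tr (S *m Z) <= (1 + eta * N%:R) * \tr Z.
Proof.
move=> eta0 ZT Z0 SI.
have trZ : \sum_i Z i i = \tr Z by [].
rewrite mulrDl mul1r -lerBlDl -{2}[Z]mul1mx -linearB /= -mulmxBl.
apply: (@le_trans _ _ (\sum_(i < N) \sum_(j < N) eta * ((Z i i + Z j j) / 2))).
  apply: ler_sum => i _; rewrite mxE; apply: ler_sum => j _.
  apply: (le_trans (ler_norm _)); rewrite normrM; apply: ler_pM => //.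
    by rewrite !mxE; exact: SI.
  by rewrite (le_trans (psd_entry j i ZT Z0))// addrC.
under eq_bigr => i _ do rewrite -mulr_sumr -mulr_suml big_split /= sumr_const card_ord trZ.
rewrite -mulr_sumr -mulr_suml big_split /= sumrMnl trZ sumr_const card_ord.
by rewrite -[\tr Z *+ N]mulr_natr le_eqVlt; apply/orP; left; apply/eqP; field.
Qed.

(** A lower bound for an operator whose coefficients [S] tend to [A]. The limiting form is needed
    because sup-convolutions only give jets at nearby points, with nearby values and gradients. *)
Definition superjet_bound (V : 'rV[R]_N -> R) (x0 P0 : 'rV[R]_N) (A : 'M[R]_N) (c : R) :=
  forall k : R, 0 < k -> exists2 rho : R, 0 < rho &
    forall x P X, dot (x - x0) (x - x0) < rho -> `|V x - V x0| < rho ->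
      dot (P - P0) (P - P0) < rho -> superjet V x P X ->
      exists2 S : 'M[R]_N, (forall i j, `|S i j - A i j| <= k) & c - k <= \tr (S *m X).

Lemma superjet_comp (V : 'rV[R]_N -> R) x0 P0 E xi P X : E \in unitmx ->
  superjet (fun d => V (x0 + d *m E) - V x0 - dot P0 (d *m E)) xi P X ->
  superjet V (x0 + xi *m E) (P0 + P *m (invmx E)^T) (invmx E *m X *m (invmx E)^T).
Proof.
move=> Eu [XT HX]; split; first by rewrite !trmx_mul trmxK XT mulmxA.
have [K K0 KE] := sq_mulmx_le (invmx E).
have [r r0 rP] := (near_sqP _ _).1 HX.
apply/near_sqP; exists (r / (K ^+ 2 + 1)).
  by rewrite divr_gt0// ltr_wpDl// sqr_ge0.
move=> d; rewrite subr0 ltr_pdivlMr ?ltr_wpDl ?sqr_ge0// => dr.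
have := rP (d *m invmx E); rewrite /= subr0 !mulmxDl mulmxKV// -qf_mulmx.
have -> : dot P (d *m invmx E) = dot (P *m (invmx E)^T) d by rewrite dot_mulmx trmxK.
rewrite addrA [dot P0 (_ + _)]dotDr [dot (P0 + _) d]dotDl => H.
have : dot (d *m invmx E) (d *m invmx E) < r.
  apply: (le_lt_trans (KE d)); have := sq_ge0 d; lra.
move=> /H; lra.
Qed.

Lemma visc_near_comp (V : 'rV[R]_N -> R) x0 P0 E c : E \in unitmx ->
  superjet_bound V x0 P0 (E^T *m E) c ->
  visc_near (fun d => V (x0 + d *m E) - V x0 - dot P0 (d *m E)) c.
Proof.
move=> Eu HV L k k0.
pose F := invmx E; pose L' := `|L|; have L0 : 0 <= L' by exact: normr_ge0.
pose C := (\sum_i \sum_j `|F i j|) ^+ 2 + 1.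
have C1 : 1 <= C by rewrite lerDr sqr_ge0.
have C0 : 0 < C by lra.
pose n := N%:R : R; have n0 : 0 <= n by exact: ler0n.
(* Collects every error term that is linear in the coefficient error [k1], so that [k1 = k / T]
   keeps their sum below [k]. *)
pose T := 2 + C * (L' * n + L' * n * n + n * `|c| + n * k).
have T0 : 0 < T.
  rewrite /T ltr_pwDl// mulr_ge0 ?(ltW C0)// !addr_ge0// !mulr_ge0// ltW//.
pose k1 := k / T; have k10 : 0 < k1 by rewrite divr_gt0.
have [rho rho0 rhoP] := HV k1 k10.
have [K K0 KE] := sq_mulmx_le E.
have [M M0 MF] := sq_mulmx_le F^T.
pose B := 2 + K ^+ 2 + M ^+ 2 + K * nrm P0.
have K20 := sqr_ge0 K; have M20 := sqr_ge0 M.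
have KP0 : 0 <= K * nrm P0 by rewrite mulr_ge0 ?nrm_ge0.
have B0 : 0 < B by rewrite /B; lra.
pose t := Num.min 1 (rho / B); have t0 : 0 < t by rewrite lt_min ltr01 divr_gt0.
have t1 : t <= 1 by rewrite ge_min lexx.
have tB : t * B <= rho by rewrite -ler_pdivlMr// ge_min lexx orbT.
exists (t ^+ 2) => [|xi P X xit fxi Pt FX XL]; first by rewrite exprn_gt0.
have tt : t ^+ 2 <= t by rewrite expr2 ler_piMl// ltW.
have nE : nrm (xi *m E) <= K * t.
  rewrite ler_nrm_sq ?mulr_ge0 ?(ltW t0)// (le_trans (KE xi))// exprMn.
  by rewrite ler_wpM2l// ltW.
have [S SA trS] : exists2 S : 'M[R]_N, (forall i j, `|S i j - (E^T *m E) i j| <= k1) &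
    c - k1 <= \tr (S *m (F *m X *m F^T)).
  apply: (rhoP (x0 + xi *m E) (P0 + P *m F^T)).
  - rewrite [x0 + _]addrC addrK; apply: (le_lt_trans (KE xi)).
    have : K ^+ 2 * dot xi xi <= K ^+ 2 * t ^+ 2 by rewrite ler_wpM2l// ltW.
    have : K ^+ 2 * t ^+ 2 <= K ^+ 2 * t by rewrite ler_wpM2l.
    rewrite /B in tB; have : 0 <= t * M ^+ 2 by rewrite mulr_ge0// ltW.
    have : 0 <= t * (K * nrm P0) by rewrite mulr_ge0// ltW.
    lra.
  - have := ler_dot P0 (xi *m E).
    have : nrm P0 * nrm (xi *m E) <= nrm P0 * (K * t) by rewrite ler_wpM2l ?nrm_ge0.
    move: fxi; rewrite /B in tB; have : 0 <= t * M ^+ 2 by rewrite mulr_ge0// ltW.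
    have : 0 <= t * K ^+ 2 by rewrite mulr_ge0// ltW.
    move=> h1 h2 fxi h3 h4.
    have h5 : `|V (x0 + xi *m E) - V x0| <=
        `|V (x0 + xi *m E) - V x0 - dot P0 (xi *m E)| + `|dot P0 (xi *m E)|.
      by apply: le_trans (ler_normD _ _); rewrite subrK.
    by apply: (le_lt_trans h5); set u := `|_ - _ - _| in fxi h5 *; set v := `|dot _ _| in h4 h5 *; lra.
  - rewrite [P0 + _]addrC addrK; apply: (le_lt_trans (MF P)).
    have : M ^+ 2 * dot P P <= M ^+ 2 * t ^+ 2 by rewrite ler_wpM2l// ltW.
    have : M ^+ 2 * t ^+ 2 <= M ^+ 2 * t by rewrite ler_wpM2l.
    rewrite /B in tB; have : 0 <= t * K ^+ 2 by rewrite mulr_ge0// ltW.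
    have : 0 <= t * (K * nrm P0) by rewrite mulr_ge0// ltW.
    lra.
  - exact: superjet_comp.
have [XT _] := FX.
pose S2 := F^T *m S *m F.
have trE : \tr (S *m (F *m X *m F^T)) = \tr (S2 *m X).
  by rewrite /S2 !mulmxA mxtrace_mulC !mulmxA.
have EF : E *m F = 1%:M by exact: mulmxV.
have S2I i j : `|S2 i j - (i == j)%:R| <= k1 * C.
  have -> : (i == j)%:R = (F^T *m (E^T *m E) *m F) i j.
    by rewrite -!mulmxA EF mulmx1 -trmx_mul EF trmx1 mxE.
  have -> : S2 i j - (F^T *m (E^T *m E) *m F) i j = (F^T *m (S - E^T *m E) *m F) i j.
    by rewrite mulmxBr mulmxBl !mxE.
  rewrite mxE; apply: (le_trans (ler_norm_sum _ _ _)).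
  apply: (@le_trans _ _ (k1 * ((\sum_k \sum_l `|F k l|) * (\sum_k \sum_l `|F k l|)))); last first.
    by rewrite ler_wpM2l ?(ltW k10)// /C -expr2 lerDl.
  set T1 := \sum_k \sum_l `|F k l|.
  have T10 : 0 <= T1 by apply: sumr_ge0 => a _; exact: sumr_ge0.
  have Fcol b : \sum_a `|F a b| <= T1.
    by apply: ler_sum => a _; rewrite (bigD1 b)//= lerDl sumr_ge0.
  apply: (@le_trans _ _ (\sum_a (k1 * T1) * `|F a j|)); last first.
    by rewrite -mulr_sumr -mulrA ler_wpM2l ?(ltW k10)// ler_wpM2l.
  apply: ler_sum => a _; rewrite normrM ler_wpM2r// mxE.
  apply: (le_trans (ler_norm_sum _ _ _)).
  apply: (@le_trans _ _ (\sum_b k1 * `|F b i|)); last first.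
    by rewrite -mulr_sumr ler_wpM2l ?(ltW k10).
  apply: ler_sum => b _; rewrite normrM [leRHS]mulrC; apply: ler_pM => //.
    by rewrite mxE.
  by have := SA b a; rewrite !mxE.
(* The lower bound on [X] makes this shift positive semidefinite; the shift is undone afterwards
   through the trace of [S2]. *)
pose Z := X + L'%:M.
have ZT : Z^T = Z by rewrite linearD /= XT tr_scalar_mx.
have Z0 d : 0 <= qf Z d.
  rewrite qfD qf_scalar; have := XL d; have := sq_ge0 d; have := ler_norm L.
  rewrite -/L' => h1 h2 h3; have : L * dot d d <= L' * dot d d by rewrite ler_wpM2r.
  lra.
have eta0 : 0 <= k1 * C by rewrite mulr_ge0// ltW.
have := trace_perturb eta0 ZT Z0 S2I.
rewrite /Z mulmxDr !linearD /= mul_mx_scalar linearZ /= mxtrace_scalar -trE -[L' *+ N]mulr_natr -/n.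
have trS2 : n - n * (k1 * C) <= \tr S2.
  have -> : n - n * (k1 * C) = \sum_(i < N) (1 - k1 * C).
    by rewrite sumr_const card_ord -[_ *+ N]mulr_natl -/n; ring.
  apply: ler_sum => i _; have := S2I i i; rewrite eqxx /= ler_norml => /andP[? _]; lra.
have : L' * (n - n * (k1 * C)) <= L' * \tr S2 by rewrite ler_wpM2l.
move: (\tr (S *m _)) (\tr S2) (\tr X) trS => a b T' h1 h2 h3.
rewrite leNgt; apply/negP => h4.
have h5 : (1 + k1 * C * n) * T' <= (1 + k1 * C * n) * (c - k).
  by rewrite ler_wpM2l ?(ltW h4)// addr_ge0// mulr_ge0.
have h6 : k1 * C * n * c <= k1 * C * n * `|c|.
  by rewrite ler_wpM2l ?ler_norm// mulr_ge0.
have h7 : k = k1 * T by rewrite /k1 divfK// gt_eqF.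
have h8 : 0 <= k1 * C * n * k by exact: mulr_ge0 (mulr_ge0 eta0 n0) (ltW k0).
have h9 : k1 * T = 2 * k1 + k1 * C * (L' * n) + k1 * C * (L' * n * n) + k1 * C * n * `|c| + k1 * C * n * k.
  by rewrite /T; ring.
lra.
Qed.


Lemma near_affine (x0 xi : 'rV[R]_N) E (Pr : set 'rV[R]_N) :
  (\forall y \near x0 + xi *m E, Pr y) -> \forall z \near xi, Pr (x0 + z *m E).
Proof.
move=> /near_sqP[r r0 rP]; have [K K0 KE] := sq_mulmx_le E.
apply/near_sqP; exists (r / (K ^+ 2 + 1)).
  by rewrite divr_gt0// ltr_wpDl// sqr_ge0.
move=> z; rewrite ltr_pdivlMr ?ltr_wpDl ?sqr_ge0// => zr; apply: rP.
rewrite opprD addrACA subrr add0r -mulmxBl.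
apply: (le_lt_trans (KE _)); have := sq_ge0 (z - xi); lra.
Qed.

Lemma usc_ball_affine (V : 'rV[R]_N -> R) x0 P0 E r r' :
  lsc_within [set x | dot (x - x0) (x - x0) <= r] (fun x => - V x) ->
  (forall xi, dot xi xi <= r' -> dot (xi *m E) (xi *m E) <= r) ->
  usc_ball r' (fun d => V (x0 + d *m E) - V x0 - dot P0 (d *m E)).
Proof.
move=> Vusc Er.
have -> : usc_ball r' (fun d => V (x0 + d *m E) - V x0 - dot P0 (d *m E)) =
    lsc_within [set x : 'rV[R]_N | dot x x <= r']
      (fun d => - V (x0 + d *m E) + (V x0 + dot (P0 *m E^T) d)).
  congr lsc_within; apply/funext => d; rewrite dot_mulmx trmxK; ring.
apply: lsc_withinD.
  move=> xi /= xir a aV.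
  have := Vusc (x0 + xi *m E) _ a aV; rewrite /= [x0 + _]addrC addrK => /(_ (Er _ xir)).
  rewrite [_ + x0]addrC => /near_affine; apply: filterS => z zP zr.
  by apply: zP; rewrite [x0 + _]addrC addrK Er.
by apply: lsc_within_cts => z _; exact: (cts_polyf (polyf_add (polyf_cst _ _ _) (polyf_dot _))).
Qed.

End ChangeOfVariables.

(** * The theorem on sums along a pair of frames *)

Section SumOfSuperjets.
Variables (R : realType) (N : nat).
Implicit Types (x d P : 'rV[R]_N) (E X Y Z S : 'M[R]_N).

(** After linear changes by [E1] and [E2] this is [sum_superjets0]: its diagonal vectors become
    pairs of corresponding rows. Only this one trace of the Hessian of the test function is ever
    used. *)
Lemma sum_superjets (V W : 'rV[R]_N -> R) (x0 y0 P0 Q0 : 'rV[R]_N) (E1 E2 : 'M[R]_N)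
    (c1 c2 r : R) (q : 'rV[R]_(N + N) -> R) :
  (0 < N)%N -> E1 \in unitmx -> E2 \in unitmx -> is_qf q -> 0 < r ->
  lsc_within [set x | dot (x - x0) (x - x0) <= r] (fun x => - V x) ->
  lsc_within [set x | dot (x - y0) (x - y0) <= r] (fun x => - W x) ->
  superjet_bound V x0 P0 (E1^T *m E1) c1 -> superjet_bound W y0 Q0 (E2^T *m E2) c2 ->
  (forall k : R, 0 < k -> \forall w \near (0 : 'rV[R]_(N + N)),
     V (x0 + lsubmx w) + W (y0 + rsubmx w) <= V x0 + W y0 +
       (dot P0 (lsubmx w) + dot Q0 (rsubmx w)) + 2^-1 * q w + k * dot w w) ->
  c1 + c2 <= \sum_i q (row_mx (row i E1) (row i E2)).
Proof.
move=> N0 E1u E2u [Q QT qE] r0 Vusc Wusc HV HW HVW.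
apply/ler_addgt0Pr => e e0.
pose rE i := row_mx (row i E1) (row i E2).
pose T := \sum_i dot (rE i) (rE i).
have T0 : 0 <= T by apply: sumr_ge0 => i _; exact: sq_ge0.
pose k := e / (2 * (T + 1)).
have T1 : 0 < 2 * (T + 1) by lra.
have k0 : 0 < k by rewrite divr_gt0.
have [r1 r10 r1P] := (near_sqP _ _).1 (HVW k k0).
pose B := block_mx E1 0 0 E2.
have wB (xi ze : 'rV[R]_N) : row_mx xi ze *m B = row_mx (xi *m E1) (ze *m E2).
  by rewrite mul_row_block !mulmx0 addr0 add0r.
have [K K0 KB] := sq_mulmx_le B.
have K1 : 0 < 2 * K ^+ 2 + 2 by have := sqr_ge0 K; lra.
pose r2 := Num.min r r1; have r20 : 0 < r2 by rewrite lt_min r0.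
have r2r : r2 <= r by rewrite ge_min lexx.
have r2r1 : r2 <= r1 by rewrite ge_min lexx orbT.
pose r' := r2 / (2 * K ^+ 2 + 2); have r'0 : 0 < r' by rewrite divr_gt0.
have small (xi ze : 'rV[R]_N) : dot xi xi <= r' -> dot ze ze <= r' ->
    dot (row_mx xi ze *m B) (row_mx xi ze *m B) < r2.
  move=> xr zr; apply: (le_lt_trans (KB _)); rewrite sq_row_mx.
  have : K ^+ 2 * (dot xi xi + dot ze ze) <= K ^+ 2 * (r' + r').
    by rewrite ler_wpM2l ?sqr_ge0// lerD.
  have : r2 = r' * (2 * K ^+ 2 + 2) by rewrite /r' divfK// gt_eqF.
  lra.
(* The second summand turns the allowance [k * dot w w] into part of the quadratic bound; it
   contributes [2 * k * T] to the trace, below [e] by the choice of [k]. *)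
pose Q' := B *m Q *m B^T + (2 * k) *: (B *m B^T).
have Q'T : Q'^T = Q'.
  by rewrite /Q' linearD /= linearZ /= !trmx_mul !trmxK QT mulmxA.
have Q'E (xi ze : 'rV[R]_N) : qf Q' (row_mx xi ze) = q (row_mx (xi *m E1) (ze *m E2)) +
    2 * k * dot (row_mx (xi *m E1) (ze *m E2)) (row_mx (xi *m E1) (ze *m E2)).
  rewrite /Q' qfD qfZ qE -wB qf_mulmx; congr (_ + _ * _).
  by rewrite /qf mulmxA dot_mulmx trmxK.
have dl0 (E : 'M[R]_N) : 0 *m E = 0 :> 'rV[R]_N by rewrite mul0mx.
have H := @sum_superjets0 R N (fun d => V (x0 + d *m E1) - V x0 - dot P0 (d *m E1))
  (fun d => W (y0 + d *m E2) - W y0 - dot Q0 (d *m E2)) Q' r' c1 c2 N0 Q'T r'0.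
have : c1 + c2 <= \sum_i qf Q' (row_mx (delta_mx 0 i) (delta_mx 0 i)).
  apply: H.
  - apply: (usc_ball_affine Vusc) => xi xr; apply: (le_trans _ r2r).
    have := small xi 0 xr; rewrite dot0l wB sq_row_mx => /(_ (ltW r'0)).
    by rewrite mul0mx dot0l addr0 => /ltW.
  - apply: (usc_ball_affine Wusc) => xi xr; apply: (le_trans _ r2r).
    have := small 0 xi; rewrite dot0l wB sq_row_mx => /(_ (ltW r'0) xr).
    by rewrite mul0mx dot0l add0r => /ltW.
  - by rewrite mul0mx addr0 dot0r; lra.
  - by rewrite mul0mx addr0 dot0r; lra.
  - move=> xi ze xr zr; have := r1P (row_mx (xi *m E1) (ze *m E2)).
    rewrite subr0 -wB /= => /(_ (lt_le_trans (small _ _ xr zr) r2r1)).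
    rewrite wB row_mxKl row_mxKr Q'E; lra.
  - exact: visc_near_comp.
  - exact: visc_near_comp.
move=> /le_trans; apply.
have -> : \sum_i qf Q' (row_mx (delta_mx 0 i) (delta_mx 0 i)) =
    \sum_i q (row_mx (row i E1) (row i E2)) + 2 * k * T.
  by rewrite mulr_sumr -big_split; apply: eq_bigr => i _; rewrite Q'E -!rowE.
rewrite lerD2l /k.
have -> : 2 * (e / (2 * (T + 1))) * T = e * (T / (T + 1)) by field; rewrite gt_eqF//; lra.
by rewrite ler_piMr ?(ltW e0)// ler_pdivrMr ?mul1r; lra.
Qed.

End SumOfSuperjets.

(** * Matched frames for two tangent planes of graphs *)

Section Frames.
Variables (R : realType) (N : nat).
Implicit Types (p q x y : 'rV[R]_N) (X : 'M[R]_N).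

Definition slope p : R := Num.sqrt (1 + dot p p).

Lemma slope_sq p : slope p ^+ 2 = 1 + dot p p.
Proof. by rewrite sqr_sqrtr// addr_ge0// sq_ge0. Qed.

Lemma slope_ge1 p : 1 <= slope p.
Proof.
rewrite -(@ler_pXn2r _ 2) ?nnegrE ?sqrtr_ge0// slope_sq expr1n lerDl; exact: sq_ge0.
Qed.

Lemma slope_gt0 p : 0 < slope p.
Proof. exact: lt_le_trans ltr01 (slope_ge1 p). Qed.

(** Cauchy-Schwarz in R^(N+1) for the normals [(p, -1)] and [(q, -1)], whose lengths are the
    slopes. *)
Lemma dot_le_slope p q : 1 + dot p q <= slope p * slope q.
Proof.
rewrite leNgt; apply/negP => H.
have h0 : 0 <= slope p * slope q by rewrite mulr_ge0// ltW// slope_gt0.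
have : (slope p * slope q) ^+ 2 < (1 + dot p q) ^+ 2 by rewrite ltr_pXn2r ?nnegrE//; lra.
rewrite exprMn !slope_sq; have := cauchy_schwarz p q; have := sq_ge0 (p - q).
rewrite !dotE (dotC q p); nra.
Qed.

Lemma curvmx_sym p : (curvmx p)^T = curvmx p.
Proof. by rewrite /curvmx linearB /= linearZ /= trmx1 trmx_mul trmxK. Qed.

Lemma mulmx_curvmx p x : x *m curvmx p = x - (dot x p / (1 + dot p p)) *: p.
Proof.
rewrite /curvmx mulmxBr mulmx1 -scalemxAr mulmxA [x *m p^T]mx11_scalar mul_scalar_mx scalerA.
rewrite mulrC; congr (_ - (_ / _) *: _); rewrite mxE; apply: eq_bigr => i _; by rewrite mxE.
Qed.

Lemma outer_mxE p q i j : (p^T *m q) i j = p 0 i * q 0 j.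
Proof. by rewrite mxE big_ord1 mxE. Qed.

Definition tilt_dir p q : 'rV[R]_N :=
  (slope p * slope q + 1 + dot p q)^-1 *: (p + (slope p / slope q) *: q).

(* The linear map [x |-> x + (x . (p - q)) tilt_dir p q] is, on horizontal
   components, the rotation of R^(N+1) in the plane of the two normals that takes
   the tangent space of slope p to the one of slope q. *)
Lemma frames p q : exists E1 E2 : 'M[R]_N,
  [/\ E1 \in unitmx, E2 \in unitmx, E1^T *m E1 = curvmx p, E2^T *m E2 = curvmx q &
      forall i, row i E2 = row i E1 + dot (row i E1) (p - q) *: tilt_dir p q].
Proof.
have [a1 b1] := (slope_ge1 p, slope_ge1 q).
have [aa bb] := (slope_sq p, slope_sq q).
set a := slope p in a1 aa; set b := slope q in b1 bb.
have a0 : a != 0 by rewrite gt_eqF//; lra.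
have b0 : b != 0 by rewrite gt_eqF//; lra.
have a10 : a + 1 != 0 by rewrite gt_eqF//; lra.
(* The symmetric square root of [curvmx p]: on the line of [p] the eigenvalue drops from 1 to
   [1 / a]. *)
pose E1 : 'M[R]_N := 1%:M - (a * (a + 1))^-1 *: (p^T *m p).
have E1T : E1^T = E1 by rewrite /E1 linearB /= linearZ /= trmx1 trmx_mul trmxK.
have pp : p *m p^T = (dot p p)%:M.
  by rewrite [LHS]mx11_scalar mxE; congr (_%:M); apply: eq_bigr => i _; rewrite mxE.
have E1E1 : E1^T *m E1 = curvmx p.
  rewrite E1T /E1 mulmxBl mul1mx mulmxBr mulmx1 -scalemxAl -scalemxAr.
  rewrite -mulmxA [p *m (p^T *m p)]mulmxA pp mul_scalar_mx -!scalemxAr.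
  apply/matrixP => i j; rewrite !mxE big_ord1 !mxE -aa.
  have -> : dot p p = a ^+ 2 - 1 by rewrite aa; ring.
  by field; rewrite a0 a10.
have unit_of x (E : 'M[R]_N) : E^T *m E = curvmx x -> E \in unitmx.
  move=> EE; suff : curvmx x \in unitmx by rewrite -EE unitmx_mul => /andP[].
  (* The inverse of [curvmx x] is [1 + x^T x], the metric induced on a graph of slope [x]. *)
  apply: (@mulmx1_unit _ _ _ (1%:M + x^T *m x) _).1 => //.
  rewrite mulmxDr mulmx1; apply/matrixP => i j.
  have x1 : 1 + dot x x != 0 by rewrite gt_eqF// ltr_pwDl ?sq_ge0.
  have xx : curvmx x *m (x^T *m x) = (1 + dot x x)^-1 *: (x^T *m x).
    rewrite mulmxA -[curvmx x]trmxK curvmx_sym -trmx_mul mulmx_curvmx linearB linearZ /=.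
    rewrite mulmxBl -scalemxAl -{1}[x^T *m x]scale1r -scalerBl; congr (_ *: _).
    by field.
  by rewrite xx /curvmx !mxE; ring.
pose r := p - q; pose w := tilt_dir p q.
pose M : 'M[R]_N := 1%:M + r^T *m w.
have outer (x y : 'rV[R]_N) : x *m y^T = (dot x y)%:M.
  by rewrite [LHS]mx11_scalar mxE; congr (_%:M); apply: eq_bigr => i _; rewrite mxE.
have E2E2 : (E1 *m M)^T *m (E1 *m M) = curvmx q.
  rewrite trmx_mul -mulmxA [E1^T *m _]mulmxA E1E1.
  pose s := r - (dot r p / (1 + dot p p)) *: p.
  have rS : r *m curvmx p = s by exact: mulmx_curvmx.
  have Sr : curvmx p *m r^T = s^T by rewrite -rS trmx_mul curvmx_sym.
  have -> : M^T *m (curvmx p *m M) = curvmx p + s^T *m w + w^T *m s + dot r s *: (w^T *m w).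
    rewrite /M linearD /= trmx1 trmx_mul trmxK mulmxDl mul1mx mulmxDr mulmx1 !mulmxA Sr.
    rewrite mulmxDr -!mulmxA rS [r *m (s^T *m w)]mulmxA outer mul_scalar_mx -scalemxAr.
    by rewrite !addrA -scalemxAr.
  have D0 : a * b + 1 + dot p q != 0.
    have : slope (- q) = b by rewrite /slope dotNr dotNl opprK.
    by have := dot_le_slope p (- q) => /[swap] ->; rewrite dotNr -/a => dle; rewrite gt_eqF//; lra.
  pose d := dot p q.
  have rp : dot r p = a ^+ 2 - 1 - d by rewrite /r dotDl dotNl (dotC q) aa /d; ring.
  have rq : dot r q = d - b ^+ 2 + 1 by rewrite /r dotDl dotNl bb /d; ring.
  have rs : dot r s = b ^+ 2 - (1 + d) ^+ 2 / a ^+ 2.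
    rewrite /s dotDr dotNr dotZr rp -aa {1}/r dotDr dotNr rp rq.
    by field.
  apply/matrixP => i j; rewrite /curvmx !mxE !big_ord1 !mxE rs rp -aa -bb -/a -/b -/d.
  field; rewrite D0 a0 b0; lra.
exists E1, (E1 *m M); split => //.
- exact: unit_of E1E1.
- exact: unit_of E2E2.
- by move=> i; rewrite row_mul /M mulmxDr mulmx1 mulmxA outer mul_scalar_mx.
Qed.

Lemma dot_frame (E : 'M[R]_N) x y :
  \sum_i dot (row i E) x * dot (row i E) y = dot (x *m (E^T *m E)) y.
Proof.
have rowE i z : dot (row i E) z = (z *m E^T) 0 i.
  by rewrite mxE; apply: eq_bigr => j _; rewrite !mxE mulrC.
rewrite mulmxA dot_mulmx; apply: eq_bigr => i _; by rewrite !rowE.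
Qed.

Lemma tr_frame (E : 'M[R]_N) X : \sum_i qf X (row i E) = \tr (E^T *m E *m X).
Proof.
rewrite -mulmxA mxtrace_mulC -mulmxA mxtrace_qf; apply: eq_bigr => i _.
by rewrite mulmxA -qf_mulmx -rowE.
Qed.

Lemma qf_curvmx_ge p x : dot x x / (1 + dot p p) <= qf (curvmx p) x.
Proof.
have p1 : 0 < 1 + dot p p by rewrite ltr_pwDl ?sq_ge0.
rewrite ler_pdivrMr// /qf mulmx_curvmx !dotE mulrAC mulrBl divfK ?gt_eqF//.
have := cauchy_schwarz x p; rewrite (dotC p x); nra.
Qed.

Lemma qf_curvmx_le p x : qf (curvmx p) x <= dot x x.
Proof.
have p1 : 0 < 1 + dot p p by rewrite ltr_pwDl ?sq_ge0.
rewrite /qf mulmx_curvmx !dotE (dotC p x) gerBl mulrAC -expr2 divr_ge0 ?sqr_ge0//; exact: ltW.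
Qed.

Lemma mxtrace_curvmx_le p : \tr (curvmx p) <= N%:R.
Proof.
have := tr_curvmx p 1%:M; rewrite mulmx1 mxtrace1 qf_scalar mul1r => ->.
by rewrite gerBl divr_ge0 ?sq_ge0// addr_ge0 ?sq_ge0.
Qed.

Lemma slope_lip p q : `|slope p - slope q| <= nrm (p - q).
Proof.
rewrite -(@ler_pXn2r _ 2) ?nnegrE ?nrm_ge0// nrm_sq real_normK ?num_real//.
have := dot_le_slope p q; have := slope_sq p; have := slope_sq q.
rewrite !dotE (dotC q p); nra.
Qed.

Lemma slopeN p : slope (- p) = slope p.
Proof. by rewrite /slope !dotE opprK. Qed.

Lemma curvmxN p : curvmx (- p) = curvmx p.
Proof.
have tN : (- p)^T = - p^T by apply/matrixP => i j; rewrite !mxE.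
by rewrite /curvmx !dotE opprK tN mulNmx mulmxN opprK.
Qed.

End Frames.

(** * The theorem on sums for curvature operators *)

Section FramedSums.
Variables (R : realType) (N : nat).
Implicit Types (p q x y : 'rV[R]_N) (X : 'M[R]_N).

Lemma cts_sq : continuous (fun p : 'rV[R]_N => dot p p).
Proof. by move=> p; apply: (@cvg_dot R N _ (nbhs p) id id); exact: cvg_id. Qed.

Lemma cts_slope : continuous (@slope R N).
Proof.
move=> p; apply: (@continuous_comp _ _ _ (fun p => 1 + dot p p) Num.sqrt).
  by apply: continuousD; [exact: cst_continuous|exact: cts_sq].
exact: sqrt_continuous.
Qed.

Lemma curvmx_near p0 (k : R) : 0 < k ->
  \forall p \near p0, forall i j, `|curvmx p i j - curvmx p0 i j| <= k.
Proof.
move=> k0; suff h i j : (\forall p \near p0, `|curvmx p i j - curvmx p0 i j| <= k).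
  have hi i := @filter_forall _ _ _ (nbhs p0) (nbhs_filter p0) (h i).
  exact: (@filter_forall _ _ _ (nbhs p0) (nbhs_filter p0) hi).
have E p : curvmx p i j = (1%:M : 'M[R]_N) i j - (1 + dot p p)^-1 * (p 0 i * p 0 j).
  by rewrite !mxE big_ord1 !mxE.
have co l : {for p0, continuous (fun p : 'rV[R]_N => p 0 l)} by exact: coord_continuous.
have c1 : {for p0, continuous (fun p : 'rV[R]_N => (1 + dot p p)^-1 * (p 0 i * p 0 j))}.
  apply: continuousM; last by apply: continuousM; exact: co.
  apply: continuousV; first by rewrite gt_eqF// ltr_pwDl ?sq_ge0.
  by apply: continuousD; [exact: cst_continuous|exact: cts_sq].
have : (fun p => curvmx p i j) p @[p --> p0] --> curvmx p0 i j.
  rewrite E; under eq_fun do rewrite E.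
  exact: (continuousB (@cst_continuous _ _ ((1%:M : 'M[R]_N) i j) p0) c1).
move/cvgr_dist_le => /(_ k k0) h.
have {}h : \forall p \near p0, `|curvmx p0 i j - curvmx p i j| <= k by exact: h.
by apply: filterS h => p; rewrite distrC.
Qed.

(** [V] stands for an increasing function of a possibly discontinuous [h]. The growth hypothesis
    makes closeness of values of [V] force closeness of values of [h], so the continuous data [sl]
    and [cc] may depend on the value of [h]. *)
Lemma superjet_bound_curvmx (V h : 'rV[R]_N -> R) (eps : R) x0 P0
    (sl : 'rV[R]_N * R * 'rV[R]_N -> 'rV[R]_N) (cc : 'rV[R]_N * R * 'rV[R]_N -> R) :
  0 < eps -> (forall x, eps * `|h x - h x0| <= `|V x - V x0|) ->
  {for (x0, h x0, P0), continuous sl} -> {for (x0, h x0, P0), continuous cc} ->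
  (\forall t \near (x0, h x0, P0), forall X, h t.1.1 = t.1.2 -> superjet V t.1.1 t.2 X ->
     cc t <= \tr (curvmx (sl t) *m X)) ->
  superjet_bound V x0 P0 (curvmx (sl (x0, h x0, P0))) (cc (x0, h x0, P0)).
Proof.
move=> eps0 hV csl ccc tr k k0.
have n1 : (\forall t \near (x0, h x0, P0), forall i j,
    `|curvmx (sl t) i j - curvmx (sl (x0, h x0, P0)) i j| <= k).
  exact: csl _ (curvmx_near _ k0).
have n2 : (\forall t \near (x0, h x0, P0), cc (x0, h x0, P0) - k <= cc t).
  by apply: (cvgr_ge _ ccc); rewrite gtrBl.
have := filterI (filterI n1 n2) tr.
case=> -[A B] /= [[[A1 A2] /= [a1 a2] sA] nB] sub.
have [r1 r10 h1] := (near_sqP x0 _).1 a1.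
have [r2 /= r20 h2] := (nbhs_ballP (h x0) _).1 a2.
have [r3 r30 h3] := (near_sqP P0 _).1 nB.
exists (Num.min r1 (Num.min (eps * r2) r3)); first by rewrite !lt_min r10 mulr_gt0.
move=> x P X; rewrite !lt_min => /andP[d1 _] /and3P[_ d2 _] /and3P[_ _ d3] sj.
have [|[g1 g2] g3] := sub (x, h x, P).
  split => /=; last exact: h3.
  apply: sA; split => /=; first exact: h1.
  by apply: h2; rewrite /ball /= distrC -(ltr_pM2l eps0); apply: le_lt_trans (hV x) d2.
by exists (curvmx (sl (x, h x, P))) => //; apply: (le_trans g2); exact: g3.
Qed.

(** The two frames differ by multiples of the single vector [tilt_dir p q]. For a test form in
    [y - x] the sum therefore reduces to one direction, and the first two conclusions allow all sums
    over the frame to be evaluated. *)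
Lemma sum_superjets_frames (V W : 'rV[R]_N -> R) x0 y0 P0 Q0 p q c1 c2 r
    (Q : 'rV[R]_(N + N) -> R) : (0 < N)%N -> is_qf Q -> 0 < r ->
  lsc_within [set x | dot (x - x0) (x - x0) <= r] (fun x => - V x) ->
  lsc_within [set x | dot (x - y0) (x - y0) <= r] (fun x => - W x) ->
  superjet_bound V x0 P0 (curvmx p) c1 -> superjet_bound W y0 Q0 (curvmx q) c2 ->
  (forall k : R, 0 < k -> \forall w \near (0 : 'rV[R]_(N + N)),
     V (x0 + lsubmx w) + W (y0 + rsubmx w) <= V x0 + W y0 +
       (dot P0 (lsubmx w) + dot Q0 (rsubmx w)) + 2^-1 * Q w + k * dot w w) ->
  exists e : 'I_N -> 'rV[R]_N, [/\
    forall x y, \sum_i dot (e i) x * dot (e i) y = dot (x *m curvmx p) y,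
    forall X, \sum_i qf X (e i) = \tr (curvmx p *m X) &
    c1 + c2 <= \sum_i Q (row_mx (e i) (e i + dot (e i) (p - q) *: tilt_dir p q))].
Proof.
move=> N0 qQ r0 lV lW bV bW near.
have [E1 [E2 [u1 u2 EE1 EE2 E12]]] := frames p q.
exists (fun i => row i E1); split.
- by move=> x y; rewrite dot_frame EE1.
- by move=> X; rewrite tr_frame EE1.
- rewrite -EE1 in bV; rewrite -EE2 in bW.
  have := sum_superjets N0 u1 u2 qQ r0 lV lW bV bW near.
  by under eq_bigr do rewrite E12.
Qed.

Lemma jet_mulmx M (f : 'rV[R]_N -> R) x l (q : 'rV[R]_N -> R) (A : 'M[R]_(M, N)) : jet f x l q ->
  jet (fun w => f (x + w *m A)) 0 (fun w => l (w *m A)) (fun w => q (w *m A)).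
Proof.
move=> [[c lc] [Q QT qQ] o]; split.
- by exists (c *m A^T) => d; rewrite lc dot_mulmx trmxK.
- exists (A *m Q *m A^T); first by rewrite !trmx_mul trmxK QT mulmxA.
  by move=> d; rewrite qQ /qf !mulmxA [in RHS]dot_mulmx trmxK.
- have [K K0 hK] : exists2 K : R, 0 <= K & forall d : 'rV[R]_M, dot (d *m A) (d *m A) <= K * dot d d.
    have [K K0 hK] := qf_bound (A *m A^T).
    exists K => // d; have := hK d d; rewrite -expr2 nrm_sq => /(le_trans (ler_norm _)).
    by rewrite mulmxA [in leLHS]dot_mulmx trmxK.
  move=> k k0.
  have k1 : 0 < k / (K + 1) by rewrite divr_gt0// ltr_wpDl.
  have cA : (w *m A) @[w --> (0 : 'rV[R]_M)] --> (0 : 'rV[R]_N).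
    move=> P /= nP; have : nbhs (0 : 'rV[R]_N) P by [].
    case/near_sqP => rho rho0 sP; apply/near_sqP; exists (rho / (K + 1)).
      by rewrite divr_gt0// ltr_wpDl.
    move=> w; rewrite !subr0 ltr_pdivlMr ?ltr_wpDl// => hw; apply: sP; rewrite subr0.
    by apply: le_lt_trans (hK w) _; apply: le_lt_trans hw; rewrite mulrC ler_wpM2l ?sq_ge0// lerDl.
  have := cA _ (o _ k1) => h1.
  apply: (@filterS _ (nbhs (0 : 'rV[R]_M)) (nbhs_filter _) _ _ _ h1) => w /= h; rewrite mul0mx !addr0 add0r.
  apply: le_trans h _; rewrite mulrAC ler_pdivrMr ?ltr_wpDl// -mulrA ler_wpM2l ?(ltW k0)//.
  apply: le_trans (hK w) _; rewrite mulrC ler_wpM2l ?sq_ge0// lerDl//.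
Qed.

Lemma jet_exp (f : 'rV[R]_N -> R) x l (q : 'rV[R]_N -> R) n : jet f x l q ->
  jet (fun y => f y ^+ n.+2) x (fun d => (n.+2%:R * f x ^+ n.+1) * l d)
    (fun d => (n.+2%:R * f x ^+ n.+1) * q d + (n.+2%:R * n.+1%:R * f x ^+ n) * l d ^+ 2).
Proof.
move=> jf; elim: n => [|n IH].
  apply: eq_jet (jetM jf jf) => d; rewrite ?expr0 ?expr1 ?expr2; ring.
apply: eq_jet (jetM jf IH) => d; rewrite -?natr1 ?exprS; ring.
Qed.

End FramedSums.

(** * Touching along spheres of variable radius *)

Section Touching.
Variables (R : realType) (N : nat).
Implicit Types (p q x y : 'rV[R]_N) (X : 'M[R]_N).

Lemma slope_sum_ge p q : 2 <= slope p * slope q + 1 + dot p q.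
Proof. have := dot_le_slope p (- q); rewrite slopeN dotNr; lra. Qed.

Lemma slope_defect_le p q : 2 * (slope p * slope q - 1 - dot p q) <= dot (p - q) (p - q).
Proof.
have -> : dot (p - q) (p - q) = dot p p + dot q q - 2 * dot p q.
  by rewrite !dotE (dotC q p); ring.
have := slope_sq p; have := slope_sq q; have := sqr_ge0 (slope p - slope q); nra.
Qed.

(** The left side is the coefficient [kap] of the tilt in [touching]. It collapses to the defect of
    the two normals in Cauchy-Schwarz, which is quadratic in [p - q]; that is what makes the final
    error quartic in the gradient of the radius. *)
Lemma tilt_dirE p q (D := slope p * slope q + 1 + dot p q) :
  dot (tilt_dir p q) (tilt_dir p q) - (slope q ^+ 2)^-1 + (1 - dot q (tilt_dir p q)) ^+ 2 =
  (slope p * slope q - 1 - dot p q) / (slope q ^+ 2 * D).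
Proof.
have D0 : D != 0 by rewrite gt_eqF// (lt_le_trans _ (slope_sum_ge p q)).
have b0 : slope q != 0 by rewrite gt_eqF// slope_gt0.
have pp : dot p p = slope p ^+ 2 - 1 by rewrite slope_sq; ring.
have qq : dot q q = slope q ^+ 2 - 1 by rewrite slope_sq; ring.
rewrite /tilt_dir -/D !dotE (dotC q p) pp qq.
have dE : dot p q = D - 1 - slope p * slope q by rewrite /D; ring.
rewrite dE; move: D dE D0 => D _ D0. by field; rewrite D0 b0.
Qed.

Lemma tilt_defect_le p q :
  dot (tilt_dir p q) (tilt_dir p q) - (slope q ^+ 2)^-1 + (1 - dot q (tilt_dir p q)) ^+ 2 <=
  dot (p - q) (p - q) / (4 * slope q ^+ 2).
Proof.
rewrite tilt_dirE.
have D2 := slope_sum_ge p q; have := slope_defect_le p q; have b0 := slope_gt0 q.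
set D := slope p * slope q + 1 + dot p q in D2 *; set n := slope p * slope q - 1 - dot p q => h.
rewrite ler_pdivrMr; last by rewrite mulr_gt0 ?exprn_gt0//; lra.
have -> : dot (p - q) (p - q) / (4 * slope q ^+ 2) * (slope q ^+ 2 * D) = dot (p - q) (p - q) * (D / 4).
  by field; rewrite gt_eqF.
have := sq_ge0 (p - q); nra.
Qed.

Variables (Omega : set 'rV[R]_N) (H u v : 'rV[R]_N -> R).
Hypotheses (Oo : open Omega) (Hc : forall x, Omega x -> {for x, continuous H}).
Hypotheses (u_super : viscosity_supersolution Omega H u)
  (v_sub : viscosity_subsolution Omega H v).

Lemma superjet_bound_sub x0 p : Omega x0 ->
  superjet_bound v x0 p (curvmx p) (slope p * (N%:R * H x0)).
Proof.
move=> Ox.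
apply: (@superjet_bound_curvmx _ _ v v 1 x0 p (fun t => t.2)
  (fun t => slope t.2 * (N%:R * H t.1.1))).
- by [].
- by move=> x; rewrite mul1r.
- exact: cvg_snd.
- apply: continuousM.
    apply: (@continuous_comp _ _ _ (fun t : 'rV[R]_N * R * 'rV[R]_N => t.2)); first exact: cvg_snd.
    exact: cts_slope.
  apply: continuousM; first exact: cst_continuous.
  apply: (@continuous_comp _ _ _ (fun t : 'rV[R]_N * R * 'rV[R]_N => t.1.1)); last exact: Hc.
  apply: (@continuous_comp _ _ _ (fun t : 'rV[R]_N * R * 'rV[R]_N => t.1) fst); exact: cvg_fst.
- exists (Omega `*` setT, setT) => /=.
    split; last exact: filterT.
    exists (Omega, setT) => //=; split; [exact: open_nbhs_nbhs|exact: filterT].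
  move=> t [[Ot _] _] X _ sj; exact: viscosity_sub_jet v_sub Ot sj.
Qed.

Lemma superjetN (f : 'rV[R]_N -> R) x p X :
  superjet (fun x => - f x) x p X -> subjet f x (- p) (- X).
Proof.
move=> [XT sj]; split; first by rewrite linearN /= XT.
apply: filterS sj => d; rewrite qfN dotNl; lra.
Qed.

Lemma superjet_bound_super y0 p : Omega y0 ->
  superjet_bound (fun y => - u y) y0 p (curvmx p) (- (slope p * (N%:R * H y0))).
Proof.
move=> Oy.
apply: (@superjet_bound_curvmx _ _ (fun y => - u y) (fun y => - u y) 1 y0 p (fun t => t.2)
  (fun t => - (slope t.2 * (N%:R * H t.1.1)))).
- by [].
- by move=> x; rewrite mul1r.
- exact: cvg_snd.
- apply: continuousN; apply: continuousM.
    apply: (@continuous_comp _ _ _ (fun t : 'rV[R]_N * R * 'rV[R]_N => t.2)); first exact: cvg_snd.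
    exact: cts_slope.
  apply: continuousM; first exact: cst_continuous.
  apply: (@continuous_comp _ _ _ (fun t : 'rV[R]_N * R * 'rV[R]_N => t.1.1)); last exact: Hc.
  apply: (@continuous_comp _ _ _ (fun t : 'rV[R]_N * R * 'rV[R]_N => t.1) fst); exact: cvg_fst.
- exists (Omega `*` setT, setT) => /=.
    split; last exact: filterT.
    exists (Omega, setT) => //=; split; [exact: open_nbhs_nbhs|exact: filterT].
  move=> t [[Ot _] _] X _ /superjetN/(viscosity_super_jet u_super Ot).
  by rewrite curvmxN -/(slope _) slopeN mulmxN linearN /= lerNl.
Qed.

(** The last hypothesis keeps [(y, u y)] outside the sphere of radius [rho x] about a fixed
    translate of [(x, v x)], with contact at [(x0, y0)]. For constant radius both slopes agree and
    the values of [H] are simply compared. A varying radius tilts one normal against the other;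
    matched frames reduce the effect to the Hessian [Y] of the radius and a quartic error. *)
Lemma touching x0 y0 (c : 'rV[R]_N) (rho : 'rV[R]_N -> R) g Y (r s : R) (z : 'rV[R]_N := y0 - x0 - c) (Th : R := Num.sqrt (s ^+ 2 - dot z z)) :
  (0 < N)%N -> Omega x0 -> Omega y0 -> 0 < r ->
  lsc_within [set x | dot (x - x0) (x - x0) <= r] (fun x => - v x) ->
  lsc_within [set x | dot (x - y0) (x - y0) <= r] u ->
  jet rho x0 (dot g) (qf Y) -> rho x0 = s -> 0 < s -> dot z z < s ^+ 2 ->
  (\forall w \near (0 : 'rV[R]_(N + N)), v (x0 + lsubmx w) - u (y0 + rsubmx w) <=
     v x0 - u y0 + Th - Num.sqrt (rho (x0 + lsubmx w) ^+ 2 - dot (z + rsubmx w - lsubmx w) (z + rsubmx w - lsubmx w))) ->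
  exists2 p, slope p <= s / Th * (1 + nrm g) &
    \tr (curvmx p *m Y) <= (s / Th) ^+ 2 * nrm g ^+ 4 / (4 * s) +
      (N%:R * (H y0 - H x0) + nrm g * (N%:R * `|H x0|)).
Proof.
move=> N0 Ox Oy r0 lv lu jr rx s0 zs near.
pose L : 'M[R]_(N + N, N) := col_mx 1%:M 0.
pose M : 'M[R]_(N + N, N) := col_mx (- 1%:M) 1%:M.
have LE w : w *m L = lsubmx w by rewrite -{1}[w]hsubmxK mul_row_col mulmx1 mulmx0 addr0.
have ME w : w *m M = rsubmx w - lsubmx w.
  by rewrite -{1}[w]hsubmxK mul_row_col mulmx1 mulmxN mulmx1 addrC.
have F0 : 0 < s ^+ 2 - dot z z by rewrite subr_gt0.
have T0 : 0 < Th by rewrite sqrtr_gt0.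
have TT : Th ^+ 2 = s ^+ 2 - dot z z by rewrite sqr_sqrtr// ltW.
have j1 := jet_mulmx L jr.
have j2 := jet_mulmx M (jet_sq 0 z).
have jF := jetD (jetM j1 j1) (jetZ (-1) j2).
have := jet_comp jF; rewrite !mul0mx !addr0 subr0 rx mulN1r -expr2.
move=> /(_ _ _ _ (jet1_sqrt F0)); rewrite -/Th => jP.
(* [q] is the slope of the sphere at the touching point, with slope factor [b]. The varying radius
   shifts the slope on the side of [v] to [p = q - b *: g]. *)
pose q : 'rV[R]_N := - (Th^-1 *: z).
pose b : R := s / Th.
have bq : slope q = b.
  apply/eqP; rewrite -(@eqrXn2 _ 2)// ?ltW ?slope_gt0 ?divr_gt0// slope_sq; apply/eqP.
  rewrite /q dotNl dotNr opprK dotZl dotZr /b expr_div_n; have -> : s ^+ 2 = Th ^+ 2 + dot z z by rewrite TT; ring.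
  by field; rewrite gt_eqF.
pose p : 'rV[R]_N := q - b *: g.
have b0 : 0 < b by rewrite divr_gt0.
move: jP; set lP := (X in jet _ _ X); set qP := (X in jet _ _ _ X) => -[_ iP oP].
have pq : p - q = - (b *: g) by rewrite /p addrAC subrr add0r.
have zE : z = - (Th *: q) by rewrite /q scalerN opprK scalerA mulfV ?scale1r ?gt_eqF.
have pE : p = q - b *: g by [].
have bE : b = s / Th by [].
have ThE : Th = Num.sqrt (s ^+ 2 - dot z z) by [].
have sE : s = b * Th by rewrite bE divfK// gt_eqF.
rewrite -bE; clearbody p q b z Th.
have lPE w : lP w = - (dot p (lsubmx w) + dot (- q) (rsubmx w)).
  rewrite /lP LE ME zE pE sE; move: (lsubmx w) (rsubmx w) => l1 l2.
  by rewrite !dotE; field; rewrite gt_eqF.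
have iQ : is_qf (fun w => -1 * qP w) by exact: is_qfZ.
have bV := superjet_bound_sub p Ox; have bW := superjet_bound_super (- q) Oy.
rewrite curvmxN slopeN in bW.
have lu' : lsc_within [set x | dot (x - y0) (x - y0) <= r] (fun x => - - u x).
  move=> x hx a; rewrite opprK => /(lu x hx) h.
  by apply: (@filterS _ _ (nbhs_filter x) _ _ _ h) => y {}h /h; rewrite opprK.
have touch : forall k : R, 0 < k -> \forall w \near (0 : 'rV[R]_(N + N)),
     v (x0 + lsubmx w) + - u (y0 + rsubmx w) <= v x0 + - u y0 +
       (dot p (lsubmx w) + dot (- q) (rsubmx w)) + 2^-1 * (-1 * qP w) + k * dot w w.
  move=> k k0; have h := @filterI _ _ (nbhs_filter (0 : 'rV[R]_(N + N))) _ _ (oP k k0) near.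
  apply: (@filterS _ (nbhs (0 : 'rV[R]_(N + N))) (nbhs_filter _) _ _ _ h) => w [] {h}.
  rewrite lPE !mul0mx !addr0 !add0r !subr0 rx LE ME !mulN1r -!expr2 -ThE !(addrA z) ler_norml => /andP[h _] h'.
  apply: le_trans h' _; lra.
have [e [e1 e2 e3]] := sum_superjets_frames N0 iQ r0 lv lu' bV bW touch.
pose t i := dot (e i) (p - q).
(* Coefficient left in the tilt direction by the Hessian of the sphere after the frames have been
   inserted. *)
pose kap : R := dot (tilt_dir p q) (tilt_dir p q) - (b ^+ 2)^-1 + (1 - dot q (tilt_dir p q)) ^+ 2.
have qE i : -1 * qP (row_mx (e i) (e i + t i *: tilt_dir p q)) = (t i * t i) * (kap / Th) - b * qf Y (e i).
  have ge : dot g (e i) = - (t i / b).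
    by rewrite /t pq dotNr dotZr (dotC g); field; rewrite gt_eqF.
  rewrite /qP LE ME row_mxKl row_mxKr (addrC (e i)) addrK ge zE /kap; move: (t i) (tilt_dir p q) (qf Y (e i)) => ti ta y.
  by rewrite sE !dotE; field; rewrite !gt_eqF.
have T0' : 0 <= qf (curvmx p) (p - q) <= b ^+ 2 * nrm g ^+ 2.
  apply/andP; split.
    by apply: le_trans (qf_curvmx_ge _ _); rewrite divr_ge0 ?sq_ge0// addr_ge0 ?sq_ge0.
  by apply: le_trans (qf_curvmx_le _ _) _; rewrite pq !dotE nrm_sq; lra.
have kapE : kap <= nrm g ^+ 2 / 4.
  have := tilt_defect_le p q; rewrite bq -/kap => /le_trans; apply.
  have b0' : b != 0 by rewrite gt_eqF.
  by rewrite pq !dotE -nrm_sq le_eqVlt; apply/orP; left; apply/eqP; field.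
move: e3; rewrite (eq_bigr _ (fun i _ => qE i)) sumrB -mulr_suml -mulr_sumr e1 e2 bq.
rewrite -/(qf (curvmx p) (p - q)) => e3.
have pb : `|slope p - b| <= b * nrm g.
  by rewrite -bq; apply: le_trans (slope_lip _ _) _; rewrite pq nrmN nrmZ bq ger0_norm// ltW.
exists p; first by have := pb; rewrite ler_norml => /andP[_ h]; lra.
rewrite -(ler_pM2l b0).
have main : qf (curvmx p) (p - q) * (kap / Th) <= b * (b ^+ 2 * nrm g ^+ 4 / (4 * s)).
  have -> : b * (b ^+ 2 * nrm g ^+ 4 / (4 * s)) = (b ^+ 2 * nrm g ^+ 2) * (nrm g ^+ 2 / 4 / Th).
    by rewrite sE; field; rewrite !gt_eqF.
  case/andP: T0' => h1 h2; have Ti : 0 <= Th^-1 by rewrite invr_ge0 ltW.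
  apply: le_trans (_ : qf (curvmx p) (p - q) * (nrm g ^+ 2 / 4 / Th) <= _).
    by rewrite ler_wpM2l// ler_wpM2r.
  by rewrite ler_wpM2r// mulr_ge0// mulr_ge0// ?sqr_ge0.
have hb : (b - slope p) * (N%:R * H x0) <= b * (nrm g * (N%:R * `|H x0|)).
  apply: le_trans (ler_norm _) _; rewrite normrM distrC normrM (ger0_norm (ler0n _ N)).
  by rewrite [leRHS]mulrA; apply: ler_wpM2r => //; apply: mulr_ge0.
lra.
Qed.

End Touching.

(** * Continuity and semicontinuity tools *)

Section MoreContinuity.
Variable R : realType.

Lemma lsc_within_comp (S T : topologicalType) (K : set T) (K' : set S) (f : T -> R) (phi : S -> T) :
  continuous phi -> (forall x, K' x -> K (phi x)) -> lsc_within K f ->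
  lsc_within K' (fun x => f (phi x)).
Proof.
move=> cphi sub lf x Kx a /(lf _ (sub x Kx)) h.
by apply: (@filterS _ _ (nbhs_filter x) _ _ _ (cphi x _ h)) => y /= hy /sub; exact: hy.
Qed.

Lemma lsc_within_mono (T : topologicalType) (K : set T) (f : T -> R) (phi : R -> R) :
  continuous phi -> {homo phi : s t / s <= t} -> lsc_within K f ->
  lsc_within K (fun x => phi (f x)).
Proof.
move=> cphi mphi lf x Kx a /(cvgr_gt _ (cphi (f x))) /nbhs_ballP[e /= e0 he].
have h1 : a < phi (f x - e / 2).
  by apply: he; rewrite /ball /= opprB addrCA subrr addr0 gtr0_norm; lra.
have h2 : f x - e / 2 < f x by lra.
apply: (@filterS _ _ (nbhs_filter x) _ _ _ (lf x Kx _ h2)) => y hy Ky.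
by apply: lt_le_trans h1 _; apply: mphi; apply: ltW; exact: hy.
Qed.

Lemma compact_lsc_gt0 (T : topologicalType) (K : set T) (f : T -> R) :
  compact K -> lsc_within K f -> (forall x, K x -> 0 < f x) ->
  exists2 mu : R, 0 < mu & forall x, K x -> mu <= f x.
Proof.
move=> Kc lf f0; have [[x Kx]|K0] := pselect (exists x, K x).
  have [y Ky hy] := compact_lsc_min Kc (ex_intro _ x Kx) lf.
  by exists (f y) => //; exact: f0.
by exists 1 => // x Kx; case: K0; exists x.
Qed.

Lemma continuous_maxr0 : continuous (fun t : R => Num.max 0 t).
Proof.
by move=> t; exact: (continuous_max (@cst_continuous _ _ 0 t) (@cvg_id _ (nbhs t))).
Qed.

Lemma continuous_mulmx (N M : nat) (A : 'M[R]_(M, N)) :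
  continuous (fun w : 'rV[R]_M => w *m A).
Proof.
have [K K0 hK] := qf_bound (A *m A^T).
move=> w0 P /= nP; have : nbhs (w0 *m A) P by [].
case/near_sqP => rho rho0 sP; apply/near_sqP; exists (rho / (K + 1)).
  by rewrite divr_gt0// ltr_wpDl.
move=> w; rewrite ltr_pdivlMr ?ltr_wpDl// => hw; apply: sP; rewrite -mulmxBl.
have := hK (w - w0) (w - w0); rewrite -expr2 nrm_sq => /(le_trans (ler_norm _)).
rewrite mulmxA [in leLHS]dot_mulmx trmxK => /le_lt_trans; apply; apply: le_lt_trans hw.
by rewrite mulrC ler_wpM2l ?sq_ge0// lerDl.
Qed.

Lemma nrm_continuous (N : nat) : continuous (@nrm R N).
Proof.
move=> x; apply: (@continuous_comp _ _ _ (fun x => dot x x) Num.sqrt); first exact: cts_sq.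
exact: sqrt_continuous.
Qed.

Lemma lsc_on_within (N : nat) (Omega D : set 'rV[R]_N) u : open Omega -> D `<=` Omega ->
  lsc_on Omega u -> lsc_within D u.
Proof.
move=> Oo DO lu x Dx a ax.
have [V nV hV] := lu x a ax.
have nV' : nbhs x V.
  by rewrite (@nbhs_subspace_interior _ Omega x)//; apply: open_nbhs_nbhs; split => //; exact: DO.
by apply: (@filterS _ _ (nbhs_filter x) _ _ _ nV') => y /hV; rewrite lte_fin.
Qed.

Lemma usc_on_within (N : nat) (Omega D : set 'rV[R]_N) v : open Omega -> D `<=` Omega ->
  usc_on Omega v -> lsc_within D (fun x => - v x).
Proof.
move=> Oo DO uv x Dx a ax.
have [|V nV hV] := uv x (- a); first by rewrite lte_fin; lra.
have nV' : nbhs x V.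
  by rewrite (@nbhs_subspace_interior _ Omega x)//; apply: open_nbhs_nbhs; split => //; exact: DO.
by apply: (@filterS _ _ (nbhs_filter x) _ _ _ nV') => y /hV; rewrite lte_fin ltrNr.
Qed.

End MoreContinuity.

(** * Existence of a touching configuration near the contact point *)

Section TouchPoint.
Variables (R : realType) (N : nat).
Implicit Types x y z : 'rV[R]_N.
Local Notation T3 := ('rV[R]_N * 'rV[R]_N * 'rV[R]_N)%type.

Lemma nrm_lerP x (k : R) : 0 <= k -> reflect (nrm x <= k) (dot x x <= k ^+ 2).
Proof. by move=> k0; apply: (iffP idP); rewrite ler_nrm_sq. Qed.

Lemma sqball_convex y1 (rd t : R) x y : 0 <= rd -> 0 <= t <= 1 ->
  dot (x - y1) (x - y1) <= rd ^+ 2 -> dot (y - y1) (y - y1) <= rd ^+ 2 ->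
  dot (x + t *: (y - x) - y1) (x + t *: (y - x) - y1) <= rd ^+ 2.
Proof.
move=> r0 /andP[t0 t1] /nrm_lerP-/(_ r0) hx /nrm_lerP-/(_ r0) hy; apply/nrm_lerP => //.
have -> : x + t *: (y - x) - y1 = (1 - t) *: (x - y1) + t *: (y - y1).
  by apply/rowP => i; rewrite !mxE; ring.
apply: le_trans (ler_nrmD _ _) _; rewrite !nrmZ !ger0_norm ?subr_ge0//.
have t1' : 0 <= 1 - t by rewrite subr_ge0.
have := ler_wpM2l t1' hx; have := ler_wpM2l t0 hy; lra.
Qed.

Lemma lsc_within_sub (T : topologicalType) (K K' : set T) (f : T -> R) :
  K' `<=` K -> lsc_within K f -> lsc_within K' f.
Proof.
move=> sub lf x Kx a /(lf x (sub x Kx)) h.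
by apply: (@filterS _ _ (nbhs_filter x) _ _ _ h) => y hy /sub.
Qed.

Lemma nrm_lsub (w : 'rV[R]_(N + N)) : nrm (lsubmx w) <= nrm w.
Proof.
have E := sq_row_mx (lsubmx w) (rsubmx w); rewrite hsubmxK in E.
by rewrite ler_nrm_sq ?nrm_ge0// nrm_sq E lerDl sq_ge0.
Qed.

Lemma nrm_rsub (w : 'rV[R]_(N + N)) : nrm (rsubmx w) <= nrm w.
Proof.
have E := sq_row_mx (lsubmx w) (rsubmx w); rewrite hsubmxK in E.
by rewrite ler_nrm_sq ?nrm_ge0// nrm_sq E lerDr sq_ge0.
Qed.

Lemma continuous_lsub : continuous (fun w : 'rV[R]_(N + N) => lsubmx w).
Proof.
have -> : (fun w : 'rV[R]_(N + N) => lsubmx w) = (fun w => w *m col_mx 1%:M 0).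
  by apply/funext => w; rewrite -{2}[w]hsubmxK mul_row_col mulmx1 mulmx0 addr0.
exact: continuous_mulmx.
Qed.

Lemma continuous_rsub : continuous (fun w : 'rV[R]_(N + N) => rsubmx w).
Proof.
have -> : (fun w : 'rV[R]_(N + N) => rsubmx w) = (fun w => w *m col_mx 0 1%:M).
  by apply/funext => w; rewrite -{2}[w]hsubmxK mul_row_col mulmx1 mulmx0 add0r.
exact: continuous_mulmx.
Qed.

(** Minimizes the square root of a distance in R^(N+1) minus [e * h]. Contact with [h >= 0] occurs
    only at [y1], which localizes the minimizer there. At the minimum the distance equals
    [(m + e * h x0) ^+ 2], and nearby it is at least the corresponding expression, which is the
    hypothesis of [touching]. *)
Lemma hopf_touch_point (u v h : 'rV[R]_N -> R) y1 (rd L0 eta theta : R)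
    (D := [set x | dot (x - y1) (x - y1) <= rd ^+ 2]) :
  0 < rd -> 0 <= L0 -> 0 < eta -> 0 < theta ->
  lsc_within D u -> lsc_within D (fun x => - v x) -> continuous h -> h y1 = 0 -> u y1 = v y1 ->
  (forall x y, D x -> D y -> v x - u y <= L0 * nrm (x - y)) ->
  (forall x, D x -> 0 <= h x -> u x = v x -> x = y1) ->
  exists2 e0 : R, 0 < e0 & forall e : R, 0 < e -> e <= e0 ->
  exists x0 y0 c : 'rV[R]_N, exists m s Th : R,
    [/\ [/\ dot (x0 - y1) (x0 - y1) < eta, nrm (y0 - x0) <= (2 + L0) * s,
            D y0 & (2 + L0) * s <= rd / 4],
        [/\ 0 < s, (m + e * h x0) ^+ 2 = s, 0 < m + e * h x0 & m + e * h x0 <= e * theta],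
        [/\ Th = Num.sqrt (s ^+ 2 - dot (y0 - x0 - c) (y0 - x0 - c)), 0 < Th &
            nrm (y0 - x0 - c) <= (1 + L0) * Th] &
        \forall w \near (0 : 'rV[R]_(N + N)),
          v (x0 + lsubmx w) - u (y0 + rsubmx w) <= v x0 - u y0 + Th -
            Num.sqrt (((m + e * h (x0 + lsubmx w)) ^+ 2) ^+ 2 -
              dot (y0 - x0 - c + rsubmx w - lsubmx w) (y0 - x0 - c + rsubmx w - lsubmx w))].
Proof.
move=> rd0 L00 eta0 th0 lu lv ch hy1 uv1 pair uniq.
pose Lam : R := L0 + 1.
(* Vertical gap between [(y, u y)] and the graph of [v] lowered by [d] and then smoothed by downward
   cones of slope [Lam]; the middle component of the triple is the base point on the cone. The cones
   keep the normal at the touching point away from the horizontal. *)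
pose tt (d : R) (t : T3) : R :=
  u t.2 + (- v t.1.1) + (d + Lam * nrm (t.1.2 - t.1.1)).
pose G (d : R) (t : T3) : R :=
  dot (t.2 - t.1.2) (t.2 - t.1.2) + (Num.max 0 (tt d t)) ^+ 2.
pose r4 (t : R) : R := Num.sqrt (Num.sqrt t).
pose K3 : set (T3) := D `*` D `*` D.
have cD : compact D by exact: compact_sqball.
have c2 : continuous (fun t : T3 => t.2) by move=> t; exact: cvg_snd.
have c1 : continuous (fun t : T3 => t.1) by move=> t; exact: cvg_fst.
have c11 : continuous (fun t : T3 => t.1.1).
  by move=> t; apply: (@continuous_comp _ _ _ (fun t : T3 => t.1) fst); [exact: c1|exact: cvg_fst].
have c12 : continuous (fun t : T3 => t.1.2).
  by move=> t; apply: (@continuous_comp _ _ _ (fun t : T3 => t.1) snd); [exact: c1|exact: cvg_snd].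
have G0 d t : 0 <= G d t by rewrite addr_ge0 ?sq_ge0 ?sqr_ge0.
have r4m : {homo r4 : s t / s <= t} by move=> s t st; rewrite /r4 !ler_wsqrtr.
have r4c : continuous r4.
  move=> t; apply: (@continuous_comp _ _ _ Num.sqrt Num.sqrt); exact: sqrt_continuous.
have lG d : lsc_within K3 (fun t => r4 (G d t)).
  apply: lsc_within_mono => //; apply: lsc_withinD.
    apply: lsc_within_cts => t _.
    apply: (@continuous_comp _ _ _ (fun t : T3 => t.2 - t.1.2) (fun x : 'rV[R]_N => dot x x)); last exact: cts_sq.
    by apply: continuousB; [exact: c2|exact: c12].
  apply: (@lsc_within_mono _ _ _ (tt d) (fun t : R => Num.max 0 t ^+ 2)).
  - move=> t; apply: (@continuous_comp _ _ _ (fun t : R => Num.max 0 t) (fun s : R => s ^+ 2)).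
      exact: continuous_maxr0.
    exact: exprn_continuous.
  - move=> s t st; have mm : Num.max 0 s <= Num.max 0 t by rewrite ge_max !le_max lexx st orbT.
    by rewrite ler_pXn2r// nnegrE le_max lexx.
  apply: lsc_withinD; first apply: lsc_withinD.
  - by apply: (@lsc_within_comp _ _ _ D _ u (fun t : T3 => t.2)) => // t [_].
  - by apply: (@lsc_within_comp _ _ _ D _ (fun x => - v x) (fun t : T3 => t.1.1)) => // t [[]].
  - apply: lsc_within_cts => t _; apply: continuousD; first exact: cst_continuous.
    apply: continuousM; first exact: cst_continuous.
    apply: (@continuous_comp _ _ _ (fun t : T3 => t.1.2 - t.1.1) (@nrm R N)); last exact: nrm_continuous.
    by apply: continuousB; [exact: c12|exact: c11].
have ch1 : continuous (fun t : T3 => h t.1.1).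
  by move=> t; apply: (@continuous_comp _ _ _ (fun t : T3 => t.1.1) h); [exact: c11|exact: ch].
have Dy1 : D y1 by rewrite /D /= subrr dot0l sqr_ge0.
have [eta1 [e10 e1e e1r e1h]] : exists eta1 : R, [/\ 0 < eta1, eta1 <= eta, eta1 <= (rd / 2) ^+ 2 &
    forall x, dot (x - y1) (x - y1) < eta1 -> h x < theta / 2].
  have th2 : h y1 < theta / 2 by rewrite hy1 divr_gt0.
  have [r r0 hr] := (near_sqP y1 _).1 (cvgr_lt _ (ch y1) _ th2).
  exists (Num.min r (Num.min eta ((rd / 2) ^+ 2))); split.
  - by rewrite !lt_min r0 eta0 exprn_gt0// divr_gt0.
  - by rewrite !ge_min lexx orbT.
  - by rewrite !ge_min lexx !orbT.
  - by move=> x; rewrite lt_min => /andP[/hr].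
(* If both terms vanished, [x] would be a contact point with [h x >= 0], hence [y1]; compactness
   makes this exclusion quantitative away from [y1]. *)
have [mu mu0 hmu] : exists2 mu : R, 0 < mu & forall t, K3 t -> eta1 <= dot (t.1.1 - y1) (t.1.1 - y1) ->
    mu <= r4 (G 0 t) + Num.max 0 (- h t.1.1).
  have csq : continuous (fun t : T3 => dot (t.1.1 - y1) (t.1.1 - y1)).
    move=> t; apply: (@continuous_comp _ _ _ (fun t : T3 => t.1.1 - y1) (fun x : 'rV[R]_N => dot x x)); last exact: cts_sq.
    by apply: continuousB; [exact: c11|exact: cst_continuous].
  have [|||mu mu0 hmu] := @compact_lsc_gt0 R _ (K3 `&` [set t | eta1 <= dot (t.1.1 - y1) (t.1.1 - y1)])
    (fun t => r4 (G 0 t) + Num.max 0 (- h t.1.1)).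
  - apply: compact_closedI; first by apply: compact_setX => //; exact: compact_setX.
    by apply: (@preimage_closed _ _ _ [set s | eta1 <= s]); [move=> t _; exact: csq|exact: closed_ge].
  - apply: lsc_withinD; first exact: (lsc_within_sub (@subIsetl _ _ _) (lG 0)).
    apply: lsc_within_cts => t _.
    apply: (@continuous_comp _ _ _ (fun t : T3 => - h t.1.1) (fun s : R => Num.max 0 s)); last exact: continuous_maxr0.
    by apply: continuousN; exact: ch1.
  - move=> [[x x'] y] [[[Dx Dx'] Dy] /= ex].
    have [Gp|] := ltP 0 (G 0 (x, x', y)).
      by rewrite ltr_pwDl// ?le_max ?lexx// /r4 !sqrtr_gt0.
    rewrite le_eqVlt ltNge G0 orbF paddr_eq0 ?sq_ge0 ?sqr_ge0// => /andP[/eqP/sq_eq0/= yx'].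
    rewrite sqrf_eq0 => /eqP mx0; apply: ltr_wpDl; first by rewrite /r4 sqrtr_ge0.
    have tt0 : tt 0 (x, x', y) <= 0 by apply: (@le_trans _ _ (Num.max 0 (tt 0 (x, x', y)))); [rewrite le_max lexx orbT|rewrite mx0].
    rewrite lt_max oppr_gt0 ltxx /= ltNge; apply/negP => hx.
    have {}yx' : x' = y by apply/esym/eqP; rewrite -subr_eq0 yx'.
    have := pair x y Dx Dy; move: tt0; rewrite /tt /Lam /= yx' (nrmB y x) => h1 h2.
    have n0 := nrm_ge0 (x - y).
    have /nrm_eq0/eqP : nrm (x - y) = 0 by lra.
    rewrite subr_eq0 => /eqP xy; subst y.
    have xy1 : x = y1.
      apply: uniq => //; apply/eqP; rewrite eq_le; apply/andP; split; last first.
        by have := pair x x Dx Dx; rewrite subrr nrm0; lra.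
      by move: h1; rewrite xy subrr nrm0 -xy; lra.
    by move: ex; rewrite xy1 subrr dot0l leNgt e10.
  - by exists mu => // t Kt et; exact: hmu.
have [hm hm0 hhm] : exists2 hm : R, 0 < hm & forall x, D x -> h x <= hm.
  have [x Dx hx] : exists2 x, D x & forall y, D y -> - h x <= - h y.
    apply: compact_lsc_min => //; first by exists y1.
    by apply: lsc_within_cts => x _; apply: continuousN; exact: ch.
  exists (`|h x| + 1); first by rewrite ltr_wpDl.
  by move=> y /hx; have := ler_norm (h x); lra.
pose e0 := Num.min (Num.min 1 (theta / 2)) (Num.min (mu / (4 * (hm + 1))) (rd / (4 * (3 + L0) * (theta ^+ 2 + 1)))).
have th2 : 0 < theta ^+ 2 + 1 by rewrite ltr_wpDl// sqr_ge0.
have L3 : 0 < 3 + L0 by lra.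
have hm1 : 0 < hm + 1 by lra.
exists e0.
  by rewrite !lt_min ltr01 !divr_gt0// !mulr_gt0.
move=> e ep; rewrite /e0 !le_min => /andP[/andP[e_1 e_th] /andP[]].
rewrite !ler_pdivlMr ?mulr_gt0// => e_mu e_rd.
pose J t := r4 (G (e ^+ 4) t) + - (e * h t.1.1).
have [[[x0 x1] y0] /= [[Dx0 Dx1] Dy0] Jmin] : exists2 t, K3 t & forall t', K3 t' -> J t <= J t'.
  apply: compact_lsc_min; first by apply: compact_setX => //; exact: compact_setX.
  - by exists ((y1, y1), y1).
  - apply: lsc_withinD => //; apply: lsc_within_cts => t _; apply: continuousN.
    by apply: continuousM; [exact: cst_continuous|exact: ch1].
pose m := J (x0, x1, y0).
have e4 : 0 < e ^+ 4 by rewrite exprn_gt0.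
have r4X (t : R) : 0 <= t -> r4 (t ^+ 4) = t.
  move=> t0; have -> : t ^+ 4 = (t ^+ 2) ^+ 2 by rewrite -exprM.
  by rewrite /r4 !sqrtr_sqr (ger0_norm (sqr_ge0 t)) sqrtr_sqr ger0_norm.
(* At [(y1, y1, y1)] the gap is exactly [e ^+ 4], and the square root of the distance is [e ^+ 2],
   of lower order than the effect of [e * h]. *)
have me : m <= e ^+ 2.
  apply: le_trans (Jmin (y1, y1, y1) _) _ => //; rewrite /J /G /tt /= !subrr dot0l nrm0 uv1 hy1.
  rewrite subrr mulr0 mulr0 oppr0 !addr0 !add0r (max_r (ltW e4)).
  have -> : (e ^+ 4) ^+ 2 = (e ^+ 2) ^+ 4 by rewrite -!exprM.
  by rewrite r4X// sqr_ge0.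
have near_y1 : dot (x0 - y1) (x0 - y1) < eta1.
  rewrite ltNge; apply/negP => far.
  have := hmu (x0, x1, y0) (conj (conj Dx0 Dx1) Dy0) far; rewrite /=.
  have Gmono : r4 (G 0 (x0, x1, y0)) <= r4 (G (e ^+ 4) (x0, x1, y0)).
    apply: r4m; rewrite /G lerD2l.
    have mm : Num.max 0 (tt 0 (x0, x1, y0)) <= Num.max 0 (tt (e ^+ 4) (x0, x1, y0)).
      by rewrite ge_max !le_max lexx /=; apply/orP; right; rewrite /tt /=; lra.
    by rewrite ler_pXn2r// nnegrE le_max lexx.
  move: me; rewrite /m /J /=; have := hhm x0 Dx0.
  have g0 : 0 <= r4 (G 0 (x0, x1, y0)) by rewrite sqrtr_ge0.
  case: (leP 0 (- h x0)) => hx; nra.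

pose s := Num.sqrt (G (e ^+ 4) (x0, x1, y0)).
pose c := x1 - x0.
pose z := y0 - x0 - c.
have zE : z = y0 - x1 by apply/rowP => i; rewrite !mxE; ring.
pose t' := tt (e ^+ 4) (x0, x1, y0).
pose tp := Num.max 0 t'.
have tp0 : 0 <= tp by rewrite le_max lexx.
have Gs : G (e ^+ 4) (x0, x1, y0) = nrm z ^+ 2 + tp ^+ 2 by rewrite nrm_sq zE.
have s0 : 0 <= s by exact: sqrtr_ge0.
have ss : s ^+ 2 = nrm z ^+ 2 + tp ^+ 2 by rewrite sqr_sqrtr// Gs.
have rs : Num.sqrt s = m + e * h x0 by rewrite /m /J /= subrK.
have Gmin t1 : K3 t1 -> t1.1.1 = x0 -> G (e ^+ 4) (x0, x1, y0) <= G (e ^+ 4) t1.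
  move=> Kt tx; have := Jmin t1 Kt; rewrite /J /= tx lerD2r leNgt => /negP h1.
  by rewrite leNgt; apply/negP => h2; apply: h1; rewrite /r4 !ltr_sqrt ?sqrtr_gt0// (le_lt_trans _ h2).
have L1 : 0 <= Lam by rewrite /Lam; lra.
have z0 := nrm_ge0 z.
(* First variation in the base point: moving [x1] towards [y0] shortens the horizontal part at rate
   [nrm z] and lengthens the vertical one at rate at most [Lam]. *)
have zt : nrm z <= Lam * tp.
  rewrite leNgt; apply/negP => zt.
  have zp : 0 < nrm z by apply: le_lt_trans zt; exact: mulr_ge0.
  pose dl := nrm z * (nrm z - Lam * tp).
  have dl0 : 0 < dl by rewrite mulr_gt0// subr_gt0.
  have Lz0 : 0 < (1 + Lam ^+ 2) * nrm z ^+ 2.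
    by apply: mulr_gt0; rewrite ?exprn_gt0// ltr_pwDl// sqr_ge0.
  pose a := dl / ((1 + Lam ^+ 2) * nrm z ^+ 2).
  have a0 : 0 < a by rewrite divr_gt0.
  have aE : a * ((1 + Lam ^+ 2) * nrm z ^+ 2) = dl by rewrite divfK// gt_eqF.
  have a1 : a <= 1.
    rewrite ler_pdivrMr// mul1r /dl; have := mulr_ge0 (ltW zp) (mulr_ge0 L1 tp0).
    have := mulr_ge0 (sqr_ge0 Lam) (sqr_ge0 (nrm z)); lra.
  have Dw : D (x1 + a *: (y0 - x1)) by apply: sqball_convex => //; [exact: ltW|rewrite (ltW a0)].
  have := Gmin (x0, x1 + a *: (y0 - x1), y0) (conj (conj Dx0 Dw) Dy0) erefl.
  rewrite Gs {1}/G /=.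
  have -> : y0 - (x1 + a *: (y0 - x1)) = (1 - a) *: z.
    by rewrite zE; apply/rowP => i; rewrite !mxE; ring.
  rewrite dotZl dotZr -nrm_sq leNgt => /negP; apply.
  set mx := Num.max 0 _.
  have mx0 : 0 <= mx by rewrite le_max lexx.
  have mxle : mx <= tp + Lam * (a * nrm z).
    rewrite ge_max; apply/andP; split; first exact: addr_ge0 tp0 (mulr_ge0 L1 (mulr_ge0 (ltW a0) z0)).
    apply: (@le_trans _ _ (t' + Lam * (a * nrm z))); last by rewrite lerD2r le_max lexx orbT.
    rewrite /t' /tt /= -!addrA !lerD2l -mulrDr; apply: ler_wpM2l => //.
    have -> : x1 + (a *: (y0 - x1) - x0) = (x1 - x0) + a *: z.
      by rewrite zE; apply/rowP => i; rewrite !mxE; ring.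
    by apply: le_trans (ler_nrmD _ _) _; rewrite nrmZ gtr0_norm.
  have : mx ^+ 2 <= (tp + Lam * (a * nrm z)) ^+ 2.
    by rewrite ler_pXn2r// nnegrE (le_trans mx0).
  have -> : (tp + Lam * (a * nrm z)) ^+ 2 = tp ^+ 2 + 2 * (a * (Lam * tp * nrm z)) + a * (a * (Lam ^+ 2 * nrm z ^+ 2)) by ring.
  have -> : (1 - a) * ((1 - a) * nrm z ^+ 2) = nrm z ^+ 2 - 2 * (a * nrm z ^+ 2) + a * (a * nrm z ^+ 2) by ring.
  have : a * dl < a * (2 * dl) by rewrite ltr_pM2l//; lra.
  have -> : a * (2 * dl) = 2 * (a * nrm z ^+ 2) - 2 * (a * (Lam * tp * nrm z)) by rewrite /dl; ring.
  have -> : a * dl = a * (a * nrm z ^+ 2) + a * (a * (Lam ^+ 2 * nrm z ^+ 2)) by rewrite -{1}aE; ring.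
  lra.
(* The two-point estimate against the cone of slope [Lam = L0 + 1]: the surplus 1 bounds the shift
   [c], and the lowering [e ^+ 4] makes the gap strictly positive. *)
have tge : e ^+ 4 + nrm c <= t' + L0 * nrm z.
  have := pair x0 y0 Dx0 Dy0; rewrite /t' /tt /Lam /= -/c.
  have : nrm (x0 - y0) <= nrm c + nrm z.
    rewrite nrmB; have -> : y0 - x0 = c + z by rewrite /z [c + _]addrC subrK.
    exact: ler_nrmD.
  move=> h1; have := ler_wpM2l L00 h1; have := nrm_ge0 c; nra.
have t0 : 0 < t'.
  rewrite ltNge; apply/negP => tn; move: zt; rewrite /tp max_l// mulr0 => zn.
  have := nrm_ge0 c; have := nrm_ge0 z; nra.
have tpE : tp = t' by rewrite /tp max_r// ltW.
rewrite tpE in ss zt Gs.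
have ThE : Num.sqrt (s ^+ 2 - dot z z) = t'.
  by rewrite ss nrm_sq addrC addKr sqrtr_sqr gtr0_norm.
have sp : 0 < s.
  by rewrite lt_def s0 andbT; apply/eqP => s00; move: ss; rewrite s00; nra.
have zs : nrm z <= s by rewrite -(@ler_pXn2r _ 2) ?nnegrE// ss lerDl sqr_ge0.
have ts : t' <= s by rewrite -(@ler_pXn2r _ 2) ?nnegrE ?(ltW t0)// ss lerDr sqr_ge0.
have cs : nrm c <= (1 + L0) * s by have := ler_wpM2l L00 zs; lra.
have yx : nrm (y0 - x0) <= (2 + L0) * s.
  have -> : y0 - x0 = c + z by rewrite /z [c + _]addrC subrK.
  by apply: le_trans (ler_nrmD _ _) _; lra.
have rs0 : 0 < Num.sqrt s by rewrite sqrtr_gt0.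
have hx0 : h x0 < theta / 2 by exact: e1h.
have sq_le : Num.sqrt s <= e * theta by rewrite rs; nra.
have s_rd : (3 + L0) * s <= rd / 4.
  have : s <= e * theta ^+ 2.
    rewrite -(sqr_sqrtr s0); apply: le_trans (_ : (e * theta) ^+ 2 <= _).
      by rewrite ler_pXn2r ?nnegrE ?(ltW rs0)// mulr_ge0// ltW.
    rewrite exprMn; apply: ler_wpM2r; [exact: sqr_ge0|nra].
  move=> h1; have := ler_wpM2l (ltW L3) h1; have := mulr_ge0 (ltW ep) (ltW L3); nra.
have x0y1 : nrm (x0 - y1) <= rd / 2 by apply/nrm_lerP; lra.
exists x0, y0, c, m, s, t'; rewrite -/z; split; last first.
- have chl : continuous (fun w : 'rV[R]_(N + N) => m + e * h (x0 + lsubmx w)).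
    move=> w; apply: (@continuousD _ _ _ (fun _ : 'rV[R]_(N + N) => m) (fun w => e * h (x0 + lsubmx w))).
      exact: cst_continuous.
    apply: (@continuousM _ _ (fun _ : 'rV[R]_(N + N) => e) (fun w => h (x0 + lsubmx w))).
      exact: cst_continuous.
    apply: (@continuous_comp _ _ _ (fun w : 'rV[R]_(N + N) => x0 + lsubmx w) h); last exact: ch.
    by apply: continuousD; [exact: cst_continuous|exact: continuous_lsub].
  have cF : continuous (fun w : 'rV[R]_(N + N) => ((m + e * h (x0 + lsubmx w)) ^+ 2) ^+ 2 -
      dot (z + rsubmx w - lsubmx w) (z + rsubmx w - lsubmx w)).
    move=> w; apply: (@continuousB _ _ _ (fun w : 'rV[R]_(N + N) => ((m + e * h (x0 + lsubmx w)) ^+ 2) ^+ 2)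
      (fun w => dot (z + rsubmx w - lsubmx w) (z + rsubmx w - lsubmx w))).
      apply: (@continuous_comp _ _ _ (fun w : 'rV[R]_(N + N) => (m + e * h (x0 + lsubmx w)) ^+ 2) (fun t : R => t ^+ 2));
        last exact: exprn_continuous.
      apply: (@continuous_comp _ _ _ (fun w : 'rV[R]_(N + N) => m + e * h (x0 + lsubmx w)) (fun t : R => t ^+ 2));
        [exact: chl|exact: exprn_continuous].
    apply: (@continuous_comp _ _ _ (fun w : 'rV[R]_(N + N) => z + rsubmx w - lsubmx w) (fun x : 'rV[R]_N => dot x x));
      last exact: cts_sq.
    apply: (@continuousB _ _ _ (fun w : 'rV[R]_(N + N) => z + rsubmx w) (fun w => lsubmx w)); last exact: continuous_lsub.
    by apply: (@continuousD _ _ _ (fun _ : 'rV[R]_(N + N) => z) (fun w => rsubmx w)); [exact: cst_continuous|exact: continuous_rsub].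
  have lr0 : (lsubmx (0 : 'rV[R]_(N + N)) = 0) * (rsubmx (0 : 'rV[R]_(N + N)) = 0).
    by split; apply/rowP => i; rewrite !mxE.
  have n1 : \forall w \near (0 : 'rV[R]_(N + N)), 0 < m + e * h (x0 + lsubmx w).
    by apply: (cvgr_gt _ (@chl 0)); rewrite lr0 addr0 -rs.
  have n2 : \forall w \near (0 : 'rV[R]_(N + N)), 0 < ((m + e * h (x0 + lsubmx w)) ^+ 2) ^+ 2 -
      dot (z + rsubmx w - lsubmx w) (z + rsubmx w - lsubmx w).
    apply: (cvgr_gt _ (@cF 0)); rewrite !lr0 !addr0 subr0 -rs sqr_sqrtr// -nrm_sq ss; nra.
  have n3 := @near_nrm_small R (N + N) (rd / 8) (divr_gt0 rd0 (ltr0n _ 8)).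
  apply: filterS3 n1 n2 n3 => w w1 w2 w3.
  have [w4 w5] := (le_trans (nrm_lsub w) w3, le_trans (nrm_rsub w) w3).
  have inD a : nrm (a - y1) <= rd -> D a by move=> h1; apply/nrm_lerP; first exact: ltW.
  have Lc : 0 <= L0 * s by exact: mulr_ge0.
  have K1 : K3 (x0 + lsubmx w, x0 + lsubmx w + c, y0 + rsubmx w).
    split; first split; apply: inD => /=.
    + by rewrite addrAC; apply: le_trans (ler_nrmD _ _) _; lra.
    + have -> : x0 + lsubmx w + c - y1 = (x0 - y1) + (lsubmx w + c).
        by apply/rowP => i; rewrite !mxE; ring.
      by have := ler_nrmD (x0 - y1) (lsubmx w + c); have := ler_nrmD (lsubmx w) c; lra.
    + have -> : y0 + rsubmx w - y1 = (x0 - y1) + (rsubmx w + (y0 - x0)).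
        by apply/rowP => i; rewrite !mxE; ring.
      by have := ler_nrmD (x0 - y1) (rsubmx w + (y0 - x0)); have := ler_nrmD (rsubmx w) (y0 - x0); lra.
  have := Jmin _ K1; rewrite -/m /J /= lerBrDr.
  move: w1 w2; set a := m + e * h _; set F := a ^+ 2 ^+ 2 - _ => a0 F0 aG.
  have {}aG : a ^+ 2 ^+ 2 <= G (e ^+ 4) (x0 + lsubmx w, x0 + lsubmx w + c, y0 + rsubmx w).
    have : a ^+ 2 ^+ 2 <= r4 (G (e ^+ 4) (x0 + lsubmx w, x0 + lsubmx w + c, y0 + rsubmx w)) ^+ 2 ^+ 2.
      by rewrite ler_pXn2r ?nnegrE ?sqr_ge0// ler_pXn2r ?nnegrE ?sqrtr_ge0// ltW.
    by rewrite /r4 !sqr_sqrtr// sqrtr_ge0.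
  move: aG; rewrite /G /=.
  have -> : y0 + rsubmx w - (x0 + lsubmx w + c) = z + rsubmx w - lsubmx w.
    by apply/rowP => i; rewrite !mxE; ring.
  have ttE : tt (e ^+ 4) (x0 + lsubmx w, x0 + lsubmx w + c, y0 + rsubmx w) =
      u (y0 + rsubmx w) - v (x0 + lsubmx w) + (e ^+ 4 + Lam * nrm c).
    by rewrite /tt /= [_ + c]addrC addrK.
  rewrite ttE; set t2 := u _ - v _ + _ => h1.
  have {}h1 : F <= Num.max 0 t2 ^+ 2 by rewrite /F lerBlDl.
  have h2 : Num.sqrt F <= Num.max 0 t2.
    by rewrite -[leRHS]ger0_norm ?le_max ?lexx// -sqrtr_sqr ler_wsqrtr.
  have : 0 < Num.max 0 t2 by apply: lt_le_trans h2; rewrite sqrtr_gt0.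
  rewrite lt_max ltxx /= => t20; move: h2; rewrite max_r ?(ltW t20)// /t2.
  by rewrite /t' /tt /= -/c; lra.
- by split; [rewrite ThE|exact: t0|rewrite addrC].
- by split => //; [rewrite -rs sqr_sqrtr|rewrite -rs|rewrite -rs].
- by split => //; [exact: lt_le_trans e1e|lra].
Qed.

End TouchPoint.

(** * The Hopf lemma *)

Section Hopf.
Variables (R : realType) (N : nat).
Implicit Types x y z d p : 'rV[R]_N.

Lemma qf_outer d x : qf (d^T *m d) x = dot d x ^+ 2.
Proof.
rewrite /qf mulmxA [x *m d^T]mx11_scalar mul_scalar_mx dotZl expr2; congr (_ * _).
by rewrite mxE [RHS]dotC; apply: eq_bigr => i _; rewrite mxE.
Qed.

Lemma tr_mul_outer X d : \tr (X *m (d^T *m d)) = qf X d.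
Proof.
rewrite mulmxA mxtrace_mulC mulmxA /mxtrace big_ord1 mxE /qf.
by apply: eq_bigr => i _; rewrite [d^T _ _]mxE.
Qed.

(** A large power of [K0 - |x - z|^2] plays the role of the exponential in the classical Hopf
    barrier and stays within polynomial jets. *)
Lemma hopf_barrier_jet (K0 C m e : R) n x0 z (k : R := K0 - dot (x0 - z) (x0 - z))
    (h : 'rV[R]_N -> R := fun x => (K0 - dot (x - z) (x - z)) ^+ n.+2 - C)
    (A1 : R := n.+2%:R * k ^+ n.+1) (A2 : R := n.+2%:R * n.+1%:R * k ^+ n) (f : R := m + e * h x0) :
  jet (fun x => (m + e * h x) ^+ 2) x0 (dot ((- (4 * f * e * A1)) *: (x0 - z)))
    (qf ((- (4 * f * e * A1))%:M + (8 * f * e * A2 + 8 * e ^+ 2 * A1 ^+ 2) *: ((x0 - z)^T *m (x0 - z)))).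
Proof.
have jk := jetD (jet_cst K0 x0) (jetZ (-1) (jet_sq z x0)).
have jh := jetD (jet_cst m x0) (jetZ e (jetD (jet_exp n jk) (jet_cst (- C) x0))).
apply: eq_jet (jet_exp 0 jh) => w; rewrite /= ?mulN1r //.
- rewrite expr1 -/k -/(h x0) -/f -/A1 dotZl; ring.
- rewrite expr1 expr0 -/k -/(h x0) -/f -/A1 -/A2 qfD qfZ qf_outer qf_scalar; ring.
Qed.

(** Divide by [4 * f * e]. The radial second derivative [A2] carries a factor [n.+1] more than the
    terms with [A1], so a large [n] wins. Because the radius is the square [f ^+ 2] with
    [f <= e * theta], the quartic error and the variation of [H] are each at most [f * e]. *)
Lemma hopf_numerics n p d (K0 B2 R2 LH L0 theta Dm e f b dH H0 : R)
    (k : R := K0 - dot d d) (A1 : R := n.+2%:R * k ^+ n.+1) (A2 : R := n.+2%:R * n.+1%:R * k ^+ n)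
    (G : R := nrm ((- (4 * f * e * A1)) *: d)) :
  1 <= k -> 1 <= K0 -> 1 <= B2 -> 0 < R2 -> 0 <= LH -> 0 <= L0 ->
  K0 * N%:R + K0 * K0 * (N%:R * LH) + 1 <= n.+1%:R * (R2 / (8 * B2 ^+ 2)) ->
  0 < theta -> theta <= 1 -> N%:R * LH * (2 + L0) * theta <= 1 ->
  Dm = 2 * (n.+2%:R * K0 ^+ n.+1) * K0 ->
  0 < e -> e * (1 + 2 * Dm + 4 * (B2 * Dm ^+ 4)) <= 1 -> 0 < f -> f <= e * theta ->
  0 < b -> b ^+ 2 <= B2 -> R2 / 4 <= dot d d -> slope p <= b * (1 + G) ->
  `|dH| <= LH * ((2 + L0) * f ^+ 2) -> `|H0| <= LH ->
  \tr (curvmx p *m ((- (4 * f * e * A1))%:M + (8 * f * e * A2 + 8 * e ^+ 2 * A1 ^+ 2) *: (d^T *m d))) <=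
    b ^+ 2 * G ^+ 4 / (4 * f ^+ 2) + (N%:R * dH + G * (N%:R * `|H0|)) ->
  False.
Proof.
move=> k1 K01 B21 R20 LH0 L00 hn th0 th1 thE DmE ep eC f0 fe b0 bB d2 pb dHb H0b.
have nN : 0 <= N%:R :> R by [].
have K00 : 0 <= K0 by exact: le_trans K01.
have B20 : 0 <= B2 by exact: le_trans B21.
have L20 : 0 <= 2 + L0 by exact: addr_ge0.
have NL0 : 0 <= N%:R * LH * (2 + L0) by rewrite mulr_ge0// mulr_ge0.
pose A1m : R := n.+2%:R * K0 ^+ n.+1.
have A1m0 : 0 <= A1m by rewrite mulr_ge0// exprn_ge0.
have Dm0 : 0 <= Dm by rewrite DmE !mulr_ge0// exprn_ge0.
have Q0 : 0 <= B2 * Dm ^+ 4 by rewrite mulr_ge0// exprn_ge0.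
rewrite mulmxDr mxtraceD mul_mx_scalar mxtraceZ -scalemxAr mxtraceZ tr_mul_outer.
set S := curvmx p.
have kK : k <= K0 by rewrite gerBl sq_ge0.
have n20 : 0 <= n.+2%:R :> R by [].
have kn0 j : 0 <= k ^+ j by rewrite exprn_ge0//; lra.
have A10 : 0 <= A1 by exact: mulr_ge0.
have A1A : A1 <= A1m by apply: ler_wpM2l => //; rewrite lerXn2r ?nnegrE//; lra.
have nd : nrm d <= K0.
  apply/nrm_lerP => //; apply: (@le_trans _ _ K0); first by move: k1; rewrite /k; lra.
  by rewrite expr2 ler_peMl.
have fe0 : 0 < f * e by exact: mulr_gt0.
have gE : nrm ((- (4 * f * e * A1)) *: d) = 4 * (f * e) * (A1 * nrm d).
  rewrite nrmZ normrN ger0_norm; first by ring.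
  by rewrite mulr_ge0// -mulrA mulr_ge0// ltW.
have Add : A1 * nrm d <= A1m * K0 by apply: ler_pM => //; exact: nrm_ge0.
have gD : 4 * (f * e) * (A1 * nrm d) <= 2 * (f * e) * Dm.
  have -> : 2 * (f * e) * Dm = 4 * (f * e) * (A1m * K0) by rewrite DmE /A1m; ring.
  by apply: ler_wpM2l => //; rewrite mulr_ge0// ltW.
have e1 : e <= 1.
  have := mulr_ge0 (ltW ep) Dm0; have := mulr_ge0 (ltW ep) Q0; move: eC; rewrite !mulrDr; lra.
have fE : f <= e by apply: le_trans fe _; rewrite ler_piMr// ltW.
have f1 : f <= 1 by lra.
have fee : f * e <= e by rewrite ler_piMl// ltW.
have eDm : 2 * (f * e) * Dm <= 1.
  have h1 := ler_wpM2r Dm0 fee; have := mulr_ge0 (ltW ep) Q0; move: eC; rewrite !mulrDr; nra.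
rewrite -/G in gE.
have G0 : 0 <= G by exact: nrm_ge0.
have GD : G <= 2 * (f * e) * Dm by rewrite gE.
have G1 : G <= 1 by rewrite gE; lra.
have bB' : b <= B2 by have [|] := leP b 1; [lra|move=> b1; apply: le_trans bB; rewrite expr2 ler_peMr// ltW].
have a2 : slope p ^+ 2 <= 4 * B2 ^+ 2.
  have -> : 4 * B2 ^+ 2 = (2 * B2) ^+ 2 by ring.
  rewrite lerXn2r ?nnegrE ?(ltW (slope_gt0 p))//; first by lra.
  by apply: le_trans pb _; rewrite mulrC; apply: ler_pM => //; lra.
have p2 : 0 < B2 ^+ 2 by rewrite exprn_gt0//; lra.
have qS : R2 / (16 * B2 ^+ 2) <= qf S d.
  apply: le_trans (qf_curvmx_ge p d); rewrite -slope_sq.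
  apply: (@le_trans _ _ (R2 / 4 / (4 * B2 ^+ 2))).
    by rewrite le_eqVlt; apply/orP; left; apply/eqP; field; rewrite gt_eqF//; lra.
  apply: ler_pM => //; [by rewrite divr_ge0// ltW|by rewrite invr_ge0; lra|].
  by rewrite lef_pV2 ?posrE ?exprn_gt0 ?slope_gt0//; lra.
have tS : \tr S <= N%:R by exact: mxtrace_curvmx_le.
move=> ineq.
(* [G] is of order [f * e], so [G ^+ 4 / f ^+ 2] keeps a factor [f ^+ 2 * e ^+ 4]; dividing by the
   radius does no harm. *)
have t1 : b ^+ 2 * G ^+ 4 / (4 * f ^+ 2) <= f * e.
  rewrite ler_pdivrMr; last by rewrite mulr_gt0// exprn_gt0.
  apply: (@le_trans _ _ (B2 * (2 * (f * e) * Dm) ^+ 4)).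
    apply: ler_pM => //; first by rewrite sqr_ge0.
      by rewrite exprn_ge0.
    by rewrite lerXn2r ?nnegrE ?(le_trans G0 GD).
  have -> : B2 * (2 * (f * e) * Dm) ^+ 4 = (f * e) * (f ^+ 2 * ((e * (4 * (B2 * Dm ^+ 4))) * (4 * (f * e ^+ 2)))) by ring.
  have -> : f * e * (4 * f ^+ 2) = f * e * (f ^+ 2 * 4) by ring.
  apply: ler_wpM2l; first exact: ltW.
  apply: ler_wpM2l; first exact: sqr_ge0.
  have h1 : e * (4 * (B2 * Dm ^+ 4)) <= 1.
    have := mulr_ge0 (ltW ep) Dm0; move: eC; rewrite !mulrDr; lra.
  have h2 : 0 <= 4 * (f * e ^+ 2) <= 4.
    rewrite expr2; have := mulr_ge0 (ltW f0) (sqr_ge0 e); rewrite expr2; nra.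
  have h3 : 0 <= e * (4 * (B2 * Dm ^+ 4)) by apply: mulr_ge0; [exact: ltW|lra].
  case/andP: h2 => h4 h5; nra.
have t2 : N%:R * dH <= f * e.
  have := ler_wpM2l nN (le_trans (ler_norm _) dHb) => /le_trans; apply.
  have -> : N%:R * (LH * ((2 + L0) * f ^+ 2)) = f * ((N%:R * LH * (2 + L0)) * f) by ring.
  rewrite ler_pM2l//; have := ler_wpM2l NL0 fe; have := ler_wpM2l (ltW ep) thE; lra.
have t3 : G * (N%:R * `|H0|) <= 4 * (f * e) * (A1 * K0 * (N%:R * LH)).
  rewrite gE -mulrA; apply: ler_wpM2l; first by rewrite mulr_ge0// ltW.
  have h1 : N%:R * `|H0| <= N%:R * LH by apply: ler_wpM2l => //; exact: H0b.
  apply: ler_pM => //; [by rewrite mulr_ge0// nrm_ge0|exact: ler_wpM2l].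
have A20 : 0 <= A2 by rewrite mulr_ge0// mulr_ge0.
have main : 4 * (f * e) * (2 * A2 * (R2 / (16 * B2 ^+ 2)) - A1 * N%:R) <=
    4 * (f * e) * (2^-1 + A1 * K0 * (N%:R * LH)).
  have fA : 0 <= f * e * A2 by rewrite mulr_ge0// ltW.
  have fA1 : 0 <= f * e * A1 by rewrite mulr_ge0// ltW.
  have s1 := ler_wpM2l fA qS; have s2 := ler_wpM2l fA1 tS.
  have s3 : 0 <= e ^+ 2 * A1 ^+ 2 * qf S d.
    apply: mulr_ge0; first by rewrite mulr_ge0 ?sqr_ge0.
    by apply: le_trans qS; rewrite divr_ge0//; [exact: ltW|lra].
  move: ineq t1 t2 t3 s1 s2 s3; lra.
move: main; rewrite ler_pM2l; last by lra.
have kk : 1 <= n.+2%:R * k ^+ n.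
  apply: (@le_trans _ _ (1 * 1)); first by rewrite mulr1.
  by apply: ler_pM => //; [rewrite ler1n|rewrite exprn_ege1].
have br : 1 <= n.+1%:R * (R2 / (8 * B2 ^+ 2)) - k * N%:R - k * K0 * (N%:R * LH).
  have h1 := ler_wpM2r nN kK; have h2 := ler_wpM2r (mulr_ge0 K00 (mulr_ge0 nN LH0)) kK; lra.
have -> : 2 * A2 * (R2 / (16 * B2 ^+ 2)) = (n.+2%:R * k ^+ n) * (n.+1%:R * (R2 / (8 * B2 ^+ 2))).
  by rewrite /A2; field; rewrite gt_eqF// (lt_le_trans ltr01 B21).
have -> : A1 = (n.+2%:R * k ^+ n) * k by rewrite /A1 exprSr mulrA.
move: kk br; move: (n.+2%:R * k ^+ n) => X X1 br.
have := ler_wpM2l (le_trans ler01 X1) br; lra.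
Qed.


(** The barrier [h] vanishes at [y1], and on [D] it is nonnegative exactly in the ball about [z]
    through [y1]. So [hopf_touch_point] applies, and [touching] at its outcome contradicts
    [hopf_numerics]. The two-point Lipschitz hypothesis bounds the slope of the touching sphere,
    hence the ellipticity. *)
Lemma hopf (Omega : set 'rV[R]_N) (H u v : 'rV[R]_N -> R) y1 z (rd L0 LH : R)
    (D := [set x | dot (x - y1) (x - y1) <= rd ^+ 2]) :
  (0 < N)%N -> open Omega -> (forall x, Omega x -> {for x, continuous H}) ->
  viscosity_supersolution Omega H u -> viscosity_subsolution Omega H v ->
  0 < rd -> 0 <= L0 -> 0 <= LH -> D `<=` Omega -> u y1 = v y1 ->
  (forall x y, D x -> D y -> v x - u y <= L0 * nrm (x - y)) ->
  (forall x y, D x -> D y -> `|H x - H y| <= LH * nrm (x - y)) ->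
  (forall x, D x -> `|H x| <= LH) ->
  0 < dot (y1 - z) (y1 - z) ->
  (forall x, D x -> dot (x - z) (x - z) <= dot (y1 - z) (y1 - z) -> u x = v x -> x = y1) ->
  False.
Proof.
move=> N0 Oo Hc us vs rd0 L00 LH0 DO uv1 pair Hlip Hbd R20 uniq.
set R2 := dot (y1 - z) (y1 - z) in R20 uniq.
(* Large enough for [K0 - |x - z|^2] to be at least 1 on all of [D]. *)
pose K0 : R := 2 * rd ^+ 2 + 2 * R2 + 1.
have lu := lsc_on_within Oo DO us.1; have lv := usc_on_within Oo DO vs.1.
have rd20 : 0 <= rd ^+ 2 := sqr_ge0 rd.
have par (a b : 'rV[R]_N) : dot (a + b) (a + b) <= 2 * dot a a + 2 * dot b b.
  by have := sq_ge0 (a - b); rewrite !dotE (dotC b a); lra.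
have kD x : D x -> 1 <= K0 - dot (x - z) (x - z).
  move=> Dx; have := par (x - y1) (y1 - z); rewrite addrA subrK -/R2 /K0; move: Dx; rewrite /D /=; lra.
have K01 : 1 <= K0 by rewrite /K0; lra.
pose B2 : R := 1 + (1 + L0) ^+ 2.
have B21 : 1 <= B2 by rewrite lerDl sqr_ge0.
pose n := Num.bound (8 * B2 ^+ 2 * (K0 * N%:R + K0 * K0 * (N%:R * LH) + 1) / R2).
have nN : 0 <= N%:R :> R by [].
have hn : K0 * N%:R + K0 * K0 * (N%:R * LH) + 1 <= n.+1%:R * (R2 / (8 * B2 ^+ 2)).
  have := @archi_boundP R (8 * B2 ^+ 2 * (K0 * N%:R + K0 * K0 * (N%:R * LH) + 1) / R2).
  have p1 : 0 <= K0 * N%:R + K0 * K0 * (N%:R * LH) + 1 by rewrite !addr_ge0 ?mulr_ge0//; lra.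
  have p2 : 0 < B2 ^+ 2 by rewrite exprn_gt0//; lra.
  have p3 : 0 < 8 * B2 ^+ 2 by lra.
  rewrite -/n => /(_ (divr_ge0 (mulr_ge0 (ltW p3) p1) (ltW R20))).
  rewrite ltr_pdivrMr// => h1; rewrite [leRHS]mulrA ler_pdivlMr// [leLHS]mulrC.
  by apply: le_trans (ltW h1) _; rewrite ler_wpM2r ?(ltW R20)// ler_nat.
pose h x : R := (K0 - dot (x - z) (x - z)) ^+ n.+2 - (K0 - R2) ^+ n.+2.
have ch : continuous h.
  move=> x; apply: (@continuousB _ _ _ (fun x : 'rV[R]_N => (K0 - dot (x - z) (x - z)) ^+ n.+2)
    (fun _ => (K0 - R2) ^+ n.+2)); last exact: cst_continuous.
  apply: (@continuous_comp _ _ _ (fun x : 'rV[R]_N => K0 - dot (x - z) (x - z)) (fun t : R => t ^+ n.+2));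
    last exact: exprn_continuous.
  apply: (@continuousB _ _ _ (fun _ : 'rV[R]_N => K0) (fun x => dot (x - z) (x - z))); first exact: cst_continuous.
  apply: (@continuous_comp _ _ _ (fun x : 'rV[R]_N => x - z) (fun x : 'rV[R]_N => dot x x)); last exact: cts_sq.
  by apply: continuousB; [exact: cvg_id|exact: cst_continuous].
have hy1 : h y1 = 0 by rewrite /h subrr.
have uniq' x : D x -> 0 <= h x -> u x = v x -> x = y1.
  move=> Dx hx; apply: uniq => //.
  have Dy1 : D y1 by rewrite /D /= subrr dot0l.
  have := kD x Dx; have := kD y1 Dy1; rewrite -/R2 => k1 k2.
  by move: hx; rewrite /h subr_ge0 ler_pXn2r ?nnegrE//; lra.
(* Bounds [f / e], so that the difference of [H] over the distance [(2 + L0) * f ^+ 2] stays below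
   [f * e]. *)
pose theta : R := (N%:R * LH * (2 + L0) + 1)^-1.
have NL0 : 0 <= N%:R * LH * (2 + L0) by rewrite !mulr_ge0//; lra.
have th0 : 0 < theta by rewrite invr_gt0; lra.
have th1 : theta <= 1 by rewrite invf_le1; lra.
have thE : N%:R * LH * (2 + L0) * theta <= 1 by rewrite ler_pdivrMr ?mul1r; lra.
pose eta : R := Num.min (R2 / 4) ((rd / 2) ^+ 2).
have eta0 : 0 < eta by rewrite lt_min !divr_gt0//= exprn_gt0// divr_gt0.
have [e0 e00 he] := hopf_touch_point rd0 L00 eta0 th0 lu lv ch hy1 uv1 pair uniq'.
pose A1m : R := n.+2%:R * K0 ^+ n.+1.
pose Dm : R := 2 * A1m * K0.
have A1m0 : 0 <= A1m by rewrite mulr_ge0// exprn_ge0//; lra.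
have K00 : 0 <= K0 by lra.
have Dm0 : 0 <= Dm := mulr_ge0 (mulr_ge0 (ler0n _ 2) A1m0) K00.
have B20 : 0 <= B2 by lra.
have Q0 : 0 <= B2 * Dm ^+ 4 by rewrite mulr_ge0// exprn_ge0.
pose e : R := Num.min e0 (1 + 2 * Dm + 4 * (B2 * Dm ^+ 4))^-1.
have ep : 0 < e by rewrite lt_min e00 invr_gt0; lra.
have ee0 : e <= e0 by rewrite ge_min lexx.
have eC : e * (1 + 2 * Dm + 4 * (B2 * Dm ^+ 4)) <= 1.
  by rewrite -ler_pdivlMr ?div1r ?ge_min ?lexx ?orbT//; lra.
have [x0 [y0 [c [m [s [Th [[x0e yx Dy0 srd] [s0 fs f0 fe] [ThE Th0 zTh] near]]]]]]] := he e ep ee0.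
set d := x0 - z.
set k : R := K0 - dot d d.
pose A1 : R := n.+2%:R * k ^+ n.+1; pose A2 : R := n.+2%:R * n.+1%:R * k ^+ n.
set f : R := m + e * h x0 in fs f0 fe.
have jr := hopf_barrier_jet K0 ((K0 - R2) ^+ n.+2) m e n x0 z.
rewrite -/(h x0) -/f -/d -/k -/A1 -/A2 in jr.
have x0y1 : nrm (x0 - y1) <= rd / 2.
  apply/nrm_lerP; first lra.
  by apply: ltW; apply: lt_le_trans x0e _; rewrite ge_min lexx orbT.
have yx4 : nrm (y0 - x0) <= rd / 4 by apply: le_trans yx _.
have inD a : nrm (a - y1) <= rd -> D a by move=> h1; apply/nrm_lerP; first exact: ltW.
have Dx0 : D x0 by apply: inD; lra.
have subx : [set x | dot (x - x0) (x - x0) <= (rd / 4) ^+ 2] `<=` D.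
  move=> x /nrm_lerP h1; apply: inD; have := ler_nrmD (x - x0) (x0 - y1).
  rewrite addrA subrK; have := h1 _; lra.
have suby : [set x | dot (x - y0) (x - y0) <= (rd / 4) ^+ 2] `<=` D.
  move=> x /nrm_lerP h1; apply: inD; have := ler_nrmD (x - y0) (y0 - x0 + (x0 - y1)).
  have := ler_nrmD (y0 - x0) (x0 - y1).
  have -> : x - y0 + (y0 - x0 + (x0 - y1)) = x - y1 by apply/rowP => i; rewrite !mxE; ring.
  have := h1 _; lra.
have r4 : 0 < (rd / 4) ^+ 2 by rewrite exprn_gt0// divr_gt0.
have zs : dot (y0 - x0 - c) (y0 - x0 - c) < s ^+ 2 by rewrite -subr_gt0 -sqrtr_gt0 -ThE.
rewrite ThE in near.
have [p] := touching Oo Hc us vs N0 (DO _ Dx0) (DO _ Dy0) r4 (lsc_within_sub subx lv)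
  (lsc_within_sub suby lu) jr fs s0 zs near.
rewrite -ThE => pb.
have TT : s ^+ 2 = Th ^+ 2 + nrm (y0 - x0 - c) ^+ 2.
  by rewrite ThE sqr_sqrtr ?subr_ge0 ?(ltW zs)// nrm_sq subrK.
have T20 : 0 < Th ^+ 2 by rewrite exprn_gt0.
have bB : (s / Th) ^+ 2 <= B2.
  rewrite expr_div_n ler_pdivrMr// TT /B2 mulrDl mul1r lerD2l -exprMn.
  by rewrite lerXn2r ?nnegrE ?nrm_ge0// mulr_ge0 ?(ltW Th0)// addr_ge0.
have d2 : R2 / 4 <= dot d d.
  have := par (y1 - x0) d; rewrite /d addrA subrK -/R2.
  have -> : y1 - x0 = - (x0 - y1) by rewrite opprB.
  rewrite dotNl dotNr opprK; have : dot (x0 - y1) (x0 - y1) < R2 / 4.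
    by apply: lt_le_trans x0e _; rewrite ge_min lexx.
  lra.
have dHb : `|H y0 - H x0| <= LH * ((2 + L0) * s).
  by apply: le_trans (Hlip y0 x0 Dy0 Dx0) _; exact: ler_wpM2l.
have b0 : 0 < s / Th by exact: divr_gt0.
rewrite -fs in pb bB dHb b0 *.
exact: (hopf_numerics (kD _ Dx0) K01 B21 R20 LH0 L00 hn th0 th1 thE erefl ep eC f0 fe b0 bB d2 pb dHb (Hbd _ Dx0)).
Qed.

End Hopf.

(** * Geometry of two steep, nearly parallel slopes *)

Section SlopeGeometry.
Variables (R : realType) (N : nat).
Variables (e P Bx By p q : 'rV[R]_N) (al f g b F : R).
Hypotheses (e1 : dot e e = 1) (PE : P = - (al *: e)) (g0 : 0 < g) (gf : g <= f) (fF : f <= F)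
  (Pp : P = f *: (p - Bx)) (Pq : P = g *: (q - By))
  (Bxb : nrm Bx <= b) (Byb : nrm By <= b) (alF : 16 * F * (1 + b) <= al).

Let a := slope p.
Let c := slope q.
Let de := nrm (Bx - By).
(** [nu] bounds the distance between the scaled normals [f (p, -1)] and [g (q, -1)]; [om] bounds the
    distance between the corresponding unit normals. *)
Let nu := (1 + b) * (f - g) + F * de.
Let om := 2 * nu / al.

Let f0 : 0 < f. Proof. exact: lt_le_trans gf. Qed.
Let F0 : 0 < F. Proof. exact: lt_le_trans fF. Qed.
Let b0 : 0 <= b. Proof. exact: le_trans (nrm_ge0 Bx) Bxb. Qed.
Let al0 : 0 < al.
Proof. by apply: lt_le_trans alF; rewrite mulr_gt0 ?mulr_gt0// ltr_pwDl. Qed.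
Let a0 : 0 < a. Proof. exact: slope_gt0. Qed.
Let c0 : 0 < c. Proof. exact: slope_gt0. Qed.
Let de0 : 0 <= de. Proof. exact: nrm_ge0. Qed.
Let nu0 : 0 <= nu.
Proof.
rewrite addr_ge0 ?mulr_ge0 ?subr_ge0//; [exact: addr_ge0|exact: ltW].
Qed.
Let om0 : 0 <= om. Proof. by rewrite divr_ge0 ?mulr_ge0// ltW. Qed.
(* lra does not look at section hypotheses, hence the copies of this fact in the proofs. *)
Let alF2 : 0 < F /\ 16 * F + 16 * (F * b) <= al.
Proof. by split=> //; apply: le_trans alF; rewrite mulrDr mulr1 mulrA. Qed.
Let nP : nrm P = al. 
Proof.
have ne : nrm e = 1 by rewrite /nrm e1 sqrtr1.
by rewrite PE nrmN nrmZ ne mulr1 gtr0_norm.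
Qed.

Let length_bounds (h : R) (r B : 'rV[R]_N) : 0 < h -> h <= F -> P = h *: (r - B) -> nrm B <= b ->
  al / 2 <= h * slope r <= al + F * (1 + b).
Proof.
move=> h0 hF PE' Bb.
have hr : h *: r = P + h *: B by rewrite PE' scalerBr subrK.
have r0 := nrm_ge0 r; have [s1 s0] := (slope_sq r, slope_gt0 r).
have rs : nrm r <= slope r by rewrite -(@ler_pXn2r _ 2) ?nnegrE ?(ltW s0)// nrm_sq s1 lerDr.
have sr : slope r <= 1 + nrm r.
  rewrite -(@ler_pXn2r _ 2) ?nnegrE ?(ltW s0)//; last by rewrite addr_ge0.
  by rewrite s1 -nrm_sq; nra.
have hn : nrm (h *: r) = h * nrm r by rewrite nrmZ gtr0_norm.
have hB : nrm (h *: B) <= F * b.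
  by rewrite nrmZ gtr0_norm//; apply: ler_pM => //; [exact: ltW|exact: nrm_ge0].
have l1 : h * nrm r <= al + F * b.
  by rewrite -hn hr -nP; apply: le_trans (ler_nrmD _ _) _; rewrite lerD2l.
have l2 : al - F * b <= h * nrm r.
  have := ler_nrmD (h *: r) (- (h *: B)); rewrite nrmN hn {1}hr addrK nP; lra.
have h1 := ler_wpM2l (ltW h0) rs; have h2 := ler_wpM2l (ltW h0) sr.
have Fb : 0 <= F * b by rewrite mulr_ge0// ltW.
have [F0' alF2'] := alF2.
by apply/andP; split; lra.
Qed.

Lemma length_boundsE : al / 2 <= f * a <= al + F * (1 + b).
Proof. exact: length_bounds f0 fF Pp Bxb. Qed.

Lemma length_boundsF : al / 2 <= g * c <= al + F * (1 + b).
Proof. exact: length_bounds g0 (le_trans gf fF) Pq Byb. Qed.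

Let nn := dot (f *: p - g *: q) (f *: p - g *: q) + (f - g) ^+ 2.

Let nn_le : nn <= nu ^+ 2.
Proof.
have E : f *: p - g *: q = f *: Bx - g *: By.
  have : f *: (p - Bx) = g *: (q - By) by rewrite -Pp.
  rewrite !scalerBr => /eqP; rewrite subr_eq addrAC => /eqP ->.
  by apply/rowP => i; rewrite !mxE; ring.
have h1 : nrm (f *: p - g *: q) <= (f - g) * b + F * de.
  rewrite E; have -> : f *: Bx - g *: By = (f - g) *: Bx + g *: (Bx - By).
    by apply/rowP => i; rewrite !mxE; ring.
  apply: le_trans (ler_nrmD _ _) _; rewrite !nrmZ (gtr0_norm g0) ger0_norm ?subr_ge0//.
  apply: lerD; first by rewrite ler_wpM2l ?subr_ge0.
  by rewrite ler_wpM2r ?(le_trans gf)// .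
rewrite /nn -nrm_sq; have := nrm_ge0 (f *: p - g *: q).
have fg : 0 <= f - g by rewrite subr_ge0.
have : 0 <= (f - g) * b + F * de by rewrite addr_ge0 ?mulr_ge0// ltW.
rewrite /nu; set X := (f - g) * b + F * de in h1 *; set Y := f - g in fg *; set Z := nrm _ in h1 * => X0 Z0.
have -> : (1 + b) * Y + F * de = X + Y by rewrite /X /Y; ring.
nra.
Qed.

(** Law of cosines: a squared distance is the squared difference of the lengths plus twice the
    excess of their product over the inner product. Both parts are nonnegative, so each is bounded
    by [nu ^+ 2]. *)
Let nnE : nn = (f * a - g * c) ^+ 2 + 2 * (f * a * (g * c) - f * g * (1 + dot p q)).
Proof.
rewrite /nn !dotE (dotC q p).
have -> : dot p p = a ^+ 2 - 1 by rewrite /a slope_sq; ring.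
have -> : dot q q = c ^+ 2 - 1 by rewrite /c slope_sq; ring.
ring.
Qed.

Let fg0 : 0 < f * g. Proof. exact: mulr_gt0. Qed.

Let defect_ge0 : 0 <= f * a * (g * c) - f * g * (1 + dot p q).
Proof.
have -> : f * a * (g * c) = f * g * (a * c) by ring.
by rewrite -mulrBr mulr_ge0 ?(ltW fg0)// subr_ge0 dot_le_slope.
Qed.

Lemma length_diff : `|f * a - g * c| <= nu.
Proof.
rewrite -(@ler_pXn2r _ 2) ?nnegrE// real_normK ?num_real//.
by apply: le_trans nn_le; rewrite nnE lerDl mulr_ge0.
Qed.

Lemma defect_le : 2 * (f * a * (g * c) - f * g * (1 + dot p q)) <= nu ^+ 2.
Proof. by apply: le_trans nn_le; rewrite nnE lerDr sqr_ge0. Qed.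

(** [f *: p] and [g *: q] are both the common vector [P] plus a perturbation at most a sixteenth of
    its length. *)
Lemma slopes_acute : 0 <= 1 + dot p q.
Proof.
rewrite -(pmulr_rge0 _ fg0).
have -> : f * g * (1 + dot p q) = f * g + dot (f *: p) (g *: q) by rewrite !dotE; ring.
have fp : f *: p = P + f *: Bx by rewrite Pp scalerBr subrK.
have gq : g *: q = P + g *: By by rewrite Pq scalerBr subrK.
have h1 := ler_dot P (f *: Bx); have h2 := ler_dot P (g *: By); have h3 := ler_dot (f *: Bx) (g *: By).
rewrite fp gq !dotDl !dotDr -nrm_sq nP (dotC (f *: Bx) P).
rewrite !ler_norml nP in h1 h2 h3.
have [F0' alF2'] := alF2.
have n1 : nrm (f *: Bx) <= al / 16.
  rewrite nrmZ gtr0_norm//; have : f * nrm Bx <= F * b by apply: ler_pM => //; [exact: ltW|exact: nrm_ge0].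
  lra.
have n2 : nrm (g *: By) <= al / 16.
  rewrite nrmZ gtr0_norm//; have : g * nrm By <= F * b.
    by apply: ler_pM => //; [exact: ltW|exact: nrm_ge0|exact: le_trans gf fF].
  lra.
have n3 : nrm (f *: Bx) * nrm (g *: By) <= al / 16 * (al / 16) by apply: ler_pM => //; exact: nrm_ge0.
have n4 := ler_wpM2l (ltW al0) n1; have n5 := ler_wpM2l (ltW al0) n2.
case/andP: h1 => h1 _; case/andP: h2 => h2 _; case/andP: h3 => h3 _.
have al0' : 0 < al := al0; have fg0' : 0 < f * g := fg0; nra.
Qed.

Let d := dot p q.
(** The squared tangent of half the angle between the two normals. *)
Let K := (a * c - 1 - d) / (a * c + 1 + d).

Let lE : 0 < f * a. Proof. exact: mulr_gt0. Qed.
Let lF : 0 < g * c. Proof. exact: mulr_gt0. Qed.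
Let lEF : al ^+ 2 / 4 <= f * a * (g * c).
Proof.
have -> : al ^+ 2 / 4 = (al / 2) * (al / 2) by field.
by apply: ler_pM; rewrite ?divr_ge0 ?(ltW al0)//; [case/andP: length_boundsE|case/andP: length_boundsF].
Qed.

Lemma defect_ratio_ge0 : 0 <= K.
Proof.
apply: divr_ge0; last exact: le_trans (slope_sum_ge p q).
by rewrite -addrA -opprD subr_ge0 dot_le_slope.
Qed.

Let defect_scaled : (f * a * (g * c) - f * g * (1 + d)) / (f * a * (g * c)) <= 2 * nu ^+ 2 / al ^+ 2.
Proof.
have al2 : 0 < al ^+ 2 by rewrite exprn_gt0.
rewrite ler_pdivrMr ?mulr_gt0//.
have -> : 2 * nu ^+ 2 / al ^+ 2 * (f * a * (g * c)) = 2 * nu ^+ 2 * ((f * a * (g * c)) / al ^+ 2) by ring.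
have h1 : 4^-1 <= f * a * (g * c) / al ^+ 2 by rewrite ler_pdivlMr// mulrC.
have h2 := ler_wpM2l (mulr_ge0 (ler0n R 2) (sqr_ge0 nu)) h1.
by have h3 := defect_le; rewrite -/d in h3; lra.
Qed.

Lemma defect_ratio_le : K <= 2 * nu ^+ 2 / al ^+ 2.
Proof.
apply: le_trans defect_scaled.
have -> : (f * a * (g * c) - f * g * (1 + d)) / (f * a * (g * c)) = (a * c - 1 - d) / (a * c).
  by field; rewrite !gt_eqF.
apply: ler_wpM2l; first by rewrite -addrA -opprD subr_ge0 dot_le_slope.
have ac : 0 < a * c by exact: mulr_gt0.
by rewrite lef_pV2 ?posrE//; have h := slopes_acute; rewrite -/d in h; lra.
Qed.

Let w := a^-1 *: p + c^-1 *: q.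
Let y := a^-1 *: Bx + c^-1 *: By.

Let inv_slopes : a^-1 <= 2 * f / al /\ c^-1 <= 2 * f / al.
Proof.
have [h1 h2] := (andP length_boundsE, andP length_boundsF); have [l1 _] := h1; have [l2 _] := h2.
have [a0' c0' al0' gf'] : [/\ 0 < a, 0 < c, 0 < al & g <= f] by [].
split.
  by rewrite ler_pdivlMr// mulrC ler_pdivrMr//; lra.
rewrite ler_pdivlMr// mulrC ler_pdivrMr//; have := ler_wpM2r (ltW c0') gf'; lra.
Qed.

Let wE : w = - (al / (f * a) + al / (g * c)) *: e + y.
Proof.
have pE : p = f^-1 *: P + Bx by rewrite Pp scalerA mulVf ?gt_eqF// scale1r subrK.
have qE : q = g^-1 *: P + By by rewrite Pq scalerA mulVf ?gt_eqF// scale1r subrK.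
rewrite /w {1}pE {1}qE PE /y; apply/rowP => i; rewrite !mxE; field.
by rewrite !gt_eqF.
Qed.

Let ny : nrm y <= 4 * b * f / al.
Proof.
have [i1 i2] := inv_slopes; have b0' : 0 <= b := b0.
apply: le_trans (ler_nrmD _ _) _; rewrite !nrmZ !gtr0_norm ?invr_gt0//.
have h1 : a^-1 * nrm Bx <= 2 * f / al * b by apply: ler_pM => //; [rewrite invr_ge0 ltW|exact: nrm_ge0].
have h2 : c^-1 * nrm By <= 2 * f / al * b by apply: ler_pM => //; [rewrite invr_ge0 ltW|exact: nrm_ge0].
lra.
Qed.

(** By [wE], [w] is a multiple of [e] plus [y]. Only [y] has a component transverse to [e], and it
    is small because the slopes are large. *)
Lemma tilt_perp_le : dot w w - dot e w ^+ 2 <= (4 * b * f / al) ^+ 2.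
Proof.
have -> : dot w w - dot e w ^+ 2 = nrm y ^+ 2 - dot e y ^+ 2.
  rewrite nrm_sq wE; move: (- _ : R) => k; move: y => z.
  rewrite !dotE (dotC z e) e1; ring.
have := sqr_ge0 (dot e y); have : nrm y ^+ 2 <= (4 * b * f / al) ^+ 2.
  by rewrite ler_pXn2r ?nnegrE ?nrm_ge0// (le_trans (nrm_ge0 y) ny).
lra.
Qed.

Lemma tilt_along_ge : 1 <= dot e w ^+ 2.
Proof.
have [F0' alF2'] := alF2; have [al0' fF' b0' f0'] : [/\ 0 < al, f <= F, 0 <= b & 0 < f] by [].
have Fb : 0 <= F * b by exact: mulr_ge0 (ltW F0') b0'.
have bfF := ler_wpM2l b0' fF'.
have ey : dot e y <= 1 / 4.
  have ne : nrm e = 1 by rewrite /nrm e1 sqrtr1.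
  apply: le_trans (ler_norm _) _; apply: le_trans (ler_dot _ _) _; rewrite ne mul1r.
  by apply: le_trans ny _; rewrite ler_pdivrMr//; lra.
have half t : 0 < t -> t <= al + F * (1 + b) -> 8 / 10 <= al / t.
  by move=> t0 h; rewrite ler_pdivlMr//; lra.
have h1 := half _ lE (proj2 (andP length_boundsE)).
have h2 := half _ lF (proj2 (andP length_boundsF)).
have : dot e w <= -1.
  have -> : dot e w = - (al / (f * a) + al / (g * c)) + dot e y.
    by rewrite wE; move: y => z; rewrite !dotE e1 mulr1.
  lra.
nra.
Qed.

(** The value is the squared length of the part of [(B, 1)] orthogonal to the unit vector along
    [(r, 1)]. It depends on [r] only through that unit vector, which yields the bound on
    [gain_diff]. *)
Let gain_form (r B : 'rV[R]_N) :
  qf (curvmx r) (r - B) = 1 + dot B B - ((1 + dot B r) / slope r) ^+ 2.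
Proof.
have s0 := slope_gt0 r; have ss := slope_sq r.
have rr : dot r r = slope r ^+ 2 - 1 by rewrite ss; ring.
rewrite /qf mulmx_curvmx -ss !dotE (dotC r B) rr; field; by rewrite gt_eqF.
Qed.

(** For a steep slope the unit vector along [(p, 1)] is almost horizontal, so most of the last
    component of [(Bx, 1)] survives. *)
Lemma gain_ge : 1 / 2 <= qf (curvmx p) (p - Bx).
Proof.
rewrite gain_form -/a.
have [F0' alF2'] := alF2; have [a0' b0' f0' fF'] : [/\ 0 < a, 0 <= b, 0 < f & f <= F] by [].
have [l1 _] := andP length_boundsE.
have a8 : 8 * (1 + b) <= a.
  have h1 := ler_wpM2r (ltW a0') fF'.
  by rewrite -(ler_pM2l F0'); lra.
have nB := ler_wpM2r (nrm_ge0 Bx) Bxb.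
have pa : nrm p <= a by rewrite -(@ler_pXn2r _ 2) ?nnegrE ?nrm_ge0 ?(ltW a0')// nrm_sq slope_sq lerDr.
have h2 : dot Bx p <= b * a.
  apply: le_trans (ler_norm _) _; apply: le_trans (ler_dot _ _) _.
  by apply: ler_pM => //; exact: nrm_ge0.
have h3 : dot Bx p ^+ 2 <= dot Bx Bx * a ^+ 2.
  apply: le_trans (cauchy_schwarz _ _) _; rewrite ler_wpM2l ?sq_ge0// slope_sq; lra.
rewrite expr_div_n lerBrDr -lerBrDl ler_pdivrMr ?exprn_gt0//.
have -> : (1 + dot Bx p) ^+ 2 = 1 + 2 * dot Bx p + dot Bx p ^+ 2 by ring.
have h4 : 0 <= b * a by exact: mulr_ge0 b0' (ltW a0').
have := ler_wpM2r (ltW a0') a8; rewrite expr2 in h3 *; nra.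
Qed.

Let normals_close : nrm (a^-1 *: p - c^-1 *: q) <= om /\ `|a^-1 - c^-1| <= om.
Proof.
have E : nrm (a^-1 *: p - c^-1 *: q) ^+ 2 + (a^-1 - c^-1) ^+ 2 <= om ^+ 2.
  have -> : om ^+ 2 = 2 * (2 * nu ^+ 2 / al ^+ 2) by rewrite /om expr_div_n; ring.
  apply: le_trans (ler_wpM2l (ler0n R 2) defect_scaled).
  rewrite le_eqVlt; apply/orP; left; apply/eqP; rewrite nrm_sq !dotE (dotC q p) -/d.
  have -> : dot p p = a ^+ 2 - 1 by rewrite /a slope_sq; ring.
  have -> : dot q q = c ^+ 2 - 1 by rewrite /c slope_sq; ring.
  by field; rewrite !gt_eqF.
split.
  rewrite -(@ler_pXn2r _ 2) ?nnegrE ?nrm_ge0//; apply: le_trans E; rewrite lerDl; exact: sqr_ge0.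
rewrite -(@ler_pXn2r _ 2) ?nnegrE// real_normK ?num_real//; apply: le_trans E; rewrite lerDr; exact: sqr_ge0.
Qed.

Let slope_inv_le1 (r : 'rV[R]_N) : 0 <= (slope r)^-1 <= 1.
Proof. by rewrite invr_ge0 ltW ?slope_gt0// invf_le1 ?slope_gt0// slope_ge1. Qed.

Lemma gain_diff :
  `|qf (curvmx p) (p - Bx) - qf (curvmx q) (q - By)| <= 4 * (1 + b) ^+ 2 * (om + de).
Proof.
rewrite !gain_form -/a -/c.
have [n1 n2] := normals_close; have [b0' om0' de0'] : [/\ 0 <= b, 0 <= om & 0 <= de] by [].
have unit_h (r : 'rV[R]_N) : nrm ((slope r)^-1 *: r) <= 1.
  rewrite nrmZ gtr0_norm ?invr_gt0 ?slope_gt0// mulrC ler_pdivrMr ?slope_gt0// mul1r.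
  by rewrite -(@ler_pXn2r _ 2) ?nnegrE ?nrm_ge0 ?(ltW (slope_gt0 _))// nrm_sq slope_sq lerDr.
have mE (r B : 'rV[R]_N) : (1 + dot B r) / slope r = (slope r)^-1 + dot B ((slope r)^-1 *: r).
  by rewrite dotZr; ring.
have mb (r B : 'rV[R]_N) : nrm B <= b -> `|(1 + dot B r) / slope r| <= 1 + b.
  move=> Bb; rewrite mE; apply: le_trans (ler_normD _ _) _; apply: lerD.
    by case/andP: (slope_inv_le1 r) => h1 h2; rewrite ger0_norm.
  apply: le_trans (ler_dot _ _) _; rewrite -[leRHS]mulr1; apply: ler_pM => //; exact: nrm_ge0.
have m1 := mb p Bx Bxb; have m2 := mb q By Byb; rewrite -/a in m1; rewrite -/c in m2.
have md : `|(1 + dot Bx p) / a - (1 + dot By q) / c| <= (1 + b) * om + de.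
  rewrite !mE -/a -/c.
  have -> : a^-1 + dot Bx (a^-1 *: p) - (c^-1 + dot By (c^-1 *: q)) =
      (a^-1 - c^-1) + dot Bx (a^-1 *: p - c^-1 *: q) + dot (Bx - By) (c^-1 *: q) by rewrite !dotE; ring.
  have h1 : `|dot Bx (a^-1 *: p - c^-1 *: q)| <= b * om.
    by apply: le_trans (ler_dot _ _) _; apply: ler_pM => //; exact: nrm_ge0.
  have h2 : `|dot (Bx - By) (c^-1 *: q)| <= de.
    apply: le_trans (ler_dot _ _) _; rewrite -[leRHS]mulr1; apply: ler_pM => //; try exact: nrm_ge0.
    exact: unit_h.
  apply: le_trans (ler_normD _ _) _; apply: lerD => //.
  apply: le_trans (ler_normD _ _) _; rewrite mulrDl mul1r; exact: lerD.
have Bd : `|dot Bx Bx - dot By By| <= 2 * b * de.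
  have -> : dot Bx Bx - dot By By = dot (Bx - By) (Bx + By) by rewrite !dotE (dotC By Bx); ring.
  apply: le_trans (ler_dot _ _) _; rewrite mulrC; apply: ler_wpM2r => //.
  by apply: le_trans (ler_nrmD _ _) _; have := lerD Bxb Byb; lra.
move: m1 m2 md Bd; set X := (1 + dot Bx p) / a; set Y := (1 + dot By q) / c => m1 m2 md Bd.
have XY : `|X ^+ 2 - Y ^+ 2| <= ((1 + b) * om + de) * (2 * (1 + b)).
  have -> : X ^+ 2 - Y ^+ 2 = (X - Y) * (X + Y) by ring.
  by rewrite normrM; apply: ler_pM => //; apply: le_trans (ler_normD _ _) _; lra.
have -> : 1 + dot Bx Bx - X ^+ 2 - (1 + dot By By - Y ^+ 2) = (dot Bx Bx - dot By By) - (X ^+ 2 - Y ^+ 2) by ring.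
apply: le_trans (ler_normB _ _) _; apply: le_trans (lerD Bd XY) _.
have := mulr_ge0 b0' om0'; have := mulr_ge0 b0' de0'; have := mulr_ge0 b0' (mulr_ge0 b0' de0').
have := mulr_ge0 b0' (mulr_ge0 b0' om0'); nra.
Qed.

Lemma trace_diff : `|\tr (curvmx p) - \tr (curvmx q)| <= 2 * om.
Proof.
have trE (r : 'rV[R]_N) : \tr (curvmx r) = N%:R - 1 + (slope r)^-1 ^+ 2.
  have := tr_curvmx r 1%:M; rewrite mulmx1 mxtrace1 qf_scalar mul1r -slope_sq => ->.
  have -> : dot r r = slope r ^+ 2 - 1 by rewrite slope_sq; ring.
  by field; rewrite gt_eqF// slope_gt0.
have [_ n2] := normals_close.
have -> : \tr (curvmx p) - \tr (curvmx q) = (a^-1 - c^-1) * (a^-1 + c^-1) by rewrite !trE -/a -/c; ring.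
rewrite normrM mulrC; apply: ler_pM => //.
have /andP[h1 h2] := slope_inv_le1 p; have /andP[h3 h4] := slope_inv_le1 q.
rewrite -/a in h1 h2; rewrite -/c in h3 h4; rewrite ger0_norm; lra.
Qed.

End SlopeGeometry.

(** * Change of the unknown by a convex function *)

Section Transform.
Variables (R : realType) (N : nat).
Implicit Types (x y p P : 'rV[R]_N) (X : 'M[R]_N).
Local Notation T3 := ('rV[R]_N * R * 'rV[R]_N)%type.

(** The cube makes the positive part twice continuously differentiable across 0; higher powers are
    then taken of this function. *)
Definition pos3 (t : R) : R := Num.max 0 t ^+ 3.

Lemma jet1_pos3 t : jet1 pos3 t (3 * Num.max 0 t ^+ 2) (6 * Num.max 0 t).
Proof.
move=> k k0; have [t0|t0|<-] := ltgtP 0 t.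
- near=> s.
  have s1 : `|s| <= t by near: s; apply: (@nbhs0_le _ R^o).
  have s2 : `|s| <= k by near: s; apply: (@nbhs0_le _ R^o).
  have ts : 0 <= t + s by have := ler_norm (- s); rewrite normrN; lra.
  rewrite /pos3 (max_r (ltW t0)) (max_r ts).
  have -> : (t + s) ^+ 3 - t ^+ 3 - 3 * t ^+ 2 * s - 2^-1 * (6 * t) * s ^+ 2 = s * s ^+ 2 by field.
  by rewrite normrM (ger0_norm (sqr_ge0 s)); apply: ler_wpM2r => //; exact: sqr_ge0.
- near=> s.
  have s1 : `|s| <= - t by near: s; apply: (@nbhs0_le _ R^o); lra.
  have ts : t + s <= 0 by have := ler_norm s; lra.
  rewrite /pos3 (max_l (ltW t0)) (max_l ts) !expr0n /=.
  by rewrite !mulr0 !mul0r !subr0 normr0 mulr_ge0 ?sqr_ge0// ltW.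
- near=> s.
  have s2 : `|s| <= k by near: s; apply: (@nbhs0_le _ R^o).
  rewrite /pos3 maxxx add0r !expr0n /= !mulr0 !mul0r !subr0.
  have [s0|s0] := leP 0 s.
    rewrite exprS normrM (ger0_norm (sqr_ge0 s)); apply: ler_wpM2r => //; exact: sqr_ge0.
  by rewrite expr0n normr0 mulr_ge0 ?sqr_ge0// ltW.
Unshelve. all: by end_near.
Qed.

(* [chi n eps t] is [t^(3n+6) + eps t] for [t >= 0]. *)
Definition chi n (eps t : R) : R := pos3 t ^+ n.+2 + eps * t.
Definition chi1 n (eps t : R) : R := (3 * n + 6)%:R * (pos3 t ^+ n * Num.max 0 t ^+ 5) + eps.
Definition chi2 n (t : R) : R := (3 * n + 6)%:R * (3 * n + 5)%:R * (pos3 t ^+ n * Num.max 0 t ^+ 4).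

(** Stated as a chain rule on jets so that it passes to the reflected function [- f (- s)], used for
    the supersolution. *)
Definition chain2 (f : R -> R) t a b := forall (g : 'rV[R]_N -> R) x l q, g x = t ->
  jet g x l q -> jet (fun y => f (g y)) x (fun d => a * l d) (fun d => a * q d + b * l d ^+ 2).

Lemma chain2_chi n eps t : chain2 (chi n eps) t (chi1 n eps t) (chi2 n t).
Proof.
move=> g x l q gx jg; have j3 := jet_comp jg (jet1_pos3 (g x)).
have jn := jetD (jet_exp n j3) (jetZ eps jg).
have k6 : (3 * n + 6)%:R = 3 * n%:R + 6 :> R by rewrite natrD natrM.
have k5 : (3 * n + 5)%:R = 3 * n%:R + 5 :> R by rewrite natrD natrM.
have n2 : n.+2%:R = n%:R + 2 :> R by rewrite -addn2 natrD.
have n1 : n.+1%:R = n%:R + 1 :> R by rewrite -addn1 natrD.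
apply: eq_jet jn => d //; rewrite gx /chi1 /chi2 ?k6 ?k5 ?n2 ?n1 exprS /pos3;
  set m := Num.max 0 t; set Z := (m ^+ 3) ^+ n; ring.
Qed.

Lemma chain2N (f : R -> R) t a b : chain2 f (- t) a b -> chain2 (fun s => - f (- s)) t a (- b).
Proof.
move=> fc g x l q gx jg.
have := fc (fun y => -1 * g y) x _ _ _ (jetZ (-1) jg); rewrite gx mulN1r => /(_ erefl) /(jetZ (-1)).
apply: eq_jet => d; rewrite ?mulN1r; ring.
Qed.

Lemma jet_quadratic (h : R) (l q : 'rV[R]_N -> R) : is_lf l -> is_qf q ->
  jet (fun d => h + l d + 2^-1 * q d) 0 l q.
Proof.
move=> il iq; split => // k k0; have [c cE] := il; have [Q _ QE] := iq.
near=> d; rewrite add0r cE !QE qf0r (cE 0) dot0r mulr0 !addr0.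
have -> : h + dot c d + 2^-1 * qf Q d - h - dot c d - 2^-1 * qf Q d = 0 by ring.
by rewrite normr0 mulr_ge0 ?sq_ge0// ltW.
Unshelve. all: by end_near.
Qed.

(** The quadratic model for [h] is chosen so that [f] of it dominates the superjet of [f (h y)];
    strict monotonicity then removes [f]. The term [ka] absorbs the remainder of the chain rule. *)
Lemma superjet_untransform (f : R -> R) (v : 'rV[R]_N -> R) (be c0 a b ka : R) y0 x P X
    (h := fun y => v y - be * dot (y - y0) (y - y0) + c0) :
  (forall s t, s < t -> f s < f t) -> 0 < a -> chain2 f (h x) a b -> 0 < ka ->
  superjet (fun y => f (h y)) x P X ->
  superjet v x (a^-1 *: P + (2 * be) *: (x - y0))
    (a^-1 *: X - (b / a ^+ 3) *: (P^T *m P) + (2 * be + ka)%:M).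
Proof.
move=> fmono a0 fc ka0 [XT sj]; split.
  by rewrite !linearD /= linearN /= !linearZ /= XT trmx_mul trmxK tr_scalar_mx.
pose l d := a^-1 * dot P d.
pose q d := a^-1 * qf X d + (- (b / a ^+ 3) * (dot P d * dot P d) + ka * dot d d).
have il : is_lf l by apply: is_lfZ; exists P.
have iq : is_qf q.
  apply: is_qfD; first by apply: is_qfZ; exists X.
  apply: is_qfD; apply: is_qfZ; last exact: is_qf_sq.
  by apply: is_qf_lf; exists P.
have jq := jet_quadratic (h x) il iq.
have [|_ _ o] := fc _ 0 l q _ jq; first by have [c cE] := il; have [Q _ QE] := iq; rewrite cE QE qf0r dot0r mulr0 !addr0.
have k0 : 0 < a * ka / 2 by rewrite divr_gt0// mulr_gt0.
near=> d.
have sjd : f (h (x + d)) <= f (h x) + dot P d + 2^-1 * qf X d by near: d.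
have : h (x + d) <= h x + l d + 2^-1 * q d.
  rewrite leNgt; apply/negP => /fmono; rewrite ltNge => /negP; apply; apply: le_trans sjd _.
  have : `|f (h x + l (0 + d) + 2^-1 * q (0 + d)) - f (h x + l 0 + 2^-1 * q 0) - a * l d -
      2^-1 * (a * q d + b * l d ^+ 2)| <= a * ka / 2 * dot d d by near: d; exact: o.
  have [c cE] := il; have [Q _ QE] := iq; rewrite add0r (cE 0) (QE 0) qf0r dot0r mulr0 !addr0.
  rewrite ler_norml => /andP[h1 _].
  have e1 : a * l d = dot P d by rewrite /l mulrA mulfV ?gt_eqF// mul1r.
  have e2 : a * q d + b * l d ^+ 2 = qf X d + a * ka * dot d d by rewrite /q /l; field; rewrite gt_eqF.
  by rewrite e1 e2 in h1; lra.
rewrite /h /l /q; have -> : x + d - y0 = (x - y0) + d by rewrite addrAC.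
move: (x - y0) => z; rewrite !qfD qfN !qfZ qf_scalar qf_outer !dotDl !dotDr !dotZl (dotC d z); lra.
Unshelve. all: by end_near.
Qed.

(** Besides the inequality for [v], the second derivative [b] contributes
    [b * qf (curvmx p) (a^-1 *: P)]; for [chi] this is the gain of the Lipschitz estimate. *)
Lemma transform_trace (f : R -> R) (v : 'rV[R]_N -> R) (be c0 a b m : R) y0 x P X
    (h := fun y => v y - be * dot (y - y0) (y - y0) + c0) (p := a^-1 *: P + (2 * be) *: (x - y0)) :
  (forall s t, s < t -> f s < f t) -> 0 < a -> chain2 f (h x) a b ->
  (forall Y, superjet v x p Y -> m <= \tr (curvmx p *m Y)) ->
  superjet (fun y => f (h y)) x P X ->
  a * m + b * qf (curvmx p) (a^-1 *: P) - 2 * be * a * \tr (curvmx p) <= \tr (curvmx p *m X).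
Proof.
move=> fmono a0 fc visc sj; apply/ler_addgt0Pr => ep ep0.
pose ka := ep / (a * (N%:R + 1)).
have aN : 0 < a * (N%:R + 1) by rewrite mulr_gt0// ltr_wpDl.
have ka0 : 0 < ka by rewrite divr_gt0.
have := visc _ (superjet_untransform fmono a0 fc ka0 sj).
rewrite -/p mulmxDr mxtraceD mulmxBr linearB /= -!scalemxAr !mxtraceZ tr_mul_outer mul_mx_scalar mxtraceZ => h1.
have := ler_wpM2l (ltW a0) h1.
have := mxtrace_curvmx_le p; set T := \tr (curvmx p); set Z := \tr (_ *m X) => TN.
have kT : a * (ka * T) <= ep.
  have -> : ep = a * (ka * (N%:R + 1)) by rewrite /ka; field; rewrite !gt_eqF// ltr_wpDl.
  by rewrite ler_pM2l// ler_pM2l//; lra.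
have -> : a * (a^-1 * Z - b / a ^+ 3 * qf (curvmx p) P + (2 * be + ka) * T) =
  Z - b * qf (curvmx p) (a^-1 *: P) + 2 * be * a * T + a * (ka * T).
  by rewrite qfZr; field; rewrite gt_eqF.
lra.
Qed.

Lemma continuous_dot (T : topologicalType) (F G : T -> 'rV[R]_N) (t : T) :
  {for t, continuous F} -> {for t, continuous G} -> {for t, continuous (fun s => dot (F s) (G s))}.
Proof. by move=> hF hG; exact: (@cvg_dot R N _ (nbhs t) F G _ _ (nbhs_filter t) hF hG). Qed.

Lemma superjet_bound_transform (f d1 d2 : R -> R) (v G : 'rV[R]_N -> R) (Omega : set 'rV[R]_N)
    (ep be c0 : R) y0 x0 P0 (h := fun y => v y - be * dot (y - y0) (y - y0) + c0)
    (p := (d1 (h x0))^-1 *: P0 + (2 * be) *: (x0 - y0)) :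
  open Omega -> Omega x0 -> {for x0, continuous G} -> 0 < ep ->
  (forall s t, ep * `|s - t| <= `|f s - f t|) -> (forall s t, s < t -> f s < f t) ->
  continuous d1 -> continuous d2 -> (forall t, 0 < d1 t) -> (forall t, chain2 f t (d1 t) (d2 t)) ->
  (forall x r Y, Omega x -> superjet v x r Y -> slope r * G x <= \tr (curvmx r *m Y)) ->
  superjet_bound (fun y => f (h y)) x0 P0 (curvmx p)
    (d1 (h x0) * (slope p * G x0) + d2 (h x0) * qf (curvmx p) ((d1 (h x0))^-1 *: P0) -
       2 * be * d1 (h x0) * \tr (curvmx p)).
Proof.
move=> Oo Ox cG ep0 growth fmono c1 c2 d10 fc visc.
pose sl (t : T3) := (d1 t.1.2)^-1 *: t.2 + (2 * be) *: (t.1.1 - y0).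
pose r (t : T3) := (d1 t.1.2)^-1 *: t.2.
pose cc (t : T3) := d1 t.1.2 * (slope (sl t) * G t.1.1) +
  d2 t.1.2 * (dot (r t) (r t) - dot (r t) (sl t) ^+ 2 * (1 + dot (sl t) (sl t))^-1) -
  2 * be * d1 t.1.2 * (N%:R - dot (sl t) (sl t) * (1 + dot (sl t) (sl t))^-1).
have ccE t : cc t = d1 t.1.2 * (slope (sl t) * G t.1.1) + d2 t.1.2 * qf (curvmx (sl t)) (r t) -
    2 * be * d1 t.1.2 * \tr (curvmx (sl t)).
  rewrite /cc; congr (_ + _ * _ - _ * _).
    by rewrite /qf mulmx_curvmx dotDl dotNl dotZl (dotC (sl t)); ring.
  by have := tr_curvmx (sl t) 1%:M; rewrite mulmx1 mxtrace1 qf_scalar mul1r.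
pose pt : T3 := (x0, h x0, P0).
have k1 : continuous (fun t : T3 => t.1) by move=> t; exact: cvg_fst.
have k2 : {for pt, continuous (fun t : T3 => t.2)} by exact: cvg_snd.
have k11 : {for pt, continuous (fun t : T3 => t.1.1)}.
  by apply: (@continuous_comp _ _ _ (fun t : T3 => t.1) fst); [exact: k1|exact: cvg_fst].
have k12 : {for pt, continuous (fun t : T3 => t.1.2)}.
  by apply: (@continuous_comp _ _ _ (fun t : T3 => t.1) snd); [exact: k1|exact: cvg_snd].
have kd1 : {for pt, continuous (fun t : T3 => d1 t.1.2)}.
  by apply: (@continuous_comp _ _ _ (fun t : T3 => t.1.2) d1); [exact: k12|exact: c1].
have kd2 : {for pt, continuous (fun t : T3 => d2 t.1.2)}.
  by apply: (@continuous_comp _ _ _ (fun t : T3 => t.1.2) d2); [exact: k12|exact: c2].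
have kG : {for pt, continuous (fun t : T3 => G t.1.1)}.
  by apply: (@continuous_comp _ _ _ (fun t : T3 => t.1.1) G); [exact: k11|exact: cG].
have kr : {for pt, continuous r}.
  apply: (@continuousZ _ _ _ (fun t : T3 => (d1 t.1.2)^-1) (fun t => t.2)); last exact: k2.
  by apply: (@continuousV _ _ (fun t : T3 => d1 t.1.2)); [rewrite gt_eqF|exact: kd1].
have ksl : {for pt, continuous sl}.
  apply: (@continuousD _ _ _ r (fun t : T3 => (2 * be) *: (t.1.1 - y0))); first exact: kr.
  apply: (@continuousZ _ _ _ (fun _ : T3 => 2 * be) (fun t => t.1.1 - y0)); first exact: cst_continuous.
  by apply: (@continuousB _ _ _ (fun t : T3 => t.1.1) (fun _ => y0)); [exact: k11|exact: cst_continuous].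
have kss : {for pt, continuous (fun t : T3 => (1 + dot (sl t) (sl t))^-1)}.
  apply: (@continuousV _ _ (fun t : T3 => 1 + dot (sl t) (sl t))).
    by rewrite gt_eqF// ltr_pwDl ?sq_ge0.
  apply: (@continuousD _ _ _ (fun _ : T3 => 1 : R) (fun t => dot (sl t) (sl t))); first exact: cst_continuous.
  exact: continuous_dot.
have kcc : {for pt, continuous cc}.
  apply: (@continuousB _ _ _ (fun t : T3 => d1 t.1.2 * (slope (sl t) * G t.1.1) +
      d2 t.1.2 * (dot (r t) (r t) - dot (r t) (sl t) ^+ 2 * (1 + dot (sl t) (sl t))^-1))
    (fun t => 2 * be * d1 t.1.2 * (N%:R - dot (sl t) (sl t) * (1 + dot (sl t) (sl t))^-1))).
    apply: (@continuousD _ _ _ (fun t : T3 => d1 t.1.2 * (slope (sl t) * G t.1.1)) (fun t : T3 =>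
      d2 t.1.2 * (dot (r t) (r t) - dot (r t) (sl t) ^+ 2 * (1 + dot (sl t) (sl t))^-1))).
      apply: (@continuousM _ _ (fun t : T3 => d1 t.1.2) (fun t => slope (sl t) * G t.1.1)); first exact: kd1.
      apply: (@continuousM _ _ (fun t : T3 => slope (sl t)) (fun t => G t.1.1)); last exact: kG.
      by apply: (@continuous_comp _ _ _ sl (@slope R N)); [exact: ksl|exact: cts_slope].
    apply: (@continuousM _ _ (fun t : T3 => d2 t.1.2)
      (fun t => dot (r t) (r t) - dot (r t) (sl t) ^+ 2 * (1 + dot (sl t) (sl t))^-1)); first exact: kd2.
    apply: (@continuousB _ _ _ (fun t : T3 => dot (r t) (r t))
      (fun t => dot (r t) (sl t) ^+ 2 * (1 + dot (sl t) (sl t))^-1)); first exact: continuous_dot.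
    apply: (@continuousM _ _ (fun t : T3 => dot (r t) (sl t) ^+ 2)
      (fun t => (1 + dot (sl t) (sl t))^-1)); last exact: kss.
    apply: (@continuous_comp _ _ _ (fun t : T3 => dot (r t) (sl t)) (fun s : R => s ^+ 2)).
      exact: continuous_dot.
    exact: exprn_continuous.
  apply: (@continuousM _ _ (fun t : T3 => 2 * be * d1 t.1.2)
    (fun t => N%:R - dot (sl t) (sl t) * (1 + dot (sl t) (sl t))^-1)).
    by apply: (@continuousM _ _ (fun _ : T3 => 2 * be) (fun t => d1 t.1.2)); [exact: cst_continuous|exact: kd1].
  apply: (@continuousB _ _ _ (fun _ : T3 => N%:R : R) (fun t => dot (sl t) (sl t) * (1 + dot (sl t) (sl t))^-1)).
    exact: cst_continuous.
  apply: (@continuousM _ _ (fun t : T3 => dot (sl t) (sl t)) (fun t => (1 + dot (sl t) (sl t))^-1)); last exact: kss.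
  exact: continuous_dot.
have bound : \forall t \near pt, forall X, h t.1.1 = t.1.2 -> superjet (fun y => f (h y)) t.1.1 t.2 X ->
    cc t <= \tr (curvmx (sl t) *m X).
  exists (Omega `*` setT, setT) => /=.
    split; last exact: filterT.
    exists (Omega, setT) => //=; split; [exact: open_nbhs_nbhs|exact: filterT].
  move=> t [[Ot _] _] X ht sj; rewrite ccE -ht.
  have slE : sl t = (d1 (h t.1.1))^-1 *: t.2 + (2 * be) *: (t.1.1 - y0) by rewrite /sl ht.
  rewrite /r slE -ht; apply: transform_trace sj => // Y; exact: visc.
have := superjet_bound_curvmx ep0 (fun x => growth _ _) ksl kcc bound.
by rewrite ccE.
Qed.

Lemma pos3_ge0 t : 0 <= pos3 t. Proof. by rewrite exprn_ge0// le_max lexx. Qed.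

Lemma pos3_homo : {homo pos3 : s t / s <= t}.
Proof.
move=> s t st; have mm : Num.max 0 s <= Num.max 0 t by rewrite ge_max !le_max lexx st orbT.
by rewrite lerXn2r// nnegrE le_max lexx.
Qed.

Lemma chi_growth n (ep s t : R) : s <= t -> ep * (t - s) <= chi n ep t - chi n ep s.
Proof.
move=> st; have : pos3 s ^+ n.+2 <= pos3 t ^+ n.+2.
  by rewrite lerXn2r ?nnegrE ?pos3_ge0//; exact: pos3_homo.
rewrite /chi; lra.
Qed.

Lemma chi_growth_norm n (ep s t : R) : 0 < ep -> ep * `|s - t| <= `|chi n ep s - chi n ep t|.
Proof.
move=> ep0; wlog st : s t / s <= t => [hw|].
  by case: (leP s t) => [/hw//|/ltW/hw]; rewrite distrC [X in _ <= X]distrC.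
rewrite distrC [leRHS]distrC ger0_norm ?subr_ge0//.
by apply: le_trans (ler_norm _); exact: chi_growth.
Qed.

Lemma chi_lt n (ep s t : R) : 0 < ep -> s < t -> chi n ep s < chi n ep t.
Proof.
move=> ep0 st; rewrite -subr_gt0; apply: lt_le_trans (chi_growth n ep (ltW st)).
by rewrite mulr_gt0// subr_gt0.
Qed.

Lemma chi1_gt0 n (ep t : R) : 0 < ep -> 0 < chi1 n ep t.
Proof. by move=> ep0; rewrite ltr_wpDl// mulr_ge0// mulr_ge0// exprn_ge0 ?pos3_ge0// le_max lexx. Qed.

Lemma continuous_pow_pos3 n m : continuous (fun t : R => pos3 t ^+ n * Num.max 0 t ^+ m).
Proof.
have cx i : continuous (fun t : R => Num.max 0 t ^+ i).
  move=> t; apply: (@continuous_comp _ _ _ (fun t : R => Num.max 0 t) (fun s : R => s ^+ i)).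
    exact: continuous_maxr0.
  exact: exprn_continuous.
move=> t; apply: (@continuousM _ _ (fun t : R => pos3 t ^+ n) (fun t => Num.max 0 t ^+ m)); last exact: cx.
apply: (@continuous_comp _ _ _ pos3 (fun s : R => s ^+ n)); [exact: cx|exact: exprn_continuous].
Qed.

Lemma continuous_chi1 n ep : continuous (chi1 n ep).
Proof.
move=> t; apply: (@continuousD _ _ _ (fun t : R => (3 * n + 6)%:R * (pos3 t ^+ n * Num.max 0 t ^+ 5)) (fun _ => ep)).
  apply: (@continuousM _ _ (fun _ : R => (3 * n + 6)%:R) (fun t => pos3 t ^+ n * Num.max 0 t ^+ 5)).
    exact: cst_continuous.
  exact: continuous_pow_pos3.
exact: cst_continuous.
Qed.

Lemma continuous_chi2 n : continuous (chi2 n).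
Proof.
move=> t.
apply: (@continuousM _ _ (fun _ : R => (3 * n + 6)%:R * (3 * n + 5)%:R) (fun t => pos3 t ^+ n * Num.max 0 t ^+ 4)).
  exact: cst_continuous.
exact: continuous_pow_pos3.
Qed.

End Transform.

(** * The inequality at a touching pair for the Lipschitz estimate *)

Section LipschitzTouching.
Variables (R : realType) (N : nat).
Implicit Types (x y z p q w e : 'rV[R]_N) (X : 'M[R]_N).

(* [(sqrt s + j)^2] as a function of the square of [s]; the concave term [2 j sqrt s]
   makes the second derivative along the segment very negative for small [s]. *)
Definition psi (j t : R) : R := (Num.sqrt (Num.sqrt t) + j) ^+ 2.

Lemma jet_psi (j sg : R) z e : 0 < sg -> dot z z = sg ^+ 4 -> z = sg ^+ 2 *: e ->
  jet (fun y => psi j (dot y y)) z (fun w => (1 + j / sg) * dot e w)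
    (fun w => (1 + j / sg) / sg ^+ 2 * (dot w w - dot e w ^+ 2) - j / (2 * sg ^+ 3) * dot e w ^+ 2).
Proof.
move=> sg0 zz ze; have z0 : 0 < dot (z - 0) (z - 0) by rewrite subr0 zz exprn_gt0.
have r2 : Num.sqrt (dot (z - 0) (z - 0)) = sg ^+ 2.
  by rewrite subr0 zz (exprM sg 2 2) sqrtr_sqr ger0_norm// sqr_ge0.
have j1 := jet_comp (jet_sq 0 z) (jet1_sqrt z0); rewrite r2 in j1.
have z1 : 0 < Num.sqrt (dot (z - 0) (z - 0)) by rewrite r2 exprn_gt0.
have r1 : Num.sqrt (Num.sqrt (dot (z - 0) (z - 0))) = sg.
  by rewrite r2 sqrtr_sqr gtr0_norm.
have j2 := jet_comp j1 (jet1_sqrt z1); rewrite r1 in j2.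
have j3 := jetD j2 (jet_cst j z).
have := jet_comp j3 (jet1_sq _).
apply: eq_jet => w; rewrite /= ?subr0 //; have zw : dot z w = sg ^+ 2 * dot e w by rewrite {1}ze dotZl.
- by rewrite subr0 in r1; rewrite r1 zw; field; rewrite gt_eqF.
- by rewrite subr0 in r1; rewrite r1 zw; field; rewrite gt_eqF.
Qed.

Lemma qf_curvmx_diff p q : qf (curvmx p) (p - q) =
  (slope p * slope q - 1 - dot p q) * (slope p * slope q + 1 + dot p q) / slope p ^+ 2.
Proof.
have s0 := slope_gt0 p.
have pp : dot p p = slope p ^+ 2 - 1 by rewrite slope_sq; ring.
have qq : dot q q = slope q ^+ 2 - 1 by rewrite slope_sq; ring.
rewrite /qf mulmx_curvmx -slope_sq !dotE (dotC q p) pp qq; field; by rewrite gt_eqF.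
Qed.

Lemma tilt_dirZ p q : tilt_dir p q =
  (slope p / (slope p * slope q + 1 + dot p q)) *: ((slope p)^-1 *: p + (slope q)^-1 *: q).
Proof.
have a0 := slope_gt0 p; have c0 := slope_gt0 q; have D0 := slope_sum_ge p q.
apply/rowP => i; rewrite !mxE; field; rewrite !gt_eqF//; lra.
Qed.

Variables (Omega : set 'rV[R]_N) (H u v : 'rV[R]_N -> R).
Hypotheses (Oo : open Omega) (Hc : forall x, Omega x -> {for x, continuous H}).
Hypotheses (u_super : viscosity_supersolution Omega H u)
  (v_sub : viscosity_subsolution Omega H v).

(** The theorem on sums for [chi (hv x)] and [- chi (hu y)]. The penalty depends on [y - x] only, so
    its Hessian enters through the tilt direction alone, weighted by the squared tangent of half the
    angle between the normals. *)
Lemma lip_touching n (ep be c0 tau j sg r : R) y0 x1 y1 e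
    (hv := fun y => v y - be * dot (y - y0) (y - y0) + c0)
    (hu := fun y => u y - be * dot (y - y0) (y - y0) + c0)
    (f := chi1 n ep (hv x1)) (g := chi1 n ep (hu y1)) (al := (1 + j / sg) / tau)
    (P := - (al *: e)) :
  (0 < N)%N -> 0 < ep -> 0 < tau -> 0 < sg -> 0 < r ->
  Omega x1 -> Omega y1 -> dot (y1 - x1) (y1 - x1) = sg ^+ 4 -> y1 - x1 = sg ^+ 2 *: e ->
  lsc_within [set x | dot (x - x1) (x - x1) <= r] (fun x => - chi n ep (hv x)) ->
  lsc_within [set x | dot (x - y1) (x - y1) <= r] (fun x => chi n ep (hu x)) ->
  (\forall w \near (0 : 'rV[R]_(N + N)),
    tau * (chi n ep (hv (x1 + lsubmx w)) - chi n ep (hu (y1 + rsubmx w))) <=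
    tau * (chi n ep (hv x1) - chi n ep (hu y1)) +
    psi j (dot (y1 - x1 + (rsubmx w - lsubmx w)) (y1 - x1 + (rsubmx w - lsubmx w))) -
    psi j (dot (y1 - x1) (y1 - x1))) ->
  exists p q, let wd := (slope p)^-1 *: p + (slope q)^-1 *: q in
  [/\ P = f *: (p - (2 * be) *: (x1 - y0)), P = g *: (q - (2 * be) *: (y1 - y0)) &
    (f * (slope p * (N%:R * H x1)) + chi2 n (hv x1) * qf (curvmx p) (p - (2 * be) *: (x1 - y0)) -
       2 * be * f * \tr (curvmx p)) -
    (g * (slope q * (N%:R * H y1)) + chi2 n (hu y1) * qf (curvmx q) (q - (2 * be) *: (y1 - y0)) -
       2 * be * g * \tr (curvmx q)) <=
    tau^-1 * ((slope p * slope q - 1 - dot p q) / (slope p * slope q + 1 + dot p q)) *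
      ((1 + j / sg) / sg ^+ 2 * (dot wd wd - dot e wd ^+ 2) - j / (2 * sg ^+ 3) * dot e wd ^+ 2)].
Proof.
move=> N0 ep0 tau0 sg0 r0 Ox Oy zz ze lv lu near.
have f0 : 0 < f by exact: chi1_gt0.
have g0 : 0 < g by exact: chi1_gt0.
pose p := f^-1 *: P + (2 * be) *: (x1 - y0).
pose q := g^-1 *: P + (2 * be) *: (y1 - y0).
have pE : p - (2 * be) *: (x1 - y0) = f^-1 *: P by rewrite addrK.
have qE : q - (2 * be) *: (y1 - y0) = g^-1 *: P by rewrite addrK.
exists p, q => wd; rewrite pE qE; split.
- by rewrite scalerA mulfV ?scale1r ?gt_eqF.
- by rewrite scalerA mulfV ?scale1r ?gt_eqF.
have visc_v x r' Y : Omega x -> superjet v x r' Y -> slope r' * (N%:R * H x) <= \tr (curvmx r' *m Y).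
  by move=> Ox' sj; exact: viscosity_sub_jet v_sub Ox' sj.
have visc_u x r' Y : Omega x -> superjet (fun y => - u y) x r' Y ->
    slope r' * - (N%:R * H x) <= \tr (curvmx r' *m Y).
  move=> Ox' /superjetN/(viscosity_super_jet u_super Ox').
  by rewrite curvmxN -/(slope _) slopeN mulmxN linearN /= mulrN lerNl.
have cG : {for x1, continuous (fun x => N%:R * H x)}.
  by apply: (@continuousM _ _ (fun _ => N%:R) H); [exact: cst_continuous|exact: Hc].
have cG' : {for y1, continuous (fun x => - (N%:R * H x))}.
  apply: (@continuousN _ _ _ (fun x => N%:R * H x)).
  by apply: (@continuousM _ _ (fun _ => N%:R) H); [exact: cst_continuous|exact: Hc].
have bV := @superjet_bound_transform R N (chi n ep) (chi1 n ep) (chi2 n) v (fun x => N%:R * H x) Omega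
  ep be c0 y0 x1 P Oo Ox cG ep0 (fun s t => chi_growth_norm n s t ep0) (fun s t => @chi_lt R n ep s t ep0)
  (@continuous_chi1 R n ep) (@continuous_chi2 R n) (fun t => chi1_gt0 n t ep0) (fun t => @chain2_chi R N n ep t) visc_v.
rewrite -/(hv x1) -/f -/p in bV.
pose cW := - (g * (slope q * (N%:R * H y1)) + chi2 n (hu y1) * qf (curvmx q) (g^-1 *: P) -
       2 * be * g * \tr (curvmx q)).
have bW : superjet_bound (fun y => - chi n ep (hu y)) y1 (- P) (curvmx q) cW.
  (* Writes the supersolution side as a subsolution: signs of the paraboloid and of the constant are
     reversed, and [chi] is reflected. *)
  pose hm y := - u y - (- be) * dot (y - y0) (y - y0) + - c0.
  have hmE y : - hm y = hu y by rewrite /hm /hu; ring.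
  have cN : continuous (fun s : R => - s) by move=> s; exact: opp_continuous.
  have ch1 : continuous (fun s : R => chi1 n ep (- s)).
    by move=> s; apply: (@continuous_comp _ _ _ (fun s : R => - s) (chi1 n ep)); [exact: cN|exact: continuous_chi1].
  have ch2 : continuous (fun s : R => - chi2 n (- s)).
    move=> s; apply: (@continuousN _ _ _ (fun s : R => chi2 n (- s))).
    by apply: (@continuous_comp _ _ _ (fun s : R => - s) (chi2 n)); [exact: cN|exact: continuous_chi2].
  have gr s t : ep * `|s - t| <= `|- chi n ep (- s) - - chi n ep (- t)|.
    rewrite -opprD normrN; have -> : s - t = - (- s - - t) by ring.
    rewrite normrN; exact: chi_growth_norm.
  have mo s t : s < t -> - chi n ep (- s) < - chi n ep (- t) by move=> st; rewrite ltrN2 chi_lt// ltrN2.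
  have B := @superjet_bound_transform R N (fun s => - chi n ep (- s)) (fun s => chi1 n ep (- s)) (fun s => - chi2 n (- s))
    (fun y => - u y) (fun x => - (N%:R * H x)) Omega ep (- be) (- c0) y0 y1 (- P) Oo Oy cG' ep0 gr mo ch1 ch2
    (fun t => chi1_gt0 n (- t) ep0) (fun t => chain2N (@chain2_chi R N n ep (- t))) visc_u.
  rewrite -/(hm y1) hmE -/g in B.
  have qN : g^-1 *: - P + (2 * - be) *: (y1 - y0) = - q by rewrite /q opprD scalerN mulrN scaleNr.
  rewrite qN curvmxN slopeN scalerN qfNr in B.
  have -> : (fun y => - chi n ep (hu y)) = (fun y => - chi n ep (- hm y)) by apply/funext => y; rewrite hmE.
  have -> : cW = g * (slope q * - (N%:R * H y1)) + - chi2 n (hu y1) * qf (curvmx q) (g^-1 *: P) -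
      2 * - be * g * \tr (curvmx q) by rewrite /cW; ring.
  exact: B.
pose M : 'M[R]_(N + N, N) := col_mx (- 1%:M) 1%:M.
have ME m (w : 'M[R]_(m, N + N)) : w *m M = rsubmx w - lsubmx w.
  by rewrite -{1}[w]hsubmxK mul_row_col mulmx1 mulmxN mulmx1 addrC.
pose qs (w : 'rV[R]_N) : R := (1 + j / sg) / sg ^+ 2 * (dot w w - dot e w ^+ 2) - j / (2 * sg ^+ 3) * dot e w ^+ 2.
have [_ iq o] : jet (fun w : 'rV[R]_(N + N) => psi j (dot (y1 - x1 + w *m M) (y1 - x1 + w *m M))) 0
    (fun w : 'rV[R]_(N + N) => (1 + j / sg) * dot e (w *m M)) (fun w : 'rV[R]_(N + N) => qs (w *m M)).
  exact: jet_mulmx M (jet_psi j sg0 zz ze).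
have iQ : is_qf (fun w : 'rV[R]_(N + N) => tau^-1 * qs (w *m M)) by exact: is_qfZ.
have lu' : lsc_within [set x | dot (x - y1) (x - y1) <= r] (fun x => - - chi n ep (hu x)).
  move=> x hx a; rewrite opprK => /(lu x hx) h.
  by apply: (@filterS _ _ (nbhs_filter x) _ _ _ h) => y {}h /h; rewrite opprK.
have touch : forall k : R, 0 < k -> \forall w \near (0 : 'rV[R]_(N + N)),
     chi n ep (hv (x1 + lsubmx w)) + - chi n ep (hu (y1 + rsubmx w)) <= chi n ep (hv x1) + - chi n ep (hu y1) +
       (dot P (lsubmx w) + dot (- P) (rsubmx w)) + 2^-1 * (tau^-1 * qs (w *m M)) + k * dot w w.
  move=> k k0; have h := @filterI _ _ (nbhs_filter (0 : 'rV[R]_(N + N))) _ _ (o (tau * k) (mulr_gt0 tau0 k0)) near.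
  apply: (@filterS _ (nbhs (0 : 'rV[R]_(N + N))) (nbhs_filter _) _ _ _ h) => w [] {h}.
  rewrite !mul0mx !addr0 !add0r ME ler_norml => /andP[_ h1] h2.
  rewrite -(ler_pM2l tau0).
  have -> : dot P (lsubmx w) + dot (- P) (rsubmx w) = al * dot e (rsubmx w - lsubmx w).
    by rewrite /P !dotDr !dotNl !dotNr !dotZl; ring.
  have e1 : tau * (al * dot e (rsubmx w - lsubmx w)) = (1 + j / sg) * dot e (rsubmx w - lsubmx w).
    by rewrite /al; field; rewrite !gt_eqF.
  have e2 : tau * (tau^-1 * qs (rsubmx w - lsubmx w)) = qs (rsubmx w - lsubmx w) by rewrite mulrA mulfV ?gt_eqF// mul1r.
  lra.
have [es [es1 es2 es3]] := sum_superjets_frames N0 iQ r0 lv lu' bV bW touch.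
move: es3; rewrite /cW => /le_trans; apply.
pose D := slope p * slope q + 1 + dot p q.
have D0 : 0 < D by apply: lt_le_trans (slope_sum_ge p q).
have a0 := slope_gt0 p.
have qsZ k w : qs (k *: w) = k ^+ 2 * qs w by rewrite /qs !dotZl !dotZr; ring.
have term i : tau^-1 * qs (row_mx (es i) (es i + dot (es i) (p - q) *: tilt_dir p q) *m M) =
    dot (es i) (p - q) * dot (es i) (p - q) * (tau^-1 * ((slope p / D) ^+ 2 * qs wd)).
  rewrite ME row_mxKl row_mxKr (addrC (es i)) addrK qsZ tilt_dirZ -/wd -/D qsZ; ring.
rewrite (eq_bigr _ (fun i _ => term i)) -mulr_suml es1 -/(qf _ _) qf_curvmx_diff -/D.
rewrite le_eqVlt; apply/orP; left; apply/eqP; rewrite -/(qs wd); move: (qs wd) => z.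
clear term; clearbody D; by field; rewrite !gt_eqF.
Qed.

End LipschitzTouching.

(** * Numerical inequalities for the Lipschitz estimate *)

Section LipschitzNumerics.
Variable R : realType.
Implicit Types (a b x y f g nu al tau j sg : R).

(** With [a] and [b] the values of [pos3 ^+ n], the three gaps are, up to constants and [eps], those
    of the second, first and zeroth derivatives of [chi]. All are measured against the gap [D] of
    second derivatives, the unit of the gain. *)
Lemma power_gaps a b x y (D := a * x ^+ 4 - b * y ^+ 4) : 0 <= b -> b <= a -> 0 <= y -> y <= x ->
  [/\ 0 <= D, 0 <= a * x ^+ 5 - b * y ^+ 5, a * x ^+ 6 - b * y ^+ 6 <= 2 * x ^+ 2 * D,
      a * x ^+ 5 - b * y ^+ 5 <= 2 * x * D &
      x * (a * x ^+ 5 - b * y ^+ 5) <= a * x ^+ 6 - b * y ^+ 6].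
Proof.
move=> b0 ba y0 yx; have x0 : 0 <= x by exact: le_trans yx.
have pw i : b * y ^+ i <= a * x ^+ i by apply: ler_pM; rewrite ?exprn_ge0// lerXn2r.
have D1 : b * (x ^+ 4 - y ^+ 4) <= D.
  rewrite mulrBr lerD2r; apply: ler_wpM2r => //; exact: exprn_ge0.
have xy : 0 <= x - y by rewrite subr_ge0.
have bm i k : 0 <= b * (x ^+ i * y ^+ k * (x - y)) by rewrite mulr_ge0 ?mulr_ge0 ?exprn_ge0.
split.
- by rewrite subr_ge0.
- by rewrite subr_ge0.
- have h1 := ler_wpM2l (sqr_ge0 x) D1.
  have -> : a * x ^+ 6 - b * y ^+ 6 = x ^+ 2 * D + b * y ^+ 4 * (x ^+ 2 - y ^+ 2) by rewrite /D; ring.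
  have h2 : 0 <= b * (x ^+ 2 - y ^+ 2) * (x ^+ 2 * (x ^+ 2 + y ^+ 2) - y ^+ 4).
    have uw : y ^+ 2 <= x ^+ 2 by rewrite lerXn2r.
    have -> : x ^+ 2 * (x ^+ 2 + y ^+ 2) - y ^+ 4 = (x ^+ 2 - y ^+ 2) * (x ^+ 2 + y ^+ 2) + x ^+ 2 * y ^+ 2 by ring.
    have e2 : 0 <= x ^+ 2 - y ^+ 2 by rewrite subr_ge0.
    exact: mulr_ge0 (mulr_ge0 b0 e2) (addr_ge0 (mulr_ge0 e2 (addr_ge0 (sqr_ge0 x) (sqr_ge0 y)))
      (mulr_ge0 (sqr_ge0 x) (sqr_ge0 y))).
  lra.
- have h1 := ler_wpM2l x0 D1.
  have -> : a * x ^+ 5 - b * y ^+ 5 = x * D + b * y ^+ 4 * (x - y) by rewrite /D; ring.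
  have h2 : 0 <= b * (x - y) * (x * (x ^+ 3 + x ^+ 2 * y + x * y ^+ 2) + (x - y) * y ^+ 3).
    apply: mulr_ge0; first exact: mulr_ge0.
    apply: addr_ge0; last by rewrite mulr_ge0// exprn_ge0.
    apply: mulr_ge0 => //; apply: addr_ge0; last by rewrite mulr_ge0// exprn_ge0.
    by apply: addr_ge0; rewrite ?mulr_ge0 ?exprn_ge0.
  lra.
- rewrite mulrBr; have := bm 0 5; rewrite expr0; lra.
Qed.

(** If [sg <= j], the concave term [j / (2 * sg ^+ 3)] along [e] outweighs the transverse curvature
    and the right side is nonpositive. Otherwise the last hypothesis trades one factor [f * nu] for
    [sg ^+ 2 / tau], cancelling the singular [sg ^+ 2]. *)
Lemma rhs_bound tau j sg f nu al bb Fm C2 K perp along :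
  0 < tau -> tau <= 1 -> 0 < j -> 0 < sg -> 0 <= f -> f <= Fm -> 0 <= nu -> 0 <= bb -> 0 <= C2 ->
  al = (1 + j / sg) / tau -> 16 * Fm * (1 + bb) <= al -> 0 <= K -> K <= 2 * nu ^+ 2 / al ^+ 2 ->
  perp <= (4 * bb * f / al) ^+ 2 -> 1 <= along ->
  (j < sg -> f * nu <= C2 / tau * sg ^+ 2) ->
  tau^-1 * K * ((1 + j / sg) / sg ^+ 2 * perp - j / (2 * sg ^+ 3) * along) <= 32 * bb ^+ 2 * C2 * Fm * tau * nu.
Proof.
move=> tau0 tau1 j0 sg0 f0 fF nu0 bb0 C20 alE alF K0 KK pp al1 C2E.
have Fm0 : 0 <= Fm by exact: le_trans fF.
have js : 0 < j / sg by exact: divr_gt0.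
have al0 : 0 < al by rewrite alE divr_gt0//; lra.
have ti : 0 < tau^-1 by rewrite invr_gt0.
have rhs0 : 0 <= 32 * bb ^+ 2 * C2 * Fm * tau * nu by rewrite !mulr_ge0 ?sqr_ge0// ltW.
have s2 : 0 < sg ^+ 2 by rewrite exprn_gt0.
have s3 : 0 < 2 * sg ^+ 3 by rewrite mulr_gt0// exprn_gt0.
have ps0 : 0 <= (1 + j / sg) / sg ^+ 2 by rewrite divr_ge0 ?(ltW s2)//; lra.
have [sj|sj] := leP sg j.
  apply: le_trans rhs0; apply: mulr_ge0_le0; first by rewrite mulr_ge0// ltW.
  have q0 : 0 <= 4 * bb * f / al <= 4^-1.
    rewrite divr_ge0 ?mulr_ge0 ?(ltW al0)//= ler_pdivrMr//.
    have := ler_wpM2l bb0 fF; have := mulr_ge0 bb0 Fm0; lra.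
  have p16 : perp <= 16^-1.
    apply: le_trans pp _; case/andP: q0 => q1 q2.
    apply: (@le_trans _ _ (4^-1 ^+ 2)); first by rewrite lerXn2r ?nnegrE//; lra.
    lra.
  have h1 : (1 + j / sg) / sg ^+ 2 * 4^-1 <= j / (2 * sg ^+ 3).
    have -> : j / (2 * sg ^+ 3) = (2 * (j / sg)) / sg ^+ 2 * 4^-1 by field; rewrite gt_eqF.
    apply: ler_wpM2r => //; apply: ler_wpM2r; first by rewrite invr_ge0 ltW.
    have : 1 <= j / sg by rewrite ler_pdivlMr// mul1r.
    lra.
  have jj : 0 <= j / (2 * sg ^+ 3) by rewrite divr_ge0// ltW.
  have := ler_wpM2l ps0 p16; have := ler_wpM2l jj al1; lra.
have {}C2E := C2E sj.
have along0 : 0 <= j / (2 * sg ^+ 3) * along by rewrite mulr_ge0 ?divr_ge0 ?(ltW s3) ?(ltW j0)//; lra.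
apply: (@le_trans _ _ (tau^-1 * K * ((1 + j / sg) / sg ^+ 2 * (4 * bb * f / al) ^+ 2))).
  apply: ler_wpM2l; first by rewrite mulr_ge0// ltW.
  have := ler_wpM2l ps0 pp; lra.
apply: (@le_trans _ _ (tau^-1 * (2 * nu ^+ 2 / al ^+ 2) * ((1 + j / sg) / sg ^+ 2 * (4 * bb * f / al) ^+ 2))).
  apply: ler_wpM2r; first by rewrite mulr_ge0// sqr_ge0.
  by apply: ler_wpM2l => //; exact: ltW.
have -> : tau^-1 * (2 * nu ^+ 2 / al ^+ 2) * ((1 + j / sg) / sg ^+ 2 * (4 * bb * f / al) ^+ 2) =
    32 * bb ^+ 2 * (f * nu) * (f * nu) / sg ^+ 2 * ((1 + j / sg) / tau / al ^+ 4).
  by field; rewrite !gt_eqF.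
rewrite -alE.
have a3 : al / al ^+ 4 <= tau ^+ 3.
  have -> : al / al ^+ 4 = al^-1 ^+ 3 by field; rewrite gt_eqF.
  rewrite lerXn2r ?nnegrE ?invr_ge0 ?(ltW al0) ?(ltW tau0)//.
  rewrite -[leRHS]invrK lef_pV2 ?posrE ?invr_gt0// alE -[leLHS]mul1r ler_wpM2r ?(ltW ti)//; lra.
have fn0 : 0 <= f * nu by exact: mulr_ge0.
have b20 := sqr_ge0 bb.
have a30 : 0 <= al / al ^+ 4 by rewrite divr_ge0 ?exprn_ge0 ?(ltW al0).
have fnF : f * nu <= Fm * nu by exact: ler_wpM2r.
have h1 : f * nu / sg ^+ 2 <= C2 / tau by rewrite ler_pdivrMr.
have -> : 32 * bb ^+ 2 * (f * nu) * (f * nu) / sg ^+ 2 * (al / al ^+ 4) =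
  32 * bb ^+ 2 * ((f * nu) * (f * nu / sg ^+ 2) * (al / al ^+ 4)) by ring.
have -> : 32 * bb ^+ 2 * C2 * Fm * tau * nu = 32 * bb ^+ 2 * ((Fm * nu) * (C2 / tau) * (tau ^+ 2)).
  by field; rewrite gt_eqF.
apply: ler_wpM2l; first by rewrite mulr_ge0.
have C2t : 0 <= C2 / tau by rewrite divr_ge0// ltW.
apply: ler_pM => //.
- by rewrite mulr_ge0// divr_ge0// ltW.
- by apply: ler_pM => //; rewrite divr_ge0// ltW.
- by apply: le_trans a3 _; rewrite exprS ler_piMl// sqr_ge0.
Qed.

(* The gain [K6 K5 D / 2] is quadratic in the exponent of [chi], all the losses are
   at most linear in it up to terms that are small with [tau]. *)
Lemma gain_beats_losses (NN LH bb be hm K6 K5 Hm Fm C2 tau D s f g nu om de lE lF AX AY Tp Tq Hx Hy ax by4 rhs : R)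
    (C5 := 2 * (1 + bb) * K6 * hm) (C6 := 8 * be * Fm * hm ^+ 2) (C7 := C5 + C6)
    (C8 := K6 * K5 * Hm * (4 * (1 + bb) ^+ 2) * (2 * C7 + 8 * be * hm ^+ 2))
    (C9 := NN * LH * C6 + C8 + 8 * be * Fm * C7 + 32 * bb ^+ 2 * C2 * Fm * C7) :
  0 <= NN -> 0 <= LH -> 0 <= bb -> 0 <= be -> 0 <= hm -> 1 < K6 -> 0 <= K5 -> 0 <= Hm -> 0 <= Fm -> 0 <= C2 ->
  0 < tau -> tau <= 1 -> C9 * tau <= 1 ->
  NN * LH * (2 * (1 + bb) * hm) + 4 * be * NN * hm + 8 * NN * LH * hm ^+ 2 + 1 <= K5 / 2 ->
  0 < D -> D = ax - by4 -> 0 <= by4 -> by4 <= Hm ->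
  0 <= g -> g <= f -> f <= Fm -> f - g <= 2 * K6 * hm * D ->
  0 <= nu -> nu <= (1 + bb) * (f - g) + Fm * de -> de = 2 * be * s -> 0 <= s -> s <= 4 * hm ^+ 2 * tau * D ->
  0 <= om -> om <= 2 * tau * nu -> 0 <= lF -> lF * s <= 8 * hm ^+ 2 * D -> `|lE - lF| <= nu ->
  1 / 2 <= AX -> `|AX - AY| <= 4 * (1 + bb) ^+ 2 * (om + de) -> Tp <= NN -> `|Tp - Tq| <= 2 * om ->
  `|Hx| <= LH -> `|Hy - Hx| <= LH * s -> rhs <= 32 * bb ^+ 2 * C2 * Fm * tau * nu ->
  (NN * (lE * Hx) + K6 * K5 * ax * AX - 2 * be * f * Tp) -
    (NN * (lF * Hy) + K6 * K5 * by4 * AY - 2 * be * g * Tq) <= rhs ->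
  False.
Proof.
move=> NN0 LH0 bb0 be0 hm0 K61 K50 Hm0 Fm0 C20 tau0 tau1 C9t hn D0 DE by0 byH g0 gf fF fgD
  nu0 nuE deE s0 sD om0 omE lF0 lFs lEF AX2 AXY TpN Tpq HxL HxyL rhsE ineq.
have K60 : 0 <= K6 by lra.
have t0 := ltW tau0; have D0' := ltW D0.
have b1 : 0 <= 1 + bb by lra.
have deD : Fm * de <= C6 * tau * D.
  have -> : C6 * tau * D = Fm * (2 * be) * (4 * hm ^+ 2 * tau * D) by rewrite /C6; ring.
  by rewrite deE mulrA; apply: ler_wpM2l => //; rewrite mulr_ge0// mulr_ge0.
have de_D : de <= 8 * be * hm ^+ 2 * (tau * D).
  have -> : 8 * be * hm ^+ 2 * (tau * D) = 2 * be * (4 * hm ^+ 2 * tau * D) by ring.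
  by rewrite deE; apply: ler_wpM2l => //; rewrite mulr_ge0.
have nuD : nu <= (C5 + C6 * tau) * D.
  have -> : (C5 + C6 * tau) * D = (1 + bb) * (2 * K6 * hm * D) + C6 * tau * D by rewrite /C5; ring.
  by apply: le_trans nuE _; apply: lerD => //; exact: ler_wpM2l.
have C50 : 0 <= C5 by rewrite !mulr_ge0.
have C60 : 0 <= C6 by rewrite !mulr_ge0 ?sqr_ge0.
have C70 : 0 <= C7 by exact: addr_ge0.
have nu7 : nu <= C7 * D.
  apply: le_trans nuD _; apply: ler_wpM2r => //; rewrite /C7 lerD2l ler_piMr//.
have tD0 : 0 <= tau * D by exact: mulr_ge0.
have om7 : om <= 2 * C7 * (tau * D).
  have := ler_wpM2l t0 nu7; lra.
have rhs7 : rhs <= 32 * bb ^+ 2 * C2 * Fm * C7 * (tau * D).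
  apply: le_trans rhsE _.
  have -> : 32 * bb ^+ 2 * C2 * Fm * C7 * (tau * D) = 32 * bb ^+ 2 * C2 * Fm * tau * (C7 * D) by ring.
  by apply: ler_wpM2l => //; rewrite !mulr_ge0 ?sqr_ge0.
have Hpart : - (NN * LH * ((C5 + C6 * tau) * D + 8 * hm ^+ 2 * D)) <= NN * (lE * Hx) - NN * (lF * Hy).
  have -> : NN * (lE * Hx) - NN * (lF * Hy) = - (NN * (- (lE - lF) * Hx + lF * (Hy - Hx))) by ring.
  rewrite lerN2 -mulrA; apply: ler_wpM2l => //; rewrite [leRHS]mulrDr; apply: lerD.
    apply: le_trans (ler_norm _) _; rewrite normrM normrN mulrC; apply: ler_pM => //.
    exact: le_trans lEF nuD.
  apply: (@le_trans _ _ (lF * (LH * s))).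
    by apply: ler_wpM2l => //; apply: le_trans (ler_norm _) _.
  by rewrite mulrCA; apply: ler_wpM2l.
have Apart : K6 * K5 * D / 2 - C8 * (tau * D) <= K6 * K5 * ax * AX - K6 * K5 * by4 * AY.
  have -> : K6 * K5 * ax * AX - K6 * K5 * by4 * AY = K6 * K5 * (D * AX - by4 * (AY - AX)) by rewrite DE; ring.
  have -> : K6 * K5 * D / 2 - C8 * (tau * D) =
    K6 * K5 * (D / 2 - Hm * (4 * (1 + bb) ^+ 2 * (2 * C7 * (tau * D) + 8 * be * hm ^+ 2 * (tau * D)))) by rewrite /C8; ring.
  apply: ler_wpM2l; first exact: mulr_ge0.
  apply: lerB; first by rewrite mulrC [leRHS]mulrC; apply: ler_wpM2r => //; rewrite -div1r.
  apply: (@le_trans _ _ (by4 * (4 * (1 + bb) ^+ 2 * (om + de)))).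
    apply: ler_wpM2l => //; apply: le_trans (ler_norm _) _; rewrite distrC; exact: AXY.
  have de0 : 0 <= de by rewrite deE mulr_ge0// mulr_ge0.
  have b20 : 0 <= 4 * (1 + bb) ^+ 2 by rewrite mulr_ge0// sqr_ge0.
  apply: ler_pM => //; first by rewrite mulr_ge0// addr_ge0.
  by apply: ler_wpM2l => //; exact: lerD.
have Tpart : 2 * be * f * Tp - 2 * be * g * Tq <= 2 * be * (NN * (2 * K6 * hm * D)) + 8 * be * Fm * C7 * (tau * D).
  have -> : 2 * be * f * Tp - 2 * be * g * Tq = 2 * be * ((f - g) * Tp + g * (Tp - Tq)) by ring.
  have -> : 2 * be * (NN * (2 * K6 * hm * D)) + 8 * be * Fm * C7 * (tau * D) =
    2 * be * (NN * (2 * K6 * hm * D) + Fm * (2 * (2 * C7 * (tau * D)))) by ring.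
  apply: ler_wpM2l; first by rewrite mulr_ge0.
  apply: lerD.
    have fg0 : 0 <= f - g by lra.
    by rewrite mulrC; apply: le_trans (ler_wpM2r fg0 TpN) _; apply: ler_wpM2l.
  have h1 : Tp - Tq <= 2 * (2 * C7 * (tau * D)).
    by apply: le_trans (ler_norm _) _; apply: le_trans Tpq _; rewrite ler_pM2l.
  apply: le_trans (ler_wpM2l g0 h1) _; apply: ler_wpM2r; last exact: le_trans fF.
  by rewrite !mulr_ge0.
have NL0 : 0 <= NN * LH * hm ^+ 2 by rewrite !mulr_ge0 ?sqr_ge0.
(* Every loss is now a multiple of [D], or of [tau * D] with total constant [C9]; dividing by [D]
   contradicts [hn]. *)
have fin : K6 * K5 * D / 2 <= (K6 * (NN * LH * (2 * (1 + bb) * hm) + 4 * be * NN * hm) + 8 * NN * LH * hm ^+ 2 + C9 * tau) * D.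
  have -> : (K6 * (NN * LH * (2 * (1 + bb) * hm) + 4 * be * NN * hm) + 8 * NN * LH * hm ^+ 2 + C9 * tau) * D =
    NN * LH * ((C5 + C6 * tau) * D + 8 * hm ^+ 2 * D) + C8 * (tau * D) +
    (2 * be * (NN * (2 * K6 * hm * D)) + 8 * be * Fm * C7 * (tau * D)) + 32 * bb ^+ 2 * C2 * Fm * C7 * (tau * D).
    by rewrite /C9 {1}/C5; ring.
  lra.
move: fin; have -> : K6 * K5 * D / 2 = K6 * (K5 / 2) * D by ring.
rewrite ler_pM2r// => fin.
have := ler_wpM2l K60 hn; have K61' : 0 <= K6 - 1 by lra.
have := mulr_ge0 K61' NL0; lra.
Qed.

End LipschitzNumerics.

(** * No touching pair at positive distance *)

Section NoTouching.
Variables (R : realType) (N : nat) (Omega : set 'rV[R]_N) (H u v : 'rV[R]_N -> R).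

Definition chi_bound n (hm : R) : R := (hm ^+ 3) ^+ n * hm ^+ 4.
Definition chi1_bound n (hm : R) : R := (3 * n + 6)%:R * (chi_bound n hm * hm) + 1.
(** The constant [C2] of [rhs_bound], that is, of the bound on [f * nu] by [sg ^+ 2 / tau]. *)
Definition cross_bound n (hm bb be : R) : R :=
  (1 + bb) * (12 * ((3 * n + 6)%:R ^+ 2 * chi_bound n hm) + 1) + 2 * be * chi1_bound n hm ^+ 2.
(** The constant [C9] of [gain_beats_losses] for the actual bounds: the total of the losses that
    carry a factor [tau]. *)
Definition small_loss n (NN LH bb be hm : R) : R :=
  let K6 := (3 * n + 6)%:R in let K5 := (3 * n + 5)%:R in
  let Fm := chi1_bound n hm in
  let C6 := 8 * be * Fm * hm ^+ 2 in let C7 := 2 * (1 + bb) * K6 * hm + C6 in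
  NN * LH * C6 + K6 * K5 * chi_bound n hm * (4 * (1 + bb) ^+ 2) * (2 * C7 + 8 * be * hm ^+ 2) +
  8 * be * Fm * C7 + 32 * bb ^+ 2 * cross_bound n hm bb be * Fm * C7.

Lemma chi_boundP n (hm x : R) : 0 <= x -> x <= hm -> pos3 x ^+ n * Num.max 0 x ^+ 4 <= chi_bound n hm.
Proof.
move=> x0 xh; have h0 : 0 <= hm by exact: le_trans xh.
rewrite /pos3 max_r//; apply: ler_pM; rewrite ?exprn_ge0//; rewrite !lerXn2r ?nnegrE ?exprn_ge0//.
Qed.

(** At such a pair [lip_touching] contradicts [gain_beats_losses]. The lower bound on [VU] expresses
    that the pair violates the estimate at [tau]; the upper bound expresses that a weaker estimate
    is already available. *)
Lemma lip_no_touch n (ep be bb c0 rd hm LH tau j sg r : R) y0 x1 y1 e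
    (hv := fun y => v y - be * dot (y - y0) (y - y0) + c0)
    (hu := fun y => u y - be * dot (y - y0) (y - y0) + c0)
    (VU := chi n ep (hv x1) - chi n ep (hu y1)) (Fm := chi1_bound n hm) :
  open Omega -> (forall x, Omega x -> {for x, continuous H}) ->
  viscosity_supersolution Omega H u -> viscosity_subsolution Omega H v ->
  (0 < N)%N -> 0 <= LH -> 0 <= be -> 1 <= hm -> 2 * be * rd <= bb ->
  N%:R * LH * (2 * (1 + bb) * hm) + 4 * be * N%:R * hm + 8 * N%:R * LH * hm ^+ 2 + 1 <= (3 * n + 5)%:R / 2 ->
  0 < tau -> tau <= 1 -> 16 * Fm * (1 + bb) * tau <= 1 -> small_loss n N%:R LH bb be hm * tau <= 1 ->
  0 < j -> 0 < ep -> ep <= 1 -> ep * Fm <= j ^+ 2 -> 0 < sg -> 0 < r ->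
  Omega x1 -> Omega y1 -> nrm (x1 - y0) <= rd -> nrm (y1 - y0) <= rd ->
  `|H x1| <= LH -> `|H y1 - H x1| <= LH * sg ^+ 2 ->
  0 <= hv x1 -> hv x1 <= hm -> (sg + j) ^+ 2 / tau <= VU -> VU <= 3 * ((sg + j) ^+ 2 / tau) ->
  ep * (hv x1 - hu y1) <= VU / 2 ->
  dot (y1 - x1) (y1 - x1) = sg ^+ 4 -> y1 - x1 = sg ^+ 2 *: e ->
  lsc_within [set x | dot (x - x1) (x - x1) <= r] (fun x => - chi n ep (hv x)) ->
  lsc_within [set x | dot (x - y1) (x - y1) <= r] (fun x => chi n ep (hu x)) ->
  (\forall w \near (0 : 'rV[R]_(N + N)),
    tau * (chi n ep (hv (x1 + lsubmx w)) - chi n ep (hu (y1 + rsubmx w))) <=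
    tau * (chi n ep (hv x1) - chi n ep (hu y1)) +
    psi j (dot (y1 - x1 + (rsubmx w - lsubmx w)) (y1 - x1 + (rsubmx w - lsubmx w))) -
    psi j (dot (y1 - x1) (y1 - x1))) ->
  False.
Proof.
move=> Oo Hc us vs N0 LH0 be0 hm1 bbE hn tau0 tau1 tauF tauC j0 ep0 ep1 epF sg0 r0 Ox Oy xr yr Hx Hxy
  hv0 hvm VU1 VU2 epVU zz ze lv lu near.
have [p [q [Pp Pq ineq]]] := lip_touching Oo Hc us vs N0 ep0 tau0 sg0 r0 Ox Oy zz ze lv lu near.
rewrite -/(hv x1) -/(hu y1) in Pp Pq ineq.
set f := chi1 n ep (hv x1) in Pp ineq; set g := chi1 n ep (hu y1) in Pq ineq.
set al := (1 + j / sg) / tau in Pp Pq.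
set Bx := (2 * be) *: (x1 - y0) in Pp ineq; set By := (2 * be) *: (y1 - y0) in Pq ineq.
set x := Num.max 0 (hv x1); set y := Num.max 0 (hu y1).
set a := pos3 (hv x1) ^+ n; set b := pos3 (hu y1) ^+ n.
set K6 : R := (3 * n + 6)%:R; set K5 : R := (3 * n + 5)%:R in hn.
have s2 : 0 < sg ^+ 2 by rewrite exprn_gt0.
have s40 : 0 < sg ^+ 4 by rewrite exprn_gt0.
have e1 : dot e e = 1.
  have h := zz; rewrite ze dotZl dotZr in h.
  have : sg ^+ 4 * dot e e = sg ^+ 4 * 1 by rewrite mulr1 -[RHS]h; ring.
  by move/(mulfI _); apply; rewrite gt_eqF.
have VU0 : 0 < VU by apply: lt_le_trans VU1; rewrite divr_gt0// exprn_gt0// addr_gt0.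
have huv : hu y1 <= hv x1.
  rewrite leNgt; apply/negP => /(chi_lt n ep0) h.
  by move: VU0; rewrite /VU subr_gt0 ltNge (ltW h).
have xE : x = hv x1 by rewrite /x max_r.
have y0' : 0 <= y by rewrite le_max lexx.
have yx : y <= x by rewrite ge_max !le_max lexx huv orbT.
have b0 : 0 <= b by rewrite exprn_ge0// pos3_ge0.
have ba : b <= a by rewrite lerXn2r ?nnegrE ?pos3_ge0//; exact: pos3_homo.
have [D0 G50 P6 P5 P56] := power_gaps b0 ba y0' yx.
set D := a * x ^+ 4 - b * y ^+ 4 in D0 P6 P5.
have fE : f = K6 * (a * x ^+ 5) + ep by [].
have gE : g = K6 * (b * y ^+ 5) + ep by [].
have K60 : 1 < K6 by rewrite ltr1n !addnS.
have aH : a * x ^+ 4 <= chi_bound n hm by exact: chi_boundP.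
have Hm0 : 0 <= chi_bound n hm by rewrite mulr_ge0 ?exprn_ge0//; lra.
have x0 : 0 <= x by rewrite xE.
have xh : x <= hm by rewrite xE.
have a0 : 0 <= a by exact: le_trans ba.
have f_F : f <= Fm.
  rewrite fE; apply: lerD => //; apply: ler_wpM2l; first lra.
  rewrite exprSr mulrA; apply: ler_pM => //; by rewrite mulr_ge0 ?exprn_ge0.
have g0 : 0 < g by exact: chi1_gt0.
have gf : g <= f by rewrite fE gE; have := ler_wpM2l (ltW (lt_trans ltr01 K60)) G50; lra.
have al_t : tau^-1 <= al.
  by rewrite /al -[leLHS]mul1r; apply: ler_wpM2r; rewrite ?invr_ge0 ?(ltW tau0)// lerDl divr_ge0// ltW.
have alF : 16 * Fm * (1 + bb) <= al by apply: le_trans al_t; rewrite -div1r ler_pdivlMr.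
have nB (z : 'rV[R]_N) : nrm z <= rd -> nrm ((2 * be) *: z) <= bb.
  move=> h; apply: le_trans bbE; rewrite nrmZ ger0_norm ?mulr_ge0//; apply: ler_wpM2l => //; exact: mulr_ge0.
have Bxb := nB _ xr; have Byb := nB _ yr; rewrite -/Bx in Bxb; rewrite -/By in Byb.
have PE : - (al *: e) = - (al *: e) by [].
have deE : nrm (Bx - By) = 2 * be * sg ^+ 2.
  rewrite /Bx /By -scalerBr; have -> : x1 - y0 - (y1 - y0) = - (y1 - x1) by apply/rowP => i; rewrite !mxE; ring.
  have ne : nrm e = 1 by rewrite /nrm e1 sqrtr1.
  by rewrite ze nrmZ nrmN nrmZ ne mulr1 !ger0_norm ?mulr_ge0// ltW.
have [l1 l2] := andP (length_boundsF e1 PE g0 gf f_F Pq Bxb Byb alF).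
have lEF := length_diff g0 gf f_F Pp Pq Bxb.
have Kge := defect_ratio_ge0 p q.
have Kle := defect_ratio_le e1 PE g0 gf f_F Pp Pq Bxb Byb alF.
have perp := tilt_perp_le e1 PE g0 gf f_F Pp Pq Bxb Byb alF.
have along := tilt_along_ge e1 PE g0 gf f_F Pp Pq Bxb Byb alF.
have AX := gain_ge e1 PE g0 gf f_F Pp Bxb alF.
have AXY := gain_diff e1 PE g0 gf f_F Pp Pq Bxb Byb alF.
have Tpq := trace_diff e1 PE g0 gf f_F Pp Pq Bxb Byb alF.
have TpN := mxtrace_curvmx_le p.
rewrite deE in lEF Kle AXY Tpq.
set de := 2 * be * sg ^+ 2 in lEF Kle AXY Tpq.
set nu := (1 + bb) * (f - g) + Fm * de in lEF Kle AXY Tpq.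
set om := 2 * nu / al in AXY Tpq.
have bb0 : 0 <= bb by exact: le_trans (nrm_ge0 Bx) Bxb.
have Fm0 : 0 <= Fm by apply: le_trans f_F; apply: le_trans gf; exact: ltW.
have de0 : 0 <= de := mulr_ge0 (mulr_ge0 (ler0n R 2) be0) (ltW s2).
have fg0 : 0 <= f - g by rewrite subr_ge0.
have nu0 : 0 <= nu by rewrite addr_ge0// mulr_ge0// addr_ge0.
have al0 : 0 < al by apply: lt_le_trans al_t; rewrite invr_gt0.
have om0 : 0 <= om := divr_ge0 (mulr_ge0 (ler0n R 2) nu0) (ltW al0).
have ial : al^-1 <= tau by rewrite -[leRHS]invrK lef_pV2 ?posrE ?invr_gt0.
have omE : om <= 2 * tau * nu.
  have -> : 2 * tau * nu = 2 * nu * tau by ring.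
  by apply: ler_wpM2l => //; exact: mulr_ge0.
(* The linear part of [chi] accounts for at most half of [VU], so the gap of powers, and with it
   [D], controls [VU]. *)
have VUle : VU <= 4 * hm ^+ 2 * D.
  have VE : VU = a * x ^+ 6 - b * y ^+ 6 + ep * (hv x1 - hu y1).
    have powE t : pos3 t ^+ n.+2 = pos3 t ^+ n * Num.max 0 t ^+ 6 by rewrite !exprSr /pos3; ring.
    by rewrite /VU /chi !powE -/x -/y -/a -/b; ring.
  have h2 : VU <= 4 * (x ^+ 2 * D) by move: VE epVU P6; lra.
  apply: le_trans h2 _; rewrite -mulrA ler_pM2l//; apply: ler_wpM2r => //; rewrite lerXn2r ?nnegrE//; lra.
have Dp : 0 < D.
  rewrite lt_def D0 andbT; apply/eqP => D00; move: (lt_le_trans VU0 VUle); by rewrite D00 mulr0 ltxx.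
have sj2 : sg ^+ 2 + j * sg <= (sg + j) ^+ 2 by rewrite sqrrD -addrA lerD2l mulr2n (mulrC sg) -addrA lerDl addr_ge0 ?sqr_ge0// mulr_ge0 ?ltW.
have js0 : 0 <= j * sg by rewrite mulr_ge0// ltW.
have VUt : (sg + j) ^+ 2 <= VU * tau by rewrite -ler_pdivrMr.
have sD : sg ^+ 2 <= 4 * hm ^+ 2 * tau * D.
  have := ler_wpM2r (ltW tau0) VUle; lra.
have lFs : g * slope q * sg ^+ 2 <= 8 * hm ^+ 2 * D.
  have h1 : g * slope q <= 2 * al.
    have : 0 <= Fm * bb by exact: mulr_ge0.
    lra.
  have h2 : al * sg ^+ 2 = (sg ^+ 2 + j * sg) / tau by rewrite /al; field; rewrite !gt_eqF.
  have h3 : al * sg ^+ 2 <= VU by rewrite h2; apply: le_trans VU1; apply: ler_wpM2r => //; rewrite invr_ge0 ltW.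
  have := ler_wpM2r (ltW s2) h1; lra.
have C20 : 0 <= cross_bound n hm bb be.
  exact: addr_ge0 (mulr_ge0 (addr_ge0 ler01 bb0) (addr_ge0 (mulr_ge0 (ler0n R 12) (mulr_ge0 (sqr_ge0 K6) Hm0)) ler01))
    (mulr_ge0 (mulr_ge0 (ler0n R 2) be0) (sqr_ge0 Fm)).
have fgE : f - g = K6 * (a * x ^+ 5 - b * y ^+ 5) by rewrite fE gE; ring.
have fgD : f - g <= 2 * K6 * hm * D.
  have -> : 2 * K6 * hm * D = K6 * (2 * hm * D) by ring.
  rewrite fgE; apply: ler_wpM2l; first lra.
  by apply: le_trans P5 _; apply: ler_wpM2r => //; exact: ler_wpM2l.
have f0 : 0 <= f by apply: le_trans gf; exact: ltW.
(* The only place for the upper bound on [VU]: it bounds [f * (f - g)] by a multiple of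
   [sg ^+ 2 / tau], the linear part of [chi] being at most [j ^+ 2]. *)
have C2E : j < sg -> f * nu <= cross_bound n hm bb be / tau * sg ^+ 2.
  move=> jsg.
  have tt : sg ^+ 2 <= sg ^+ 2 / tau by rewrite ler_pdivlMr// ler_piMr// ltW.
  have h1 : x * (a * x ^+ 5 - b * y ^+ 5) <= 12 * (sg ^+ 2 / tau).
    apply: (@le_trans _ _ VU).
      apply: le_trans P56 _; have := mulr_ge0 (ltW ep0) (_ : 0 <= hv x1 - hu y1); rewrite subr_ge0 => /(_ huv) h.
      have powE t : pos3 t ^+ n.+2 = pos3 t ^+ n * Num.max 0 t ^+ 6 by rewrite !exprSr /pos3; ring.
      by rewrite /VU /chi !powE -/x -/y -/a -/b; lra.
    apply: le_trans VU2 _; have -> : 12 * (sg ^+ 2 / tau) = 3 * ((sg + sg) ^+ 2 / tau) by ring.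
    rewrite ler_pM2l//; apply: ler_wpM2r; first by rewrite invr_ge0 ltW.
    rewrite lerXn2r ?nnegrE ?addr_ge0 ?(ltW sg0) ?(ltW j0)// lerD2l; exact: ltW.
  have h2 : f * (f - g) <= (12 * (K6 ^+ 2 * chi_bound n hm) + 1) * (sg ^+ 2 / tau).
    rewrite {1}fE mulrDl [leRHS]mulrDl mul1r; apply: lerD.
      rewrite fgE.
      have -> : K6 * (a * x ^+ 5) * (K6 * (a * x ^+ 5 - b * y ^+ 5)) =
        K6 ^+ 2 * ((a * x ^+ 4) * (x * (a * x ^+ 5 - b * y ^+ 5))) by ring.
      have -> : 12 * (K6 ^+ 2 * chi_bound n hm) * (sg ^+ 2 / tau) = K6 ^+ 2 * (chi_bound n hm * (12 * (sg ^+ 2 / tau))) by ring.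
      apply: ler_wpM2l; first exact: sqr_ge0.
      by apply: ler_pM => //; rewrite ?mulr_ge0 ?exprn_ge0.
    apply: le_trans tt; apply: (@le_trans _ _ (ep * Fm)).
      by apply: ler_wpM2l; [exact: ltW|lra].
    apply: le_trans epF _; rewrite lerXn2r ?nnegrE ?(ltW sg0) ?(ltW j0)//; exact: ltW.
  have h3 : f * (Fm * de) <= 2 * be * Fm ^+ 2 * (sg ^+ 2 / tau).
    have -> : 2 * be * Fm ^+ 2 * (sg ^+ 2 / tau) = Fm * (Fm * (2 * be * (sg ^+ 2 / tau))) by ring.
    apply: ler_pM => //; first exact: mulr_ge0.
    by apply: ler_wpM2l => //; apply: ler_wpM2l => //; exact: mulr_ge0.
  have -> : f * nu = (1 + bb) * (f * (f - g)) + f * (Fm * de) by rewrite /nu; ring.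
  have -> : cross_bound n hm bb be / tau * sg ^+ 2 =
    (1 + bb) * ((12 * (K6 ^+ 2 * chi_bound n hm) + 1) * (sg ^+ 2 / tau)) + 2 * be * Fm ^+ 2 * (sg ^+ 2 / tau).
    by rewrite /cross_bound -/K6 -/Fm; ring.
  by apply: lerD => //; apply: ler_wpM2l => //; exact: addr_ge0.
have rhsE := rhs_bound tau0 tau1 j0 sg0 f0 f_F nu0 bb0 C20 erefl alF Kge Kle perp along C2E.
have hm0 : 0 <= hm by lra.
have by0 : 0 <= b * y ^+ 4 by rewrite mulr_ge0// exprn_ge0.
have byH : b * y ^+ 4 <= chi_bound n hm by move: D0 aH; rewrite /D; lra.
have K50 : 0 <= K5 by [].
have lF0 : 0 <= g * slope q by rewrite mulr_ge0 ?ltW// slope_gt0.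
apply: (gain_beats_losses (ler0n R N) LH0 bb0 be0 hm0 K60 K50 Hm0 Fm0 C20 tau0 tau1 tauC hn Dp erefl by0 byH
  (ltW g0) gf f_F fgD nu0 (lexx nu) erefl (ltW s2) sD om0 omE lF0 lFs lEF AX AXY TpN Tpq Hx Hxy rhsE).
move: ineq; rewrite /chi2 -/x -/y -/a -/b -/K6 -/K5.
by apply: le_trans; rewrite le_eqVlt; apply/orP; left; apply/eqP; ring.
Qed.

End NoTouching.

(** * One doubling step of the Lipschitz estimate *)

Section PairLipschitz.
Variables (R : realType) (N : nat).
Implicit Types x y : 'rV[R]_N.

(** If the estimate held at [tau / 2] but failed at [tau], an extremal pair would have [VU] between
    once and three times the penalty over [tau], which [lip_no_touch] forbids. *)
Lemma good_step (Omega : set 'rV[R]_N) (H u v : 'rV[R]_N -> R) n (be bb c0 rd hm Ml LH tau j : R) y0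
    (D := [set x | dot (x - y0) (x - y0) <= rd ^+ 2])
    (hv := fun y => v y - be * dot (y - y0) (y - y0) + c0)
    (hu := fun y => u y - be * dot (y - y0) (y - y0) + c0) :
  open Omega -> (forall x, Omega x -> {for x, continuous H}) ->
  viscosity_supersolution Omega H u -> viscosity_subsolution Omega H v ->
  (0 < N)%N -> D `<=` Omega -> 0 < rd -> (forall x, D x -> v x <= u x) ->
  (forall x y, D x -> D y -> `|H x - H y| <= LH * nrm (x - y)) ->
  (forall x, D x -> `|H x| <= LH) -> 0 <= LH -> 0 <= be -> 1 <= hm -> 2 * be * rd <= bb ->
  N%:R * LH * (2 * (1 + bb) * hm) + 4 * be * N%:R * hm + 8 * N%:R * LH * hm ^+ 2 + 1 <= (3 * n + 5)%:R / 2 ->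
  0 <= Ml -> (forall x, D x -> - Ml <= hu x) -> (forall x, D x -> hv x <= hm) ->
  (forall x, D x -> 0 < hv x -> nrm (x - y0) <= rd / 2) ->
  0 < tau -> tau <= 1 -> 16 * chi1_bound n hm * (1 + bb) * tau <= 1 -> small_loss n N%:R LH bb be hm * tau <= 1 ->
  8 * (hm ^+ 3) ^+ n.+2 * tau <= rd -> 0 < j ->
  (forall x y, D x -> D y -> tau / 2 * (pos3 (hv x) ^+ n.+2 - pos3 (hu y) ^+ n.+2) <= psi j (dot (y - x) (y - x))) ->
  (forall x y, D x -> D y -> tau * (pos3 (hv x) ^+ n.+2 - pos3 (hu y) ^+ n.+2) <= psi j (dot (y - x) (y - x))).
Proof.
move=> Oo Hc us vs N0 DO rd0 vu Hlip Hbd LH0 be0 hm1 bbE hn Ml0 huM hvh hvr tau0 tau1 tauF tauC taur j0 good x' y' Dx' Dy'.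
rewrite leNgt; apply/negP => bad.
pose ga := tau * (pos3 (hv x') ^+ n.+2 - pos3 (hu y') ^+ n.+2) - psi j (dot (y' - x') (y' - x')).
have ga0 : 0 < ga by rewrite subr_gt0.
pose K' : R := `|hu y' - hv x'| + 1.
have K'0 : 0 < K' by rewrite ltr_wpDl.
have Fm1 : 0 < chi1_bound n hm.
  by rewrite ltr_wpDl// mulr_ge0// mulr_ge0 ?mulr_ge0 ?exprn_ge0//; lra.
have Mh0 : 0 < hm + Ml by lra.
have j20 : 0 < j ^+ 2 by rewrite exprn_gt0.
(* The linear part of [chi] must be negligible against [j ^+ 2], both in value and in its product
   with the derivative bound, and must not consume the violation [ga]. *)
pose ep : R := Num.min (Num.min 1 (j ^+ 2 / chi1_bound n hm)) (Num.min (j ^+ 2 / (2 * (hm + Ml))) (ga / K' / 2)).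
have ep0 : 0 < ep by rewrite !lt_min ltr01 !divr_gt0// mulr_gt0.
have : ep <= ep by [].
rewrite {2}/ep !le_min => /andP[/andP[ep1]]; rewrite ler_pdivlMr// => epF /andP[]; rewrite ler_pdivlMr ?mulr_gt0// => epM epK.
clearbody ep.
pose K2 : set ('rV[R]_N * 'rV[R]_N) := D `*` D.
pose J (t : 'rV[R]_N * 'rV[R]_N) : R := psi j (dot (t.2 - t.1) (t.2 - t.1)) +
  (tau * chi n ep (hu t.2) + tau * - chi n ep (hv t.1)).
have lu := lsc_on_within Oo DO us.1; have lv := usc_on_within Oo DO vs.1.
have c1 : continuous (fun t : 'rV[R]_N * 'rV[R]_N => t.1) by move=> t; exact: cvg_fst.
have c2 : continuous (fun t : 'rV[R]_N * 'rV[R]_N => t.2) by move=> t; exact: cvg_snd.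
have cq (k : R) : continuous (fun x : 'rV[R]_N => k * dot (x - y0) (x - y0)).
  move=> x; apply: (@continuousM _ _ (fun _ : 'rV[R]_N => k) (fun x => dot (x - y0) (x - y0))).
    exact: cst_continuous.
  apply: (@continuous_comp _ _ _ (fun x : 'rV[R]_N => x - y0) (fun x : 'rV[R]_N => dot x x)); last exact: cts_sq.
  by apply: (@continuousB _ _ _ (fun x : 'rV[R]_N => x) (fun _ => y0)); [exact: cvg_id|exact: cst_continuous].
have chim : {homo chi n ep : s t / s <= t}.
  by move=> s t st; rewrite -subr_ge0; apply: le_trans (chi_growth n ep st); rewrite mulr_ge0 ?(ltW ep0)// subr_ge0.
have cchi' : continuous (chi n ep).
  move=> t; apply: (@continuousD _ _ _ (fun t : R => pos3 t ^+ n.+2) (fun t => ep * t)).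
    have cp : continuous (fun t : R => pos3 t ^+ n.+2 * Num.max 0 t ^+ 0) by exact: continuous_pow_pos3.
    have -> : (fun t : R => pos3 t ^+ n.+2) = (fun t => pos3 t ^+ n.+2 * Num.max 0 t ^+ 0).
      by apply/funext => s; rewrite expr0 mulr1.
    exact: cp.
  by apply: (@continuousM _ _ (fun _ : R => ep) (fun t => t)); [exact: cst_continuous|exact: cvg_id].
have lhu : lsc_within D (fun x => chi n ep (hu x)).
  apply: (@lsc_within_mono _ _ _ hu) => //.
  have -> : hu = (fun x => u x + (- be * dot (x - y0) (x - y0) + c0)).
    by apply/funext => x; rewrite /hu; ring.
  apply: lsc_withinD => //; apply: lsc_within_cts => x _.
  by apply: (@continuousD _ _ _ (fun x : 'rV[R]_N => - be * dot (x - y0) (x - y0)) (fun _ => c0));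
    [exact: cq|exact: cst_continuous].
have lhv : lsc_within D (fun x => - chi n ep (hv x)).
  have -> : (fun x => - chi n ep (hv x)) = (fun x => - chi n ep (- (- v x + (be * dot (x - y0) (x - y0) - c0)))).
    by apply/funext => x; rewrite /hv; congr (- chi _ _ _); ring.
  apply: (@lsc_within_mono _ _ _ (fun x => - v x + (be * dot (x - y0) (x - y0) - c0)) (fun s : R => - chi n ep (- s))).
  - move=> s; apply: (@continuousN _ _ _ (fun s : R => chi n ep (- s))).
    by apply: (@continuous_comp _ _ _ (fun s : R => - s) (chi n ep)); [exact: opp_continuous|exact: cchi'].
  - by move=> s t st; rewrite lerN2; apply: chim; rewrite lerN2.
  apply: lsc_withinD => //; apply: lsc_within_cts => x _.
  by apply: (@continuousB _ _ _ (fun x : 'rV[R]_N => be * dot (x - y0) (x - y0)) (fun _ => c0));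
    [exact: cq|exact: cst_continuous].
have lscZ (T : topologicalType) (A : set T) (f : T -> R) : lsc_within A f -> lsc_within A (fun t => tau * f t).
  move=> lf; apply: (@lsc_within_mono _ _ _ f (fun s : R => tau * s)) => //.
    by move=> s; apply: (@continuousM _ _ (fun _ : R => tau) (fun t => t)); [exact: cst_continuous|exact: cvg_id].
  by move=> s t st; apply: ler_wpM2l => //; exact: ltW.
have [[x1 y1] /= [Dx1 Dy1] Jmin] : exists2 t, K2 t & forall t', K2 t' -> J t <= J t'.
  apply: compact_lsc_min; first by apply: compact_setX; exact: compact_sqball.
    by exists (x', y').
  apply: lsc_withinD.
    apply: lsc_within_cts => t _.
    apply: (@continuous_comp _ _ _ (fun t : 'rV[R]_N * 'rV[R]_N => dot (t.2 - t.1) (t.2 - t.1)) (psi j)).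
      apply: (@continuous_comp _ _ _ (fun t : 'rV[R]_N * 'rV[R]_N => t.2 - t.1) (fun x : 'rV[R]_N => dot x x)); last exact: cts_sq.
      by apply: (@continuousB _ _ _ (fun t : 'rV[R]_N * 'rV[R]_N => t.2) (fun t => t.1)); [exact: c2|exact: c1].
    apply: (@continuous_comp _ _ _ (fun s : R => Num.sqrt (Num.sqrt s) + j) (fun s : R => s ^+ 2)); last exact: exprn_continuous.
    apply: (@continuousD _ _ _ (fun s : R => Num.sqrt (Num.sqrt s)) (fun _ => j)); last exact: cst_continuous.
    by apply: (@continuous_comp _ _ _ Num.sqrt Num.sqrt); exact: sqrt_continuous.
  apply: lsc_withinD; apply: lscZ.
  - by apply: (@lsc_within_comp _ _ _ D K2 (fun x => chi n ep (hu x)) (fun t => t.2)) => // t [].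
  - by apply: (@lsc_within_comp _ _ _ D K2 (fun x => - chi n ep (hv x)) (fun t => t.1)) => // t [].
pose VU := chi n ep (hv x1) - chi n ep (hu y1).
pose ps := psi j (dot (y1 - x1) (y1 - x1)).
have Jneg : ps < tau * VU.
  have J0 : J (x', y') < 0.
    have -> : J (x', y') = - ga + tau * (ep * (hu y' - hv x')).
      by rewrite /J /ga /chi /=; ring.
    have h1 : tau * (ep * (hu y' - hv x')) <= ep * K'.
      apply: (@le_trans _ _ (ep * `|hu y' - hv x'|)).
        rewrite mulrCA; apply: ler_wpM2l; first exact: ltW.
        apply: (@le_trans _ _ (tau * `|hu y' - hv x'|)); last by rewrite ler_piMl.
        by apply: ler_wpM2l; [exact: ltW|exact: ler_norm].
      by apply: ler_wpM2l; [exact: ltW|rewrite lerDl].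
    have h2 : ep * K' <= ga / 2.
      have := ler_wpM2r (ltW K'0) epK; have -> : ga / K' / 2 * K' = ga / 2 by field; rewrite gt_eqF.
      by [].
    lra.
  by have := le_lt_trans (Jmin (x', y') (conj Dx' Dy')) J0; rewrite /J /= /ps /VU; lra.
have psE s : 0 <= s -> psi j (s ^+ 4) = (s + j) ^+ 2.
  move=> s0; rewrite /psi; have -> : s ^+ 4 = (s ^+ 2) ^+ 2 by rewrite -exprM.
  by rewrite sqrtr_sqr (ger0_norm (sqr_ge0 s)) sqrtr_sqr ger0_norm.
pose sg := Num.sqrt (Num.sqrt (dot (y1 - x1) (y1 - x1))).
have sg0' : 0 <= sg by exact: sqrtr_ge0.
have sg4 : dot (y1 - x1) (y1 - x1) = sg ^+ 4.
  by rewrite (exprM sg 2 2) !sqr_sqrtr ?sq_ge0 ?sqrtr_ge0.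
have psj : ps = (sg + j) ^+ 2 by rewrite /ps sg4 psE.
have jps : j ^+ 2 <= ps by rewrite psj lerXn2r ?nnegrE ?addr_ge0 ?(ltW j0)// lerDr.
have psVU : ps <= VU.
  have VUp : 0 <= VU by rewrite -(pmulr_rge0 _ tau0); lra.
  by apply: le_trans (ltW Jneg) _; rewrite ler_piMl.
have epVU : ep * (hv x1 - hu y1) <= j ^+ 2 / 2.
  apply: (@le_trans _ _ (ep * (hm + Ml))); last by lra.
  by apply: ler_wpM2l; [exact: ltW|have := hvh _ Dx1; have := huM _ Dy1; lra].
have hv0 : 0 < hv x1.
  rewrite ltNge; apply/negP => hv0.
  have V0 : chi n ep (hv x1) <= 0.
    by rewrite /chi /pos3 max_l// !expr0n /= add0r; apply: mulr_ge0_le0 => //; exact: ltW.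
  have U0 : - (ep * Ml) <= chi n ep (hu y1).
    have := pos3_ge0 (hu y1) => /(exprn_ge0 n.+2); rewrite /chi.
    have := ler_wpM2l (ltW ep0) (huM _ Dy1); lra.
  have : ep * Ml <= ep * (hm + Ml) by apply: ler_wpM2l; [exact: ltW|lra].
  by move: psVU jps epM; rewrite /VU; lra.
(* On the diagonal [v <= u] makes [VU] nonpositive, whereas [VU] is at least [j ^+ 2]; the extremal
   pair is therefore separated. *)
have sgp : 0 < sg.
  rewrite lt_def sg0' andbT; apply/eqP => sg00; move: sg4; rewrite sg00 expr0n /= => /sq_eq0/eqP.
  rewrite subr_eq0 => /eqP yx; move: psVU jps; rewrite /VU yx.
  have : chi n ep (hv x1) <= chi n ep (hu x1).
    by apply: chim; rewrite /hv /hu lerD2r lerD2r; exact: vu.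
  lra.
have x1r := hvr _ Dx1 hv0.
have VUle : VU <= 3 * (ps / tau).
  have h1 := good _ _ Dx1 Dy1; rewrite -/ps in h1.
  have ps0 : 0 <= ps := le_trans (ltW j20) jps.
  have h2 : j ^+ 2 <= ps / tau by apply: (le_trans jps); rewrite ler_pdivlMr// ler_piMr.
  have h3 : pos3 (hv x1) ^+ n.+2 - pos3 (hu y1) ^+ n.+2 <= 2 * (ps / tau).
    by rewrite mulrA ler_pdivlMr//; lra.
  by rewrite /VU /chi; lra.
have VUhm : VU <= 2 * (hm ^+ 3) ^+ n.+2.
  have h1 : pos3 (hv x1) ^+ n.+2 <= (hm ^+ 3) ^+ n.+2.
    rewrite lerXn2r ?nnegrE ?pos3_ge0 ?exprn_ge0//; try lra.
    by rewrite /pos3 max_r ?(ltW hv0)// lerXn2r ?nnegrE ?(ltW hv0)//; [lra|exact: hvh].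
  have h2 : 0 <= pos3 (hu y1) ^+ n.+2 by rewrite exprn_ge0 ?pos3_ge0.
  by move: psVU; rewrite /VU /chi in VUle *; lra.
have zsg : nrm (y1 - x1) = sg ^+ 2.
  by rewrite /nrm sg4; have -> : sg ^+ 4 = (sg ^+ 2) ^+ 2 by [rewrite -exprM]; rewrite sqrtr_sqr ger0_norm// sqr_ge0.
have sgps : sg ^+ 2 <= ps by rewrite psj lerXn2r ?nnegrE ?addr_ge0 ?(ltW j0)// lerDl ltW.
have zr : nrm (y1 - x1) <= rd / 4.
  rewrite zsg; apply: le_trans sgps _; have := ler_wpM2l (ltW tau0) VUhm; lra.
have y1r : nrm (y1 - y0) <= 3 * (rd / 4).
  have := ler_nrmD (y1 - x1) (x1 - y0); rewrite addrA subrK; lra.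
have inD a : nrm (a - y0) <= rd -> D a by move=> h1; apply/nrm_lerP; first exact: ltW.
have sub a : nrm (a - y0) <= 3 * (rd / 4) -> [set x | dot (x - a) (x - a) <= (rd / 8) ^+ 2] `<=` D.
  move=> ar x /nrm_lerP h1; apply: inD; have := ler_nrmD (x - a) (a - y0).
  by rewrite addrA subrK; have := h1 _; lra.
have r8 : 0 < (rd / 8) ^+ 2 by rewrite exprn_gt0// divr_gt0.
pose e := sg ^- 2 *: (y1 - x1).
have ze : y1 - x1 = sg ^+ 2 *: e by rewrite scalerA mulfV ?scale1r// gt_eqF// exprn_gt0.
apply: (@lip_no_touch R N Omega H u v n ep be bb c0 rd hm LH tau j sg ((rd / 8) ^+ 2) y0 x1 y1 e) => //.
- exact: DO.
- exact: DO.
- lra.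
- lra.
- exact: Hbd.
- by rewrite -zsg; exact: Hlip.
- exact: ltW.
- exact: hvh.
- by rewrite -psj ler_pdivrMr// mulrC; apply: ltW; exact: Jneg.
- by move: psVU jps epVU; rewrite /VU /hv /hu; lra.
- apply: lsc_within_sub lhv; apply: sub; lra.
- apply: lsc_within_sub lhu; exact: sub.
have n3 := @near_nrm_small R (N + N) (rd / 8) (divr_gt0 rd0 (ltr0n _ 8)).
apply: filterS n3 => w w3.
have [w4 w5] := (le_trans (nrm_lsub w) w3, le_trans (nrm_rsub w) w3).
have K1 : K2 (x1 + lsubmx w, y1 + rsubmx w).
  split; apply: inD => /=.
    by rewrite addrAC; apply: le_trans (ler_nrmD _ _) _; lra.
  by rewrite addrAC; apply: le_trans (ler_nrmD _ _) _; lra.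
have := Jmin _ K1; rewrite /J /=.
have -> : y1 + rsubmx w - (x1 + lsubmx w) = y1 - x1 + (rsubmx w - lsubmx w).
  by apply/rowP => i; rewrite !mxE; ring.
rewrite -/(hv x1) -/(hu y1) -/(hv (x1 + _)) -/(hu (y1 + _)); lra.
Qed.

End PairLipschitz.

(** * The two-point Lipschitz estimate *)

Section PairLipschitzEstimate.
Variables (R : realType) (N : nat).
Implicit Types x y : 'rV[R]_N.

(** For fixed [j] the penalty is at least [j ^+ 2], so the estimate is trivial for tiny [tau];
    [good_step] doubles [tau] up to a value [tau0] independent of [j]. Letting [j] tend to 0 gives a
    Lipschitz bound for powers of [hv] and [hu], and near [y0] the powers can be inverted because
    [hu] stays above one half. *)
Lemma pair_lipschitz (Omega : set 'rV[R]_N) (H u v : 'rV[R]_N -> R) y0 (rd LH : R)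
    (D := [set x | dot (x - y0) (x - y0) <= rd ^+ 2]) :
  open Omega -> (forall x, Omega x -> {for x, continuous H}) ->
  viscosity_supersolution Omega H u -> viscosity_subsolution Omega H v ->
  (0 < N)%N -> D `<=` Omega -> 0 < rd -> (forall x, D x -> v x <= u x) ->
  (forall x y, D x -> D y -> `|H x - H y| <= LH * nrm (x - y)) ->
  (forall x, D x -> `|H x| <= LH) -> 0 <= LH -> u y0 = v y0 ->
  exists r L0 : R, [/\ 0 < r, r <= rd, 0 <= L0 &
    forall x y, nrm (x - y0) <= r -> nrm (y - y0) <= r -> v x - u y <= L0 * nrm (x - y)].
Proof.
move=> Oo Hc us vs N0 DO rd0 vu Hlip Hbd LH0 uv0.
have lu := lsc_on_within Oo DO us.1; have lv := usc_on_within Oo DO vs.1.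
have cD : compact D by exact: compact_sqball.
have Dy0 : D y0 by rewrite /D /= subrr dot0l sqr_ge0.
have rd2 : 0 < rd ^+ 2 by rewrite exprn_gt0.
have [xM _ hM] := compact_lsc_min cD (ex_intro _ y0 Dy0) lv.
have [xm _ hmin] := compact_lsc_min cD (ex_intro _ y0 Dy0) lu.
(* Normalizes [hu y0] and [hv y0] to 1, well inside the range where the powers in [chi] are
   active. *)
pose c0 : R := 1 - u y0.
pose hm : R := 1 + `|v xM + c0|.
have hm1 : 1 <= hm by rewrite lerDl.
(* Steep enough for [hv] to be positive only within half the radius, which keeps extremal pairs away
   from the boundary. *)
pose be : R := 4 * hm / rd ^+ 2.
have be0 : 0 < be by rewrite divr_gt0// mulr_gt0//; lra.
pose bb : R := 2 * be * rd.
have bb0 : 0 <= bb := mulr_ge0 (mulr_ge0 (ler0n R 2) (ltW be0)) (ltW rd0).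
pose hv y := v y - be * dot (y - y0) (y - y0) + c0.
pose hu y := u y - be * dot (y - y0) (y - y0) + c0.
have bq x : 0 <= be * dot (x - y0) (x - y0) by rewrite mulr_ge0 ?sq_ge0// ltW.
have hvM x : D x -> hv x <= hm - be * dot (x - y0) (x - y0).
  by move=> /hM h; rewrite /hv /hm; have := ler_norm (v xM + c0); lra.
have hvh x : D x -> hv x <= hm by move=> /hvM; have := bq x; lra.
pose Ml : R := `|u xm - be * rd ^+ 2 + c0|.
have huM x : D x -> - Ml <= hu x.
  move=> Dx; have h1 := hmin _ Dx; have := ler_wpM2l (ltW be0) (Dx : _ <= _) => h2.
  rewrite /Ml /hu; have := ler_norm (- (u xm - be * rd ^+ 2 + c0)); rewrite normrN; lra.
have hvr x : D x -> 0 < hv x -> nrm (x - y0) <= rd / 2.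
  move=> Dx h; have h1 := lt_le_trans h (hvM _ Dx); apply/nrm_lerP; first lra.
  rewrite -(ler_pM2l be0); have -> : be * (rd / 2) ^+ 2 = hm by rewrite /be; field; rewrite gt_eqF.
  lra.
pose Ca : R := N%:R * LH * (2 * (1 + bb) * hm) + 4 * be * N%:R * hm + 8 * N%:R * LH * hm ^+ 2 + 1.
pose n := Num.bound Ca.
have hn : Ca <= (3 * n + 5)%:R / 2.
  have Ca0 : 0 <= Ca.
    have hm0 : 0 <= hm by lra.
    have be0' := ltW be0.
    have NL := mulr_ge0 (ler0n R N) LH0.
    have q1 := mulr_ge0 NL (mulr_ge0 (mulr_ge0 (ler0n R 2) (addr_ge0 ler01 bb0)) hm0).
    have q2 := mulr_ge0 (mulr_ge0 (mulr_ge0 (ler0n R 4) be0') (ler0n R N)) hm0.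
    have q3 := mulr_ge0 (mulr_ge0 (mulr_ge0 (ler0n R 8) (ler0n R N)) LH0) (sqr_ge0 hm).
    rewrite /Ca; lra.
  have h1 := archi_boundP Ca0; rewrite -/n in h1.
  have h2 : 0 <= n%:R :> R by [].
  rewrite natrD natrM; lra.
pose Hh : R := (hm ^+ 3) ^+ n.+2.
have Hh0 : 0 <= Hh by rewrite !exprn_ge0//; lra.
have hm0 : 0 <= hm by lra.
have Fm0 : 0 <= chi1_bound n hm.
  exact: addr_ge0 (mulr_ge0 (ler0n R _) (mulr_ge0 (mulr_ge0 (exprn_ge0 _ (exprn_ge0 _ hm0)) (exprn_ge0 _ hm0)) hm0)) ler01.
pose T : R := 1 + 16 * chi1_bound n hm * (1 + bb) + `|small_loss n N%:R LH bb be hm| + 8 * Hh / rd.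
have p1 := mulr_ge0 (mulr_ge0 (ler0n R 16) Fm0) (addr_ge0 ler01 bb0).
have p2 := divr_ge0 (mulr_ge0 (ler0n R 8) Hh0) (ltW rd0).
have p3 := normr_ge0 (small_loss n N%:R LH bb be hm).
have T0 : 0 < T by rewrite /T; lra.
pose tau0 := T^-1.
have t0 : 0 < tau0 by rewrite invr_gt0.
pose Good j tau := forall x y, D x -> D y ->
  tau * (pos3 (hv x) ^+ n.+2 - pos3 (hu y) ^+ n.+2) <= psi j (dot (y - x) (y - x)).
have step j tau : 0 < j -> 0 < tau -> tau <= tau0 -> Good j (tau / 2) -> Good j tau.
  move=> j0 tau_0 tauT.
  have le1 (c : R) : c <= T -> 0 <= c -> c * tau <= 1.
    move=> cT c_0; apply: (@le_trans _ _ (T * tau0)); last by rewrite mulfV// gt_eqF.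
    by apply: ler_pM => //; exact: ltW.
  have t1 : tau <= 1 by have := le1 1; rewrite mul1r; apply => //; rewrite /T; lra.
  have t2 := le1 _ _ p1; have t3 := le1 _ _ p3; have t4 := le1 _ _ p2.
  apply: (good_step (hm := hm) (Ml := Ml) (LH := LH) Oo Hc us vs N0 DO rd0 vu Hlip Hbd LH0 (ltW be0) hm1 (lexx bb) hn _ huM hvh hvr tau_0 t1) => //.
  - exact: normr_ge0.
  - by apply: t2; rewrite /T; lra.
  - apply: (@le_trans _ _ (`|small_loss n N%:R LH bb be hm| * tau)).
      by apply: ler_wpM2r; [exact: ltW|exact: ler_norm].
    by apply: t3; rewrite /T; lra.
  - have : 8 * Hh / rd * tau <= 1 by apply: t4; rewrite /T; lra.
    by rewrite mulrAC ler_pdivrMr// mul1r.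
have goodj j : 0 < j -> Good j tau0.
  move=> j0; have j2 : 0 < j ^+ 2 by rewrite exprn_gt0.
  have halves i : Good j (tau0 / 2 ^+ i) -> Good j tau0.
    elim: i => [|i IH]; first by rewrite expr0 divr1.
    rewrite exprSr invfM mulrA => h; apply: IH.
    have i0 : 0 < (2 : R) ^+ i by rewrite exprn_gt0.
    apply: step => //; first by rewrite divr_gt0.
    by rewrite ler_pdivrMr// ler_peMr ?(ltW t0)// exprn_ege1//; lra.
  pose i := Num.bound (tau0 * Hh / j ^+ 2).
  apply: (halves i) => x y Dx Dy.
  have h1 : tau0 * Hh / j ^+ 2 <= 2 ^+ i.
    have := archi_boundP (divr_ge0 (mulr_ge0 (ltW t0) Hh0) (ltW j2)); rewrite -/i => /ltW /le_trans; apply.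
    by rewrite -natrX ler_nat ltnW// ltn_expl.
  have i0 : 0 < (2 : R) ^+ i by rewrite exprn_gt0.
  apply: (@le_trans _ _ (j ^+ 2)); last first.
    rewrite /psi lerXn2r ?nnegrE ?addr_ge0 ?sqrtr_ge0 ?(ltW j0)// lerDr; exact: sqrtr_ge0.
  apply: (@le_trans _ _ (tau0 / 2 ^+ i * Hh)).
    apply: ler_wpM2l; first by rewrite divr_ge0// ltW.
    have h2 : 0 <= pos3 (hu y) ^+ n.+2 by rewrite exprn_ge0 ?pos3_ge0.
    have h3 : pos3 (hv x) ^+ n.+2 <= Hh.
      have mx : Num.max 0 (hv x) <= hm by rewrite ge_max hm0 hvh.
      have mx0 : 0 <= Num.max 0 (hv x) by rewrite le_max lexx.
      by rewrite /Hh /pos3 !lerXn2r ?nnegrE ?exprn_ge0.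
    lra.
  by move: h1; rewrite ler_pdivrMr// mulrAC ler_pdivrMr// [leRHS]mulrC.
have lim x y : D x -> D y -> tau0 * (pos3 (hv x) ^+ n.+2 - pos3 (hu y) ^+ n.+2) <= nrm (x - y).
  move=> Dx Dy; rewrite nrmB; apply/ler_addgt0Pr => ep ep0.
  pose sg := Num.sqrt (nrm (y - x)).
  have sg0 : 0 <= sg by exact: sqrtr_ge0.
  have sgE : sg ^+ 2 = nrm (y - x) by rewrite sqr_sqrtr// nrm_ge0.
  pose j : R := Num.min 1 (ep / (2 * sg + 1)).
  have q0 : 0 < 2 * sg + 1 by lra.
  have j0 : 0 < j by rewrite lt_min ltr01 divr_gt0.
  have j1 : j <= 1 by rewrite ge_min lexx.
  have jep : j * (2 * sg + 1) <= ep by rewrite -ler_pdivlMr// ge_min lexx orbT.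
  apply: (le_trans (goodj j j0 x y Dx Dy)).
  rewrite /psi -/(nrm _) -/sg.
  have -> : (sg + j) ^+ 2 = sg ^+ 2 + j * (2 * sg + j) by ring.
  rewrite sgE lerD2l; apply: le_trans jep; apply: ler_wpM2l; [exact: ltW|lra].
have near_u : \forall x \near y0, D x -> u y0 - 1 / 4 < u x by apply: (lu y0 Dy0 (u y0 - 1 / 4)); rewrite gtrBl divr_gt0.
have near_q : \forall x \near y0, be * dot (x - y0) (x - y0) < 1 / 4.
  apply/near_sqP; exists (1 / (4 * be)); first by rewrite divr_gt0// mulr_gt0.
  move=> x h; have be4 : 0 < 4 * be by exact: mulr_gt0.
  by move: h; rewrite (ltr_pdivlMr _ _ be4) => h; lra.
have near_h : \forall x \near y0, (D x -> u y0 - 1 / 4 < u x) /\ be * dot (x - y0) (x - y0) < 1 / 4.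
  by apply: (@filterI _ _ (nbhs_filter y0)).
have [r1 r10 hr1] := (near_sqP y0 _).1 near_h.
pose r : R := Num.min rd (Num.sqrt r1 / 2).
have sr0 : 0 < Num.sqrt r1 by rewrite sqrtr_gt0.
have r0 : 0 < r by rewrite lt_min rd0 divr_gt0.
have rrd : r <= rd by rewrite ge_min lexx.
have inr x : nrm (x - y0) <= r -> D x /\ 1 / 2 < hu x.
  move=> xr; have Dx : D x by apply/nrm_lerP; [exact: ltW|exact: le_trans rrd].
  have [|h1 h2] := hr1 x.
    have : nrm (x - y0) < Num.sqrt r1.
      by apply: le_lt_trans xr _; apply: (@le_lt_trans _ _ (Num.sqrt r1 / 2)); [rewrite ge_min lexx orbT|lra].
    by rewrite ltr_nrm_sq ?(ltW sr0)// sqr_sqrtr ?(ltW r10).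
  by split => //; have := h1 Dx; rewrite /hu /c0; lra.
pose k : R := (2^-1 ^+ 3) ^+ n.+2.
have k0 : 0 < k by rewrite !exprn_gt0// invr_gt0.
exists r, (bb + (tau0 * k)^-1); split => //.
  by rewrite addr_ge0// invr_ge0 ltW// mulr_gt0.
(* The gap of [hv] and [hu] gives the slope [(tau0 * k)^-1]; undoing the paraboloid adds [bb]. *)
move=> x y xr yr; have [Dx _] := inr x xr; have [Dy hy] := inr y yr.
have nx := nrm_ge0 (x - y).
have qq : be * dot (x - y0) (x - y0) - be * dot (y - y0) (y - y0) <= bb * nrm (x - y).
  have -> : be * dot (x - y0) (x - y0) - be * dot (y - y0) (y - y0) = be * dot (x - y) ((x - y0) + (y - y0)).
    have -> : x - y = (x - y0) - (y - y0) by rewrite opprB addrA subrK.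
    by move: (x - y0) (y - y0) => a b; rewrite !dotE (dotC b a); ring.
  have -> : bb * nrm (x - y) = be * (nrm (x - y) * (2 * rd)) by rewrite /bb; ring.
  apply: ler_wpM2l; first exact: ltW.
  apply: (le_trans (ler_norm _)); apply: (le_trans (ler_dot _ _)).
  by apply: ler_wpM2l => //; apply: (le_trans (ler_nrmD _ _)); lra.
have vE : v x = hv x + be * dot (x - y0) (x - y0) - c0 by rewrite /hv; ring.
have uE : u y = hu y + be * dot (y - y0) (y - y0) - c0 by rewrite /hu; ring.
have tk0 : 0 < tau0 * k by exact: mulr_gt0.
have gap : hv x - hu y <= (tau0 * k)^-1 * nrm (x - y).
  have [le|lt] := leP (hv x) (hu y).
    by apply: (@le_trans _ _ 0); [lra|rewrite mulr_ge0// invr_ge0 ltW].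
  rewrite mulrC ler_pdivlMr//; apply: le_trans (lim x y Dx Dy).
  have -> : (hv x - hu y) * (tau0 * k) = tau0 * (k * (hv x - hu y)) by ring.
  apply: ler_wpM2l; first exact: ltW.
  have hy0 : 0 <= hu y by lra.
  have hx0 : 0 <= hv x by lra.
  rewrite /pos3 (max_r hy0) (max_r hx0).
  have powE (t : R) : (t ^+ 3) ^+ n.+2 = (t ^+ 3) ^+ n.+1 * t ^+ 2 * t by rewrite exprSr; ring.
  have Zle (s t : R) : 0 <= s -> s <= t -> (s ^+ 3) ^+ n.+1 * s ^+ 2 <= (t ^+ 3) ^+ n.+1 * t ^+ 2.
    move=> s0 st; have t_0 := le_trans s0 st.
    by apply: ler_pM; rewrite ?exprn_ge0// ?lerXn2r ?nnegrE ?exprn_ge0.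
  have h2 : (0 : R) <= 2^-1 by rewrite invr_ge0.
  have kY : k <= (hu y ^+ 3) ^+ n.+1 * hu y ^+ 2.
    apply: (@le_trans _ _ ((2^-1 ^+ 3) ^+ n.+1 * 2^-1 ^+ 2)); last by apply: Zle => //; lra.
    rewrite /k powE; apply: ler_piMr; last by rewrite invf_le1// ler1n.
    by rewrite mulr_ge0 ?exprn_ge0.
  have XY := Zle _ _ hy0 (ltW lt); have d0 : 0 <= hv x - hu y by lra.
  rewrite !powE; have := ler_wpM2r d0 kY; have := ler_wpM2r hx0 XY; lra.
by rewrite mulrDl vE uE; lra.
Qed.

End PairLipschitzEstimate.

(** * Openness of the contact set and conclusion *)

Section Contact.
Variables (R : realType) (N : nat).
Implicit Types x y z : 'rV[R]_N.

Lemma locally_lipschitz_ball (Omega : set 'rV[R]_N) (H : 'rV[R]_N -> R) x0 :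
  open Omega -> locally_lipschitz Omega H -> Omega x0 ->
  exists rd LH : R, let D := [set x | dot (x - x0) (x - x0) <= rd ^+ 2] in
  [/\ 0 < rd, 0 <= LH, D `<=` Omega,
    forall x y, D x -> D y -> `|H x - H y| <= LH * nrm (x - y) &
    forall x, D x -> `|H x| <= LH].
Proof.
move=> Oo Hl Ox; have [U nU lip] := Hl x0 Ox.
have [M M0 HM] := pinfty_ex_gt0 lip.
have nUO : nbhs x0 (U `&` Omega) by apply: filterI => //; exact: open_nbhs_nbhs.
have [r r0 hr] := (near_sqP x0 _).1 nUO.
have sr0 : 0 < Num.sqrt r by rewrite sqrtr_gt0.
have sub x : dot (x - x0) (x - x0) <= (Num.sqrt r / 2) ^+ 2 -> (U `&` Omega) x.
  move=> h; apply: hr; apply: le_lt_trans h _; rewrite expr_div_n sqr_sqrtr ?(ltW r0)//; lra.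
have HL x y : dot (x - x0) (x - x0) <= (Num.sqrt r / 2) ^+ 2 ->
    dot (y - x0) (y - x0) <= (Num.sqrt r / 2) ^+ 2 -> `|H x - H y| <= M * nrm (x - y).
  move=> hx hy; apply: (le_trans (HM (x, y) (conj (sub _ hx) (sub _ hy)))) => /=.
  by rewrite ler_pM2l// norm_le_nrm.
exists (Num.sqrt r / 2), (M + (`|H x0| + M * (Num.sqrt r / 2))); split.
- by rewrite divr_gt0.
- by rewrite !addr_ge0 ?mulr_ge0 ?divr_ge0 ?(ltW M0) ?(ltW sr0).
- by move=> x /sub[].
- move=> x y hx hy; apply: (le_trans (HL x y hx hy)); apply: ler_wpM2r; first exact: nrm_ge0.
  by rewrite lerDl addr_ge0// mulr_ge0 ?divr_ge0 ?(ltW M0) ?(ltW sr0).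
- move=> x hx.
  have h0 : dot (x0 - x0) (x0 - x0) <= (Num.sqrt r / 2) ^+ 2 by rewrite subrr dot0l sqr_ge0.
  have h1 := HL x x0 hx h0.
  have h2 : nrm (x - x0) <= Num.sqrt r / 2 by apply/nrm_lerP => //; lra.
  have h3 := ler_wpM2l (ltW M0) h2.
  have := ler_normD (H x - H x0) (H x0); rewrite subrK; lra.
Qed.

Lemma compact_sublevel (T : topologicalType) (K : set T) (f : T -> R) (a : R) :
  compact K -> lsc_within K f -> compact (K `&` [set t | f t <= a]).
Proof.
move=> Kc lf F PF FA.
have FK : F K by apply: filterS FA => t [].
have [t [Kt ct]] := Kc F PF FK.
exists t; split => //; split => //=; rewrite leNgt; apply/negP => at_.
have [s [[Ks fs] /(_ Ks)]] := ct _ _ FA (lf t Kt a at_).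
by rewrite ltNge fs.
Qed.

(** Every point [z0] close enough to [xs] is a contact point: otherwise a contact point nearest to
    [z0] would contradict [hopf]. *)
Lemma contact_open (Omega : set 'rV[R]_N) (H u v : 'rV[R]_N -> R) xs :
  (0 < N)%N -> open Omega -> locally_lipschitz Omega H ->
  viscosity_supersolution Omega H u -> viscosity_subsolution Omega H v ->
  (forall x, Omega x -> v x <= u x) -> Omega xs -> u xs = v xs ->
  \forall x \near xs, Omega x /\ u x = v x.
Proof.
move=> N0 Oo Hl us vs vu Oxs uvs.
have Hc x : Omega x -> {for x, continuous H}.
  move=> Ox; have [rd [LH [rd0 LH0 DO Hlip _]]] := locally_lipschitz_ball Oo Hl Ox.
  apply: (@cvgrPdist_le _ _ _ (nbhs x) (nbhs_filter x) H (H x)).2 => ep ep0; apply/near_sqP.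
  have L1 : 0 < LH + 1 by lra.
  exists (Num.min (rd ^+ 2) ((ep / (LH + 1)) ^+ 2)); first by rewrite lt_min !exprn_gt0// divr_gt0.
  move=> y; rewrite lt_min => /andP[y1 y2].
  have h0 : dot (x - x) (x - x) <= rd ^+ 2 by rewrite subrr dot0l sqr_ge0.
  apply: (le_trans (Hlip x y h0 (ltW y1))); rewrite nrmB.
  have : nrm (y - x) <= ep / (LH + 1) by apply/nrm_lerP; [rewrite divr_ge0 ?(ltW ep0) ?(ltW L1)|exact: ltW].
  rewrite ler_pdivlMr//; have := nrm_ge0 (y - x); lra.
have [rd [LH [rd0 LH0 DO Hlip Hbd]]] := locally_lipschitz_ball Oo Hl Oxs.
have [r [L0 [r0 rrd L00 pair]]] := pair_lipschitz Oo Hc us vs N0 DO rd0 (fun x Dx => vu x (DO x Dx)) Hlip Hbd LH0 uvs.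
pose D := [set x | dot (x - xs) (x - xs) <= r ^+ 2].
have DrO : D `<=` Omega.
  move=> x; rewrite /D /= => h; apply: DO => /=; apply: (le_trans h).
  by rewrite lerXn2r ?nnegrE ?(ltW r0) ?(ltW rd0).
have inD x : nrm (x - xs) <= r -> D x by move=> h; apply/nrm_lerP => //; exact: ltW.
have inrd x : nrm (x - xs) <= r -> dot (x - xs) (x - xs) <= rd ^+ 2.
  by move=> h; apply/nrm_lerP; [exact: ltW|exact: le_trans rrd].
apply/near_sqP; exists ((r / 4) ^+ 2); first by rewrite exprn_gt0// divr_gt0.
move=> z0; rewrite -ltr_nrm_sq; last by rewrite divr_ge0// ltW.
move=> z0r; have Oz0 : Omega z0 by apply: DrO; apply: inD; lra.
split => //; apply/eqP; apply: contraT => uvz; exfalso.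
have luv : lsc_within D (fun x => u x + - v x).
  by apply: lsc_withinD; [exact: lsc_on_within us.1|exact: usc_on_within vs.1].
have cK : compact (D `&` [set x | u x + - v x <= 0]) by apply: compact_sublevel => //; exact: compact_sqball.
have lq : lsc_within (D `&` [set x | u x + - v x <= 0]) (fun x => dot (x - z0) (x - z0)).
  apply: lsc_within_cts => x _.
  apply: (@continuous_comp _ _ _ (fun x : 'rV[R]_N => x - z0) (fun x : 'rV[R]_N => dot x x)); last exact: cts_sq.
  by apply: (@continuousB _ _ _ (fun x : 'rV[R]_N => x) (fun _ => z0)); [exact: cvg_id|exact: cst_continuous].
have Kxs : (D `&` [set x | u x + - v x <= 0]) xs.
  by split; [apply: inD; rewrite subrr nrm0 ltW|rewrite /= uvs subrr].
(* A nearest contact point exists because the contact set in [D] is a sublevel set of the lower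
   semicontinuous [u - v], hence compact. *)
have [y1 [Dy1 uv1] ymin] := compact_lsc_min cK (ex_intro _ xs Kxs) lq.
have {}uv1 : u y1 = v y1 by apply/eqP; rewrite eq_le vu ?andbT; [rewrite -subr_le0|exact: DrO].
have y1z : nrm (y1 - z0) < r / 4.
  rewrite ltr_nrm_sq; last by rewrite divr_ge0// ltW.
  apply: (le_lt_trans (ymin xs Kxs)); rewrite -ltr_nrm_sq; last by rewrite divr_ge0// ltW.
  by rewrite nrmB.
have y1s : nrm (y1 - xs) <= r / 2.
  have := ler_nrmD (y1 - z0) (z0 - xs); rewrite addrA subrK; lra.
(* The ball about the midpoint [z] through [y1] lies in the ball about [z0] through [y1] and meets
   its boundary only at [y1], so [y1] is its only contact point. *)
pose z := 2^-1 *: (z0 + y1).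
have yz : y1 - z = 2^-1 *: (y1 - z0) by apply/rowP => i; rewrite !mxE; field.
have zz0 : z - z0 = 2^-1 *: (y1 - z0) by apply/rowP => i; rewrite !mxE; field.
have y1z0 : y1 - z0 != 0.
  by apply/eqP => /eqP; rewrite subr_eq0 => /eqP yE; move: uvz; rewrite -yE uv1 eqxx.
have r4 : 0 < r / 4 by rewrite divr_gt0.
have sub x : dot (x - y1) (x - y1) <= (r / 4) ^+ 2 -> nrm (x - xs) <= r.
  move=> /nrm_lerP h; have := ler_nrmD (x - y1) (y1 - xs); rewrite addrA subrK; have := h (ltW r4); lra.
apply: (@hopf R N Omega H u v y1 z (r / 4) L0 LH) => //.
- by move=> x /sub/inD/DrO.
- by move=> x y /sub hx /sub hy; exact: pair.
- by move=> x y /sub/inrd hx /sub/inrd hy; exact: Hlip.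
- by move=> x /sub/inrd hx; exact: Hbd.
- by rewrite yz dotZl dotZr !mulr_gt0 ?invr_gt0// sq_gt0.
move=> x /sub/inD Dx xz uvx.
have h1 := ymin x (conj Dx (_ : u x + - v x <= 0)); rewrite /= uvx subrr in h1.
have {}h1 := h1 (lexx 0).
rewrite yz in xz.
have xE : x - z0 = (x - z) + 2^-1 *: (y1 - z0) by rewrite -zz0 addrA subrK.
have xyE : x - y1 = (x - z) - 2^-1 *: (y1 - z0) by rewrite -yz opprB addrA subrK.
apply/eqP; rewrite -subr_eq0; apply/eqP/sq_eq0/eqP; rewrite eq_le sq_ge0 andbT xyE.
move: h1 xz; rewrite xE; move: (x - z) (y1 - z0) => a b.
rewrite !dotDl !dotDr !dotNl !dotNr !dotZl !dotZr (dotC b a); lra.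
Qed.

End Contact.

Theorem theorem2p1 (R : realType) (N : nat) (N_ge2 : (2 <= N)%N)
    (Omega : set 'rV[R]_N) (Omega_open : open Omega)
    (Omega_connected : connected Omega) (Omega_neq0 : Omega !=set0)
    (H : 'rV[R]_N -> R) (H_lip : locally_lipschitz Omega H)
    (u v : 'rV[R]_N -> R)
    (u_super : viscosity_supersolution Omega H u)
    (v_sub : viscosity_subsolution Omega H v)
    (v_le_u : forall x, Omega x -> v x <= u x)
    (x0 : 'rV[R]_N) (Omega_x0 : Omega x0) (u_eq_v_x0 : u x0 = v x0) :
  forall x, Omega x -> u x = v x.
Proof.
have N0 : (0 < N)%N by exact: ltnW.
pose K := [set x | Omega x /\ u x = v x].
suff KO : K = Omega by move=> x; rewrite -KO => -[].
have subK : K = Omega `&` K by apply/seteqP; split => x; [case|case].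
apply: Omega_connected.
- by exists x0.
- exists K; last exact: subK.
  rewrite openE => x [Ox ux]; exact: (contact_open N0 Omega_open H_lip u_super v_sub v_le_u Ox ux).
(* Relative closedness: the set where [v < u] is open, since [u - v] is lower semicontinuous, and
   its complement meets [Omega] in the contact set. *)
exists (~` [set x | Omega x /\ v x < u x]).
  apply: open_closedC; rewrite openE => x [Ox vux].
  pose m := (u x + v x) / 2.
  have lu := lsc_on_within Omega_open (@subset_refl _ Omega) u_super.1.
  have lv := usc_on_within Omega_open (@subset_refl _ Omega) v_sub.1.
  have n1 := lu x Ox m (_ : m < u x); have n2 := lv x Ox (- m) (_ : - m < - v x).
  have h1 : m < u x by rewrite /m; lra.
  have h2 : - m < - v x by rewrite /m; lra.
  have nO : nbhs x Omega by exact: open_nbhs_nbhs.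
  apply: (@filterS3 _ _ (nbhs_filter x) _ _ _ _ _ nO (n1 h1) (n2 h2)) => y Oy a b; split => //.
  by have := a Oy; have := b Oy; lra.
apply/seteqP; split => x.
- by move=> [Ox ux]; split => //=; case=> _; rewrite ux ltxx.
- move=> [Ox /= nx]; split => //; apply/eqP; rewrite eq_le v_le_u// andbT leNgt.
  by apply/negP => h; apply: nx.
Qed.
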